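(* Let $\mathbf k$ be an algebraically closed field of characteristic $0$, $S=\mathbf k[[y,x_2,\dots,x_r]]$, let $0\neq f\in(y,x_2,\dots,x_r)^2$ and let $d>2$ be an integer. Then $f$ has finite $d$-MF type if and only if, after a possible change of variables, $f$ and $d$ are one of the following: $(A_1)$ $f=y^2+x_2^2+\cdots+x_r^2$ and $d>2$ arbitrary; $(A_2)$ $f=y^3+x_2^2+\cdots+x_r^2$ and $d\in\{3,4,5\}$; $(A_3)$ $f=y^4+x_2^2+\cdots+x_r^2$ and $d=3$; $(A_4)$ $f=y^5+x_2^2+\cdots+x_r^2$ and $d=3$.
   Context: A matrix factorization of $f$ with $d$ factors is a $d$-tuple $X=(\phi_1:F_2\to F_1,\phi_2:F_3\to F_2,\dots,\phi_d:F_1\to F_d)$ of homomorphisms between finitely generated free $S$-modules of the same rank such that $\phi_1\phi_2\cdots\phi_d=f\cdot 1_{F_1}$. A morphism $X\to X'=(\phi'_1,\dots,\phi'_d)$ is a tuple $(\alpha_1,\dots,\alpha_d)$ of $S$-linear maps $\alpha_i:F_i\to F'_i$ with $\alpha_i\phi_i=\phi'_i\alpha_{i+1}$ for all $i$ (indices mod $d$); these form an additive category $\mathrm{MF}_S^d(f)$ with componentwise direct sums. We say $f$ has finite $d$-MF type if $\mathrm{MF}_S^d(f)$ has only finitely many indecomposable objects up to isomorphism. *)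

(* Defs.v *)
From HB Require Import structures.
From mathcomp Require Import all_boot all_order all_algebra.
Set Implicit Arguments. Unset Strict Implicit. Unset Printing Implicit Defensive.
Import Order.TTheory GRing.Theory.
Local Open Scope ring_scope.

Section PowerSeries.
Variables (k : nzRingType) (n : nat).

Definition mon := {ffun 'I_n -> nat}.
Definition mon0 : mon := [ffun=> 0%N].
Definition mdeg (m : mon) : nat := (\sum_(i < n) m i)%N.
Definition msub (m a : mon) : mon := [ffun i => (m i - a i)%N].
Definition mone (i : 'I_n) : mon := [ffun j => nat_of_bool (j == i)].

Definition mons_le (B : nat) : seq mon :=
  [seq [ffun i => nat_of_ord (t i)] | t : {ffun 'I_n -> 'I_B.+1}].
Definition divs (m : mon) : seq mon :=
  filter (fun a : mon => [forall i, a i <= m i]%N) (mons_le (\max_(i < n) m i)%N).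
Definition mons_upto (D : nat) : seq mon :=
  filter (fun a : mon => mdeg a <= D)%N (mons_le D).

Definition series := mon -> k.
Definition szero : series := fun _ => 0.
Definition sone : series := fun m => if m == mon0 then 1 else 0.
Definition sadd (f g : series) : series := fun m => f m + g m.
Definition smul (f g : series) : series :=
  fun m => \sum_(a <- divs m) f a * g (msub m a).
Definition spow (f : series) (e : nat) : series := iter e (smul f) sone.
Definition svar (i : 'I_n) : series := fun m => if m == mone i then 1 else 0.

Definition in_msq (f : series) : Prop := forall m, (mdeg m < 2)%N -> f m = 0.

(* substitution z_i |-> phi i (phi i in the maximal ideal): the continuous
   k-algebra endomorphism g |-> g(phi_0,...,phi_{n-1}).  The coefficient of
   z^a only involves monomials z^m with deg m <= deg a. *)
Definition monpow (phi : 'I_n -> series) (m : mon) : series :=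
  \big[smul/sone]_(i < n) spow (phi i) (m i).
Definition subst (phi : 'I_n -> series) (g : series) : series :=
  fun a => \sum_(m <- mons_upto (mdeg a)) g m * monpow phi m a.
(* a change of variables = a (continuous) k-algebra automorphism of S *)
Definition coord_change (phi : 'I_n -> series) : Prop :=
  (forall i, phi i mon0 = 0) /\ bijective (subst phi).

(* matrices over S: p x q, acting on column vectors (maps S^q -> S^p) *)
Definition smat (p q : nat) := 'I_p -> 'I_q -> series.
Definition mmul p q s (A : smat p q) (B : smat q s) : smat p s :=
  fun i j => \big[sadd/szero]_(l < q) smul (A i l) (B l j).
Definition mid p : smat p p := fun i j => if i == j then sone else szero.
Definition mscal (f : series) p : smat p p := fun i j => if i == j then f else szero.
Definition bdiag p q (A : smat p p) (B : smat q q) : smat (p + q) (p + q) :=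
  fun i j => match split i, split j with
             | inl a, inl b => A a b
             | inr a, inr b => B a b
             | _, _ => szero end.

Section MF.
Variables (d : nat) (f : series).

Definition mprod p (phi : 'I_d -> smat p p) : smat p p :=
  foldr (fun i acc => mmul (phi i) acc) (@mid p) (enum 'I_d).

(* matrix factorization of f with d factors: phi_i : F_{i+1} -> F_i,
   all F_i = S^rk, and phi_0 ... phi_{d-1} = f * 1 *)
Record MF := { mf_rk : nat;
               mf_phi : 'I_d -> smat mf_rk mf_rk;
               mf_eq : mprod mf_phi = @mscal f mf_rk }.

Definition is_mor p q (phi : 'I_d -> smat p p) (psi : 'I_d -> smat q q)
  (al : 'I_d -> smat q p) : Prop :=
  forall i, mmul (al i) (phi i) = mmul (psi i) (al (ordS i)).

Definition iso_raw p q (phi : 'I_d -> smat p p) (psi : 'I_d -> smat q q) : Prop :=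
  exists (al : 'I_d -> smat q p) (be : 'I_d -> smat p q),
    [/\ is_mor phi psi al, is_mor psi phi be,
        forall i, mmul (be i) (al i) = @mid p &
        forall i, mmul (al i) (be i) = @mid q].

Definition mf_iso (X Y : MF) : Prop := iso_raw (@mf_phi X) (@mf_phi Y).

Definition dsum_phi (X Y : MF) : 'I_d -> smat (mf_rk X + mf_rk Y) (mf_rk X + mf_rk Y) :=
  fun i => bdiag (@mf_phi X i) (@mf_phi Y i).

Definition indecomposable (X : MF) : Prop :=
  (0 < mf_rk X)%N /\
  ~ exists Y Z : MF, [/\ (0 < mf_rk Y)%N, (0 < mf_rk Z)%N &
                       iso_raw (@mf_phi X) (@dsum_phi Y Z)].

Definition finite_MF_type : Prop :=
  exists (N : nat) (L : 'I_N -> MF),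
    forall X : MF, indecomposable X -> exists i, mf_iso X (L i).

End MF.
End PowerSeries.

(* normal form A_j in k[[y, x_2, ..., x_{n+1}]]:  y^(j+1) + x_2^2 + ... ;
   y is variable 0, x_{i+2} is variable lift ord0 i *)
Definition Anf (k : nzRingType) (j n : nat) : series k n.+1 :=
  sadd (spow (svar k ord0) j.+1)
       (\big[@sadd k n.+1/@szero k n.+1]_(i < n) spow (svar k (lift ord0 i)) 2).

Definition right_equiv (k : nzRingType) (n : nat) (f g : series k n) : Prop :=
  exists phi, coord_change phi /\ f = subst phi g.

Arguments Anf k j n : clear implicits.

(* Main.v *)
(** Knörrer's argument shows that [f] and [f + x^2] have finite [d]-MF type
    simultaneously: a factorization [X] of [f] gives a factorization [K X] of
    [f + x^2] whose reduction mod [x] contains [X], and conversely every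
    factorization of [f + x^2] is a retract of some [K X].  By the splitting lemma
    [f] is a sum of squares and a series [g] of order at least 3, so one is left
    with [g].

    Finite cases: for [y^m + x^2] and the listed [d] there are binary forms
    [P, Q, R] (Klein's invariants of the dihedral, tetrahedral, octahedral and
    icosahedral groups) with [a P^m + b Q^2 + c R^d = 0].  Sending [y, x] to multiples of
    [P, Q] makes [T = k[[u, v]]] a finite free [k[[y, x]]]-module in which
    [y^m + x^2] is, up to a constant, [R^d].  For a factorization [phi] the solutions
    in [T^p] of [phi_i v_{i+1} = R v_i] form a free [T]-module, being a kernel over a
    regular ring of dimension two; since [R^(d-1)] is not in [(P, Q)], a linear
    form on [T] with value 1 at [R^(d-1)] makes [phi] a retract of a sum of copies
    of [(R, ..., R)] acting on [T].

    Infinite cases: [x^2] in two variables has the factorizations built from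
    [[x, y^j], [0, -x]]; a series of order 3 in at least two variables has a
    factorization of tensor product type that deforms along the pencil of linear
    forms; for [y^m h] one uses chains of lattices in [k((y))^2] or [k((y))^3]
    attached to lines or flags having a modulus of cross-ratio type. *)
Require Import Defs.
From HB Require Import structures.
From mathcomp Require Import all_boot all_order all_algebra.
From mathcomp Require Import boolp zify ring.
Set Implicit Arguments. Unset Strict Implicit. Unset Printing Implicit Defensive.
Import Order.TTheory GRing.Theory.
Local Open Scope ring_scope.

(** * The ring of power series *)

(** Finite type is never tested by listing indecomposables. It is equivalent to the existence of one
    finite list such that the identity of every factorization is a sum of maps through members of
    the list ([facid]). This condition passes to retracts, sums and images under additive functors,
    so the Knörrer steps and the finite cases only have to exhibit retracts. The way back to
    indecomposables uses that their endomorphisms behave as in a local ring, and this is where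
    completeness of the power series ring enters. On the infinite side, finite type leaves finitely
    many isomorphism classes in each bounded rank. Hence a sequence of factorizations of fixed rank,
    indexed by the natural numbers, has two isomorphic members, and no member has to be shown
    indecomposable. In the families with a modulus, the modulus runs through the natural numbers,
    which stay distinct in characteristic 0. The Knörrer steps need a nonzero series, because only
    then do all rotations of the product agree; a zero remainder after splitting off squares is
    therefore handled from one square with free variables. *)

Section Monomials.
Variable n : nat.
Implicit Types a b c m : mon n.

Definition madd a b : mon n := [ffun i => (a i + b i)%N].
Definition mle a b := [forall i, (a i <= b i)%N].

Lemma mleP a b : reflect (forall i, (a i <= b i)%N) (mle a b).
Proof. exact: forallP. Qed.





Lemma maddK a b : msub (madd a b) a = b.
Proof. by apply/ffunP => i; rewrite !ffunE addKn. Qed.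

Lemma msubK a m : mle a m -> madd a (msub m a) = m.
Proof. by move/mleP => h; apply/ffunP => i; rewrite !ffunE subnKC. Qed.

Lemma msubKK a m : mle a m -> msub m (msub m a) = a.
Proof. by move/mleP => h; apply/ffunP => i; rewrite !ffunE subKn. Qed.

Lemma mle_madd a b : mle a (madd a b).
Proof. by apply/mleP => i; rewrite ffunE leq_addr. Qed.

Lemma mlexx a : mle a a.
Proof. exact/mleP. Qed.

Lemma mle_trans b a c : mle a b -> mle b c -> mle a c.
Proof. by move=> /mleP h1 /mleP h2; apply/mleP => i; exact: leq_trans (h2 i). Qed.

Lemma mle_msub m a : mle (msub m a) m.
Proof. by apply/mleP => i; rewrite ffunE leq_subr. Qed.

Lemma mdegD a b : mdeg (madd a b) = (mdeg a + mdeg b)%N.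
Proof. by rewrite /mdeg -big_split; apply: eq_bigr => i _; rewrite ffunE. Qed.

Lemma mdeg0 : mdeg (mon0 n) = 0%N.
Proof. by rewrite /mdeg big1 // => i _; rewrite ffunE. Qed.

Lemma mdeg_le a i : (a i <= mdeg a)%N.
Proof. by rewrite /mdeg (bigD1 i) //= leq_addr. Qed.

Lemma mdeg_eq0 a : (mdeg a == 0%N) = (a == mon0 n).
Proof.
apply/idP/eqP => [/eqP h|->]; last by rewrite mdeg0.
by apply/ffunP => i; rewrite ffunE; apply/eqP; rewrite -leqn0 -h mdeg_le.
Qed.

Lemma mdeg_mone (i : 'I_n) : mdeg (mone i) = 1%N.
Proof.
rewrite /mdeg (bigD1 i) //= big1 ?ffunE ?eqxx // => j ne.
by rewrite ffunE (negPf ne).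
Qed.

Lemma mle_mdeg a b : mle a b -> (mdeg a <= mdeg b)%N.
Proof. by move=> /msubK <-; rewrite mdegD leq_addr. Qed.

Lemma mle0 m : mle m (mon0 n) = (m == mon0 n).
Proof.
apply/idP/eqP => [/mle_mdeg|->]; last exact: mlexx.
by rewrite mdeg0 leqn0 mdeg_eq0 => /eqP.
Qed.

Lemma mem_mons_le B m : (m \in mons_le n B) = [forall i, (m i <= B)%N].
Proof.
apply/mapP/forallP => [[t _ ->] i|h]; first by rewrite ffunE -ltnS ltn_ord.
exists [ffun i => inord (m i)]; first by rewrite mem_enum.
by apply/ffunP => i; rewrite !ffunE inordK // ltnS h.
Qed.

Lemma uniq_mons_le B : uniq (mons_le n B).
Proof.
rewrite map_inj_uniq ?enum_uniq // => s t /ffunP h.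
by apply/ffunP => i; have := h i; rewrite !ffunE => /val_inj.
Qed.

Lemma mem_divs m a : (a \in divs m) = mle a m.
Proof.
rewrite mem_filter mem_mons_le -/(mle a m); case: mleP => //= h.
apply/forallP => i; apply: leq_trans (h i) _.
exact: (leq_bigmax_cond (F := fun i => m i)).
Qed.

Lemma uniq_divs m : uniq (divs m).
Proof. by rewrite filter_uniq ?uniq_mons_le. Qed.

Lemma mem_mons_upto D m : (m \in mons_upto n D) = (mdeg m <= D)%N.
Proof.
rewrite mem_filter mem_mons_le; case: leqP => //= h.
by apply/forallP => i; apply: leq_trans (mdeg_le m i) h.
Qed.

Lemma uniq_mons_upto D : uniq (mons_upto n D).
Proof. by rewrite filter_uniq ?uniq_mons_le. Qed.

End Monomials.


Section BigDivs.
Variables (n : nat) (V : nmodType).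
Implicit Types (a b m : mon n).

Lemma big_divs_rev m (F : mon n -> mon n -> V) :
  \sum_(a <- divs m) F a (msub m a) = \sum_(a <- divs m) F (msub m a) a.
Proof.
have inj : {in divs m &, injective (msub m)}.
  by move=> a b; rewrite !mem_divs => ha hb /(congr1 (msub m)); rewrite !msubKK.
have pe : perm_eq [seq msub m a | a <- divs m] (divs m).
  apply: uniq_perm; rewrite ?map_inj_in_uniq ?uniq_divs // => a.
  rewrite mem_divs; apply/mapP/idP => [[b _ ->]|ha]; first exact: mle_msub.
  exists (msub m a); first by rewrite mem_divs mle_msub.
  by rewrite msubKK.
rewrite -(perm_big _ pe) /= big_map; apply: eq_big_seq => a; rewrite mem_divs => ha.
by rewrite msubKK.
Qed.

Lemma big_divs_sub m a (F : mon n -> V) : mle a m ->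
  \sum_(b <- divs a) F b = \sum_(b <- divs m | mle b a) F b.
Proof.
move=> am; rewrite -[RHS]big_filter; apply: perm_big.
apply: uniq_perm; [exact: uniq_divs|exact/filter_uniq/uniq_divs|move=> b].
rewrite [RHS]mem_filter !mem_divs; case: (boolP (mle b a)) => //= h.
by rewrite (mle_trans h am).
Qed.

Lemma big_divs_up m b (F : mon n -> V) : mle b m ->
  \sum_(a <- divs m | mle b a) F a = \sum_(c <- divs (msub m b)) F (madd b c).
Proof.
move=> bm; rewrite -[LHS]big_filter.
have pe : perm_eq [seq a <- divs m | mle b a] [seq madd b c | c <- divs (msub m b)].
  apply: uniq_perm; first exact/filter_uniq/uniq_divs.
    rewrite map_inj_uniq ?uniq_divs // => c c' /(congr1 (fun x => msub x b)).
    by rewrite !maddK.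
  move=> a; rewrite mem_filter mem_divs; apply/andP/mapP.
    case=> ba am; exists (msub a b); last by rewrite msubK.
    by rewrite mem_divs; apply/mleP => i; rewrite !ffunE leq_sub2r //; move/mleP: am.
  case=> c; rewrite mem_divs => h ->; split; first exact: mle_madd.
  apply/mleP => i; move/mleP: h => /(_ i); move/mleP: bm => /(_ i); rewrite !ffunE.
  by lia.
by rewrite (perm_big _ pe) /= big_map.
Qed.

(** Both sides sum over the decompositions of [m] into three monomials; this becomes associativity
    of the Cauchy product. *)
Lemma big_divs_assoc m (F : mon n -> mon n -> mon n -> V) :
  \sum_(a <- divs m) \sum_(b <- divs a) F b (msub a b) (msub m a) =
  \sum_(b <- divs m) \sum_(c <- divs (msub m b)) F b c (msub (msub m b) c).
Proof.
under eq_big_seq => a; first (rewrite mem_divs => am; rewrite (big_divs_sub _ am); over).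
rewrite (exchange_big_dep xpredT) //=.
apply: eq_big_seq => b; rewrite mem_divs => bm; rewrite big_divs_up //.
apply: eq_bigr => c _; rewrite maddK; congr F.
by apply/ffunP => i; rewrite !ffunE subnDA.
Qed.

End BigDivs.

Section Ring.
Variables (k : comNzRingType) (n : nat).
Notation S := (series k n).
Implicit Types f g h : S.

(** A series is a function on monomials, so its equality is decided classically. *)
HB.instance Definition _ := gen_eqMixin S.
HB.instance Definition _ := gen_choiceMixin S.

Let sopp f : S := fun m => - f m.

Fact saddA : associative (@sadd k n).
Proof. by move=> f g h; apply: funext => m; rewrite /sadd addrA. Qed.
Fact saddC : commutative (@sadd k n).
Proof. by move=> f g; apply: funext => m; rewrite /sadd addrC. Qed.
Fact sadd0 : left_id (@szero k n) (@sadd k n).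
Proof. by move=> f; apply: funext => m; rewrite /sadd add0r. Qed.
Fact saddN : left_inverse (@szero k n) sopp (@sadd k n).
Proof. by move=> f; apply: funext => m; rewrite /sadd /sopp addNr. Qed.

HB.instance Definition _ := GRing.isZmodule.Build S saddA saddC sadd0 saddN.

Fact smulC : commutative (@smul k n).
Proof.
move=> f g; apply: funext => m; rewrite /smul (big_divs_rev m (fun a b => f a * g b)).
by apply: eq_bigr => a _; rewrite mulrC.
Qed.

Fact smulA : associative (@smul k n).
Proof.
move=> f g h; apply: funext => m; rewrite /smul.
under eq_bigr do rewrite big_distrr /=.
under [RHS]eq_bigr do rewrite big_distrl /=.
rewrite (big_divs_assoc m (fun a b c => f a * g b * h c)).
by apply: eq_bigr => a _; apply: eq_bigr => b _; rewrite mulrA.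
Qed.

Fact smul1 : left_id (@sone k n) (@smul k n).
Proof.
move=> f; apply: funext => m; rewrite /smul.
have m0 : mon0 n \in divs m by rewrite mem_divs; apply/mleP => i; rewrite ffunE.
rewrite (bigD1_seq (mon0 n)) //= ?uniq_divs // /sone eqxx mul1r big1 => [|a /negPf->].
  by rewrite addr0; congr f; apply/ffunP => i; rewrite !ffunE subn0.
by rewrite mul0r.
Qed.

Fact smulDl : left_distributive (@smul k n) (@sadd k n).
Proof.
move=> f g h; apply: funext => m; rewrite /smul /sadd -big_split.
by apply: eq_bigr => a _; rewrite mulrDl.
Qed.

Fact sone_neq0 : @sone k n != @szero k n.
Proof.
apply/eqP => /(congr1 (fun f : S => f (mon0 n))); rewrite /sone /szero eqxx.
exact/eqP/oner_neq0.
Qed.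

HB.instance Definition _ := GRing.Zmodule_isComNzRing.Build S smulA smulC smul1 smulDl sone_neq0.

Lemma sE0 m : (0 : S) m = 0. Proof. by []. Qed.
Lemma sE1 m : (1 : S) m = (m == mon0 n)%:R.
Proof. by rewrite /1%R /= /sone; case: eqP. Qed.
Lemma sED f g m : (f + g) m = f m + g m. Proof. by []. Qed.
Lemma sEN f m : (- f) m = - f m. Proof. by []. Qed.
Lemma sEB f g m : (f - g) m = f m - g m. Proof. by []. Qed.
Lemma sEM f g m : (f * g) m = \sum_(a <- divs m) f a * g (msub m a).
Proof. by []. Qed.
Lemma sEsum I (r : seq I) (P : pred I) (F : I -> S) m :
  (\sum_(i <- r | P i) F i) m = \sum_(i <- r | P i) F i m.
Proof. by elim/big_rec2: _ => // i x y _ <-. Qed.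

Lemma spowE f e : spow f e = f ^+ e.
Proof. by elim: e => [|e ih] //; rewrite exprS -ih. Qed.

Lemma series_ext f g : (forall m, f m = g m) -> f = g.
Proof. exact: funext. Qed.

Definition sC (c : k) : S := fun m => if m == mon0 n then c else 0.

Lemma sCE c m : sC c m = if m == mon0 n then c else 0. Proof. by []. Qed.

Lemma sCM c f m : (sC c * f) m = c * f m.
Proof.
rewrite sEM; have m0 : mon0 n \in divs m by rewrite mem_divs; apply/mleP => i; rewrite ffunE.
rewrite (bigD1_seq (mon0 n)) //= ?uniq_divs // /sC eqxx big1 => [|a /negPf->].
  by rewrite addr0; congr (_ * f _); apply/ffunP => i; rewrite !ffunE subn0.
by rewrite mul0r.
Qed.

Fact sC_zmod : zmod_morphism sC.
Proof. by move=> a b; apply: series_ext => m; rewrite sEB /sC; case: eqP; rewrite ?subr0. Qed.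
Fact sC_monoid : monoid_morphism sC.
Proof.
split=> [|a b]; apply: series_ext => m; first by rewrite sE1 /sC; case: eqP.
by rewrite sCM /sC; case: eqP; rewrite ?mulr0.
Qed.
HB.instance Definition _ := GRing.isZmodMorphism.Build k S sC sC_zmod.
HB.instance Definition _ := GRing.isMonoidMorphism.Build k S sC sC_monoid.

Definition s0 (f : S) : k := f (mon0 n).
Fact s0_zmod : zmod_morphism s0. Proof. by []. Qed.
Fact s0_monoid : monoid_morphism s0.
Proof.
split=> [|f g]; first by rewrite /s0 sE1 eqxx.
rewrite /s0 sEM (eq_big_seq (fun a : mon n => if a == mon0 n then f a * g a else 0)).
  have m0 : mon0 n \in divs (mon0 n) by rewrite mem_divs mlexx.
  by rewrite (bigD1_seq (mon0 n)) ?uniq_divs //= eqxx big1 ?addr0 // => a /negPf->.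
move=> a; rewrite mem_divs mle0 => /eqP ->; rewrite eqxx; congr (_ * g _).
by apply/ffunP => i; rewrite !ffunE.
Qed.
HB.instance Definition _ := GRing.isZmodMorphism.Build S k s0 s0_zmod.
HB.instance Definition _ := GRing.isMonoidMorphism.Build S k s0 s0_monoid.

Lemma s0C c : s0 (sC c) = c. Proof. by rewrite /s0 /sC eqxx. Qed.



Definition smon (a : mon n) : S := fun m => (m == a)%:R.

Lemma smonM a f m : (smon a * f) m = if mle a m then f (msub m a) else 0.
Proof.
rewrite sEM; case: ifP => am.
  rewrite (bigD1_seq a) ?mem_divs ?uniq_divs //= /smon eqxx mul1r big1 ?addr0 //.
  by move=> b /negPf->; rewrite mul0r.
rewrite big_seq big1 // => b; rewrite mem_divs /smon; case: eqP => [->|_ _]; last by rewrite mul0r.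
by rewrite am.
Qed.

Lemma smonD a b : smon (madd a b) = smon a * smon b.
Proof.
apply: series_ext => m; rewrite smonM /smon; case: ifP => am.
  congr (_%:R); congr nat_of_bool; apply/eqP/eqP => [->|<-]; first by rewrite maddK.
  by rewrite msubK.
by case: eqP => // h; rewrite h mle_madd in am.
Qed.

Lemma smon0 : smon (mon0 n) = 1.
Proof. by apply: series_ext => m; rewrite sE1. Qed.

Lemma svarE i : svar k i = smon (mone i).
Proof. by apply: series_ext => m; rewrite /svar /smon; case: eqP. Qed.

End Ring.

(** * Order of vanishing, units, slices in the last variable *)

Section Order.
Variables (k : comNzRingType) (n : nat).
Notation S := (series k n).
Implicit Types f g h p : S.

(** Membership in the [N]-th power of the maximal ideal; convergence and congruences are phrased
    through it. *)
Definition ordge (N : nat) f := forall m, (mdeg m < N)%N -> f m = 0.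

Lemma ordge0 N : ordge N 0. Proof. by []. Qed.
Lemma ordgeW M N f : (N <= M)%N -> ordge M f -> ordge N f.
Proof. by move=> h hf m hm; apply/hf/(leq_trans hm). Qed.
Lemma ordgeD N f g : ordge N f -> ordge N g -> ordge N (f + g).
Proof. by move=> hf hg m hm; rewrite sED hf // hg // addr0. Qed.
Lemma ordgeN N f : ordge N f -> ordge N (- f).
Proof. by move=> hf m hm; rewrite sEN hf // oppr0. Qed.
Lemma ordgeB N f g : ordge N f -> ordge N g -> ordge N (f - g).
Proof. by move=> hf hg; apply/ordgeD/ordgeN. Qed.
Lemma ordgeBC N f g : ordge N (f - g) -> ordge N (g - f).
Proof. by move=> h; rewrite -opprB; apply: ordgeN. Qed.
Lemma ordge_sub_trans N f g h : ordge N (f - g) -> ordge N (g - h) -> ordge N (f - h).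
Proof. by move=> h1 h2; have := ordgeD h1 h2; rewrite addrA subrK. Qed.
Lemma ordge_sum N I (r : seq I) (P : pred I) (F : I -> S) :
  (forall i, P i -> ordge N (F i)) -> ordge N (\sum_(i <- r | P i) F i).
Proof. by move=> h; apply: (big_ind (ordge N)) => // f g; apply: ordgeD. Qed.

Lemma ordgeM M N f g : ordge M f -> ordge N g -> ordge (M + N) (f * g).
Proof.
move=> hf hg m hm; rewrite sEM big_seq big1 // => a; rewrite mem_divs => am.
case: (ltnP (mdeg a) M) => h; first by rewrite hf ?mul0r.
rewrite hg ?mulr0 //; have := congr1 (@mdeg n) (msubK am); rewrite mdegD; lia.
Qed.

Lemma ordgeMl N f g : ordge N g -> ordge N (f * g).
Proof. exact: (@ordgeM 0). Qed.
Lemma ordgeMr N f g : ordge N f -> ordge N (f * g).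
Proof. by rewrite mulrC; apply: ordgeMl. Qed.

Lemma ordgeX N f e : ordge N f -> ordge (N * e) (f ^+ e).
Proof.
move=> h; elim: e => [|e ih]; first by rewrite muln0.
by rewrite exprS mulnS; apply: ordgeM.
Qed.

Lemma ordgeX1 f e : ordge 1 f -> ordge e (f ^+ e).
Proof. by move=> /(@ordgeX 1 f e); rewrite mul1n. Qed.

Lemma ordge_prod I (r : seq I) (P : pred I) (F : I -> S) (e : I -> nat) :
  (forall i, P i -> ordge (e i) (F i)) ->
  ordge (\sum_(i <- r | P i) e i) (\prod_(i <- r | P i) F i).
Proof.
move=> h; elim/big_rec2: _ => // i N f Pi; exact/ordgeM/h.
Qed.

Lemma ordge_eq0 f : (forall N, ordge N f) -> f = 0.
Proof. by move=> h; apply: series_ext => m; apply: (h (mdeg m).+1). Qed.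

Lemma ordge_eq f g : (forall N, ordge N (f - g)) -> f = g.
Proof. by move=> h; apply/eqP; rewrite -subr_eq0; apply/eqP/ordge_eq0. Qed.

Lemma ordge1P f : ordge 1 f <-> s0 f = 0.
Proof.
split=> [h|h m]; first by apply: h; rewrite mdeg0.
by rewrite ltnS leqn0 mdeg_eq0 => /eqP ->.
Qed.

Lemma ordge_coef N f g m : ordge N (f - g) -> (mdeg m < N)%N -> f m = g m.
Proof. by move=> h /h; rewrite sEB => /eqP; rewrite subr_eq0 => /eqP. Qed.

Lemma ordge_smon a : ordge (mdeg a) (smon k a).
Proof. by move=> m hm; rewrite /smon; case: eqP => // e; rewrite e ltnn in hm. Qed.

Lemma ordge_svar i : ordge 1 (svar k i : S).
Proof. by rewrite svarE -(mdeg_mone i); apply: ordge_smon. Qed.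

(** Completeness: the coefficient at [m] no longer changes from index [mdeg m + 1] on, so the limit
    reads it there. *)
Lemma series_lim (u : nat -> S) : (forall N, ordge N (u N.+1 - u N)) ->
  exists f, forall N, ordge N (f - u N).
Proof.
move=> h; exists (fun m => u (mdeg m).+1 m) => N m hm.
have st M M' : (M <= M')%N -> ordge M (u M' - u M).
  move=> /subnK <-; elim: (M' - M)%N => [|e ih]; first by rewrite add0n subrr.
  by apply: ordge_sub_trans ih; rewrite addSn; apply: ordgeW (h _); apply: leq_addl.
by rewrite sEB (ordge_coef (st _ _ hm) (ltnSn _)) subrr.
Qed.

(** Contraction principle for the adic topology: the iterates of [G] from 0 form a Cauchy sequence.
    It later yields inverses, [m]-th roots and solutions of implicit equations. *)
Lemma series_fix e (G : S -> S) :
  (forall p, ordge e p -> ordge e (G p)) ->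
  (forall N p q, ordge e p -> ordge e q -> ordge N (p - q) -> ordge N.+1 (G p - G q)) ->
  exists2 p, ordge e p & G p = p.
Proof.
move=> Ge Gc; pose u N := iter N G 0.
have ue N : ordge e (u N) by elim: N => [|N ih]; [exact: ordge0|exact: Ge].
have uS N : ordge N (u N.+1 - u N) by elim: N => [|N ih] //; apply: Gc ih; apply: ue.
have [p hp] := series_lim uS.
have pe : ordge e p by rewrite -[p](subrK (u e)); apply: ordgeD.
exists p => //; apply: ordge_eq => N; apply: (@ordge_sub_trans _ _ (u N.+1)).
  by apply: (ordgeW (leqnSn N)); apply: Gc.
exact/ordgeBC/(ordgeW (leqnSn N))/hp.
Qed.

End Order.

Section Units.
Variables (k : fieldType) (n : nat).
Notation S := (series k n).
Implicit Types f g : S.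

Lemma series_inv_ex f : s0 f != 0 -> exists g, g * f = 1.
Proof.
move=> f0; pose c := s0 f; pose r := f - sC c.
have r1 : ordge 1 r by apply/ordge1P; rewrite rmorphB /= s0C subrr.
(* With [f = c + r] the equation [g f = 1] reads [g = c^-1 (1 - r g)], a contraction since [r] has
   no constant term. *)
have [//|N p q _ _ h|g _ hg] := @series_fix k n 0 (fun g => sC c^-1 * (1 - r * g)).
  rewrite -mulrBr; apply: ordgeMl.
  rewrite opprD addrACA subrr add0r opprK addrC -mulrBr -add1n.
  exact/ordgeM/ordgeBC.
exists g; have : sC c * g = 1 - r * g.
  by rewrite -{1}hg mulrA -rmorphM mulfV // rmorph1 mul1r.
rewrite -[f](subrK (sC c)) -/r mulrDr [g * r]mulrC [g * _]mulrC => ->.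
by rewrite addrCA subrr addr0.
Qed.

Definition sunit : pred S := fun f => s0 f != 0.
(** The default value [f] off the units is the convention that [sinv_out] records. *)
Definition sinv f : S :=
  if pselect (s0 f != 0) is left h then projT1 (cid (series_inv_ex h)) else f.

Fact smulV : {in sunit, left_inverse 1 sinv *%R}.
Proof.
move=> f; rewrite unfold_in /sinv; case: pselect => // h _; by case: cid.
Qed.
Fact sunitPl f g : g * f = 1 -> sunit f.
Proof.
move=> /(congr1 (@s0 k n)); rewrite rmorphM rmorph1 /sunit /=; apply: contra_eq_neq => ->.
by rewrite mulr0 eq_sym oner_neq0.
Qed.
Fact sinv_out : {in [predC sunit], sinv =1 id}.
Proof. by move=> f /negP hf; rewrite /sinv; case: pselect => // h; case: hf. Qed.

HB.instance Definition _ := GRing.ComNzRing_hasMulInverse.Build S smulV sunitPl sinv_out.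

Lemma s_unitE f : (f \is a GRing.unit) = (s0 f != 0). Proof. by []. Qed.

End Units.

(** * Series in n+1 variables as series in the last variable *)

Section Slice.
Variables (k : comNzRingType) (n : nat).
Notation S := (series k n).
Notation S' := (series k n.+1).
Implicit Types (f g : S) (h : S').

Definition mext (m : mon n) j : mon n.+1 :=
  [ffun i => if unlift ord_max i is Some i' then m i' else j].
Definition mres (M : mon n.+1) : mon n := [ffun i => M (lift ord_max i)].

Lemma mextK m j : mres (mext m j) = m.
Proof. by apply/ffunP => i; rewrite !ffunE liftK. Qed.
Lemma mext_max m j : mext m j ord_max = j.
Proof. by rewrite ffunE unlift_none. Qed.
Lemma mresK M : mext (mres M) (M ord_max) = M.
Proof. by apply/ffunP => i; rewrite !ffunE; case: unliftP => [i' ->|->] //; rewrite ffunE. Qed.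

Lemma mdeg_mext m j : mdeg (mext m j) = (mdeg m + j)%N.
Proof.
rewrite /mdeg big_ord_recr /= mext_max; congr (_ + _)%N; apply: eq_bigr => i _.
have -> : widen_ord (leqnSn n) i = lift ord_max i.
  by apply: val_inj; rewrite /= /bump leqNgt ltn_ord.
by rewrite ffunE liftK.
Qed.

Lemma mle_mext a i m j : mle (mext a i) (mext m j) = mle a m && (i <= j)%N.
Proof.
apply/mleP/andP => [h|[/mleP h1 h2] x].
  split; last by have := h ord_max; rewrite !mext_max.
  by apply/mleP => x; have := h (lift ord_max x); rewrite !ffunE liftK.
by rewrite !ffunE; case: unliftP.
Qed.

Lemma msub_mext a i m j : msub (mext m j) (mext a i) = mext (msub m a) (j - i).
Proof.
by apply/ffunP => x; rewrite !ffunE; case: unliftP => [y _|_] //; rewrite !ffunE.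
Qed.

Definition slice j h : S := fun m => h (mext m j).
Definition unslice (u : nat -> S) : S' := fun M => u (M ord_max) (mres M).

Lemma sliceE j h m : slice j h m = h (mext m j). Proof. by []. Qed.
Lemma slice_ext h h' : (forall j, slice j h = slice j h') -> h = h'.
Proof.
move=> e; apply: series_ext => M; rewrite -(mresK M).
exact: (congr1 (fun f : S => f (mres M)) (e (M ord_max))).
Qed.
Lemma unsliceK u j : slice j (unslice u) = u j.
Proof. by apply: series_ext => m; rewrite sliceE /unslice mext_max mextK. Qed.

Fact slice_zmod j : zmod_morphism (slice j). Proof. by []. Qed.
HB.instance Definition _ j := GRing.isZmodMorphism.Build S' S (slice j) (slice_zmod j).

Lemma sliceM j h h' :
  slice j (h * h') = \sum_(i < j.+1) slice i h * slice (j - i) h'.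
Proof.
apply: series_ext => m; rewrite sliceE sEM sEsum.
have pe : perm_eq (divs (mext m j)) [seq mext a i | i <- iota 0 j.+1, a <- divs m].
  apply: uniq_perm; first exact: uniq_divs.
    apply: allpairs_uniq; rewrite ?iota_uniq ?uniq_divs // => -[i a] [i' a'] _ _ /= e.
    by rewrite -(mextK a i) e mextK -(mext_max a i) e mext_max.
  move=> M; rewrite mem_divs -{1}(mresK M) mle_mext.
  apply/andP/allpairsPdep => [[h1 h2]|[i [a [hi ha ->]]]].
    by exists (M ord_max), (mres M); rewrite mem_iota mem_divs add0n ltnS mresK.
  by move: hi ha; rewrite mextK mext_max mem_iota mem_divs add0n ltnS.
rewrite (perm_big _ pe) big_allpairs_dep -[iota 0 _]/(iota 0 (j.+1 - 0)) -/(index_iota 0 j.+1) big_mkord /=.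
by apply: eq_bigr => i _; rewrite sEM; apply: eq_bigr => a _; rewrite !sliceE msub_mext.
Qed.

Lemma slice0M h h' : slice 0 (h * h') = slice 0 h * slice 0 h'.
Proof. by rewrite sliceM big_ord_recl big_ord0 addr0. Qed.

Fact slice0_monoid : monoid_morphism (slice 0).
Proof.
split; last exact: slice0M.
apply: series_ext => m; rewrite sliceE !sE1; congr (_%:R); congr nat_of_bool.
by rewrite -!mdeg_eq0 mdeg_mext addn0.
Qed.
HB.instance Definition _ := GRing.isMonoidMorphism.Build S' S (slice 0) slice0_monoid.

Definition siota f : S' := unslice (fun j => if j == 0%N then f else 0).

Lemma slice_iota j f : slice j (siota f) = if j == 0%N then f else 0.
Proof. exact: unsliceK. Qed.

Lemma slice_iotaM j f h : slice j (siota f * h) = f * slice j h.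
Proof.
rewrite sliceM big_ord_recl slice_iota subn0 /= big1 ?addr0 // => i _.
by rewrite slice_iota mul0r.
Qed.

Fact siota_zmod : zmod_morphism siota.
Proof.
move=> f g; apply: slice_ext => j; rewrite raddfB /= !slice_iota.
by case: eqP; rewrite ?subr0.
Qed.
HB.instance Definition _ := GRing.isZmodMorphism.Build S S' siota siota_zmod.
Fact siota_monoid : monoid_morphism siota.
Proof.
split=> [|f g]; apply: slice_ext => j; last first.
  by rewrite slice_iotaM !slice_iota; case: eqP; rewrite ?mulr0.
rewrite slice_iota; case: j => [|j] /=; first by rewrite rmorph1.
apply: series_ext => m; rewrite sliceE sE1 sE0.
by case: eqP => // /(congr1 (@mdeg _)); rewrite mdeg_mext mdeg0; lia.
Qed.
HB.instance Definition _ := GRing.isMonoidMorphism.Build S S' siota siota_monoid.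

Definition xl : S' := svar k ord_max.

Lemma slice_xlM j h : slice j (xl * h) = if j is j'.+1 then slice j' h else 0.
Proof.
have e : mone ord_max = mext (mon0 n) 1.
  apply/ffunP => i; rewrite !ffunE; case: unliftP => [x ->|->]; last by rewrite eqxx.
  by rewrite eq_sym (negPf (neq_lift _ _)) ffunE.
apply: series_ext => m; rewrite sliceE /xl svarE smonM e mle_mext.
have -> : mle (mon0 n) m by apply/mleP => i; rewrite ffunE.
case: j => [|j] //=; rewrite msub_mext subn1 /= sliceE; congr (h (mext _ _)).
by apply/ffunP => i; rewrite !ffunE subn0.
Qed.

Lemma slice_xl j : slice j xl = if j == 1%N then 1 else 0.
Proof.
rewrite -[xl]mulr1 slice_xlM; case: j => [|[|j]] //=; first by rewrite rmorph1.
by rewrite -(rmorph1 siota) slice_iota.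
Qed.

Lemma slice_xlXM e j h : slice j (xl ^+ e * h) = if (j < e)%N then 0 else slice (j - e) h.
Proof.
elim: e j => [|e ih] j; first by rewrite mul1r subn0.
rewrite exprS -mulrA slice_xlM; case: j => [|j] //; by rewrite ih ltnS subSS.
Qed.

Lemma slice_xlX e j : slice j (xl ^+ e) = (j == e)%:R.
Proof.
rewrite -[xl ^+ e]mulr1 slice_xlXM -(rmorph1 siota) slice_iota.
by case: ltngtP => [//|h|->]; rewrite ?subnn // subn_eq0 leqNgt h.
Qed.

(** The quotient by the last variable of [h] minus its part free of that variable, see [sshiftE]. *)
Definition sshift h : S' := unslice (fun j => slice j.+1 h).

Lemma slice_sshift j h : slice j (sshift h) = slice j.+1 h.
Proof. exact: unsliceK. Qed.

Fact sshift_zmod : zmod_morphism sshift.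
Proof. by move=> f g; apply: slice_ext => j; rewrite !(slice_sshift, raddfB). Qed.
HB.instance Definition _ := GRing.isZmodMorphism.Build S' S' sshift sshift_zmod.

Lemma sshiftE h : h = siota (slice 0 h) + xl * sshift h.
Proof.
apply: slice_ext => j; rewrite raddfD /= slice_iota slice_xlM.
by case: j => [|j] /=; rewrite ?addr0 ?add0r ?slice_sshift.
Qed.

Lemma sshift_xlM h : sshift (xl * h) = h.
Proof. by apply: slice_ext => j; rewrite slice_sshift slice_xlM. Qed.

Lemma xlM_inj : injective ( *%R xl).
Proof. by move=> h h' /(congr1 sshift); rewrite !sshift_xlM. Qed.

Lemma slice0_xl h : slice 0 h = 0 -> h = xl * sshift h.
Proof. by move=> h0; rewrite {1}[h]sshiftE h0 rmorph0 add0r. Qed.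

Lemma slice0_iota f : slice 0 (siota f) = f. Proof. exact: slice_iota. Qed.

Lemma ordge_slice N h : ordge N h <-> forall j, ordge (N - j) (slice j h).
Proof.
split=> [hN j m hm|hs M hM]; first by apply: hN; rewrite mdeg_mext; lia.
rewrite -(mresK M); apply: (hs (M ord_max)).
by rewrite -(mresK M) mdeg_mext in hM; lia.
Qed.

Lemma ordge_iota N f : ordge N (siota f) <-> ordge N f.
Proof.
rewrite ordge_slice; split=> [h|h j]; first by have := h 0%N; rewrite slice_iota subn0.
by rewrite slice_iota; case: eqP => [->|_] //; rewrite subn0.
Qed.

Lemma ordge_sshift N h : ordge N.+1 h -> ordge N (sshift h).
Proof.
by rewrite !ordge_slice => hh j; rewrite slice_sshift; have := hh j.+1; rewrite subSS.
Qed.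

Lemma ordge_slice0 N h : ordge N h -> ordge N (slice 0 h).
Proof. by rewrite ordge_slice => /(_ 0%N); rewrite subn0. Qed.

Lemma s0_iota f : s0 (siota f) = s0 f.
Proof.
have e : mon0 n.+1 = mext (mon0 n) 0.
  by apply/ffunP => i; rewrite !ffunE; case: unliftP => // j; rewrite ffunE.
by rewrite /s0 e -(sliceE 0 (siota f)) slice_iota.
Qed.

Lemma s0_slice0 h : s0 (slice 0 h) = s0 h.
Proof.
rewrite [in RHS](sshiftE h) rmorphD rmorphM /= s0_iota.
by rewrite (_ : s0 xl = 0) ?mul0r ?addr0 //; apply/ordge1P/ordge_svar.
Qed.

Lemma siota_C c : siota (sC c) = sC c.
Proof.
apply: slice_ext => j; rewrite slice_iota; apply: series_ext => m.
rewrite sliceE !sCE -mdeg_eq0 mdeg_mext addn_eq0 mdeg_eq0.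
by case: j => [|j] /=; rewrite ?andbT ?sCE ?andbF.
Qed.


Lemma siota_var (i : 'I_n) : siota (svar k i) = svar k (lift ord_max i).
Proof.
have e : mone (lift ord_max i) = mext (mone i) 0.
  apply/ffunP => j; rewrite !ffunE; case: unliftP => [x ->|->]; last by rewrite (negPf (neq_lift _ _)).
  by rewrite ffunE (inj_eq lift_inj).
apply: slice_ext => j; rewrite slice_iota; apply: series_ext => m.
rewrite sliceE !svarE e /smon; case: eqP => [->|/eqP j0].
  by rewrite (can_eq (fun a => mextK a 0)).
by case: eqP => // /(congr1 (fun a : mon n.+1 => a ord_max)); rewrite !mext_max => /eqP; rewrite (negPf j0).
Qed.


End Slice.

(** * Absence of zero divisors *)

Section Domain.
Variable (k : fieldType).

Lemma s0_inj0 (f g : series k 0) : s0 f = s0 g -> f = g.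
Proof.
by move=> h; apply: series_ext => m; rewrite (_ : m = mon0 0) //; apply/ffunP => -[].
Qed.

Lemma slice_neq0 n (h : series k n.+1) : h != 0 ->
  exists j, slice j h != 0 /\ forall i, (i < j)%N -> slice i h = 0.
Proof.
move=> h0; have ex : exists j, slice j h != 0.
  apply: contrapT => /forallNP H; case/eqP: h0; apply: slice_ext => j.
  by apply/eqP; rewrite -[_ == _]negbK; apply/negP/H.
exists (ex_minn ex); case: ex_minnP => j hj jm; split=> // i ij.
by apply/eqP; apply: contraLR ij => /jm; rewrite -leqNgt.
Qed.

(** Induction on the number of variables: if [i] and [j] are the lowest nonzero slices, slice
    [i + j] of the product is the product of these two. *)
Fact series_integral n (f g : series k n) : f * g = 0 -> (f == 0) || (g == 0).
Proof.
elim: n f g => [|n ih] f g fg0.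
  have /eqP : s0 f * s0 g = 0 by rewrite -rmorphM fg0 rmorph0.
  by rewrite mulf_eq0 => /orP[] /eqP h; apply/orP; [left|right]; apply/eqP/s0_inj0; rewrite h rmorph0.
apply/norP => -[/slice_neq0 [i [fi im]] /slice_neq0 [j [gj jm]]].
have := congr1 (slice (i + j)) fg0; rewrite raddf0 sliceM.
have ij : (i < (i + j).+1)%N by lia.
rewrite (bigD1 (Ordinal ij)) //= addKn big1 => [|x /eqP xi].
  by rewrite addr0 => /ih; rewrite (negPf fi) (negPf gj).
have /orP[h|h] : (x < i)%N || (i + j - x < j)%N.
- have xi' : nat_of_ord x != i by apply/eqP => e; apply: xi; apply: val_inj.
  by have := ltn_ord x; move: xi'; clear; move: (nat_of_ord x) => y; lia.
- by rewrite im ?mul0r.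
- by rewrite jm ?mulr0.
Qed.

HB.instance Definition _ n :=
  GRing.ComUnitRing_isIntegral.Build (series k n) (@series_integral n).

End Domain.

(** * Continuous homomorphisms and changes of variables *)

Section BigUpto.
Variables (n : nat) (V : nmodType).

(** Regroups a truncated product by pairs of exponents, for the comparison made in [gtruncM]. *)
Lemma big_upto_divs D (F : mon n -> mon n -> V) :
  \sum_(L <- mons_upto n D) \sum_(a <- divs L) F a (msub L a) =
  \sum_(a <- mons_upto n D) \sum_(b <- mons_upto n D | (mdeg a + mdeg b <= D)%N) F a b.
Proof.
have e1 L : (L \in mons_upto n D) ->
    \sum_(a <- divs L) F a (msub L a) = \sum_(a <- mons_upto n D | mle a L) F a (msub L a).
  rewrite mem_mons_upto => hL; rewrite -[RHS]big_filter; apply: perm_big.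
  apply: uniq_perm; [exact: uniq_divs|exact/filter_uniq/uniq_mons_upto|move=> b].
  rewrite mem_divs [RHS]mem_filter mem_mons_upto; case: (boolP (mle b L)) => //= /mle_mdeg h.
  by rewrite (leq_trans h).
rewrite (eq_big_seq _ e1) (exchange_big_dep xpredT) //=.
apply: eq_bigr => a _; rewrite -[LHS]big_filter -[RHS]big_filter.
have pe : perm_eq [seq L <- mons_upto n D | mle a L]
   [seq madd a b | b <- [seq b <- mons_upto n D | (mdeg a + mdeg b <= D)%N]].
  apply: uniq_perm; first exact/filter_uniq/uniq_mons_upto.
    rewrite map_inj_uniq; first exact/filter_uniq/uniq_mons_upto.
    by move=> c c' /(congr1 (fun x => msub x a)); rewrite !maddK.
  move=> L; rewrite mem_filter mem_mons_upto; apply/andP/mapP.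
    case=> aL LD; exists (msub L a); last by rewrite msubK.
    have e : (mdeg a + mdeg (msub L a) = mdeg L)%N by rewrite -mdegD msubK.
    by rewrite mem_filter mem_mons_upto; lia.
  case=> b; rewrite mem_filter mem_mons_upto => /andP[h _] ->.
  by rewrite mle_madd mdegD.
by rewrite (perm_big _ pe) /= big_map; apply: eq_bigr => b _; rewrite maddK.
Qed.

End BigUpto.

Section Hom.
Variables (k : comNzRingType).

(** Continuous algebra homomorphisms: the condition on orders is what makes such a map determined by
    the images of the variables ([chom_ext]). *)
Definition chom n m (H : series k n -> series k m) :=
  [/\ {morph H : f g / f + g}, {morph H : f g / f * g}, (forall c, H (sC c) = sC c)
    & forall N g, ordge N g -> ordge N (H g)].

Lemma chom_id n : chom (@id (series k n)). Proof. by []. Qed.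
Lemma chom_comp n m l (H : series k n -> series k m) (G : series k l -> series k n) :
  chom H -> chom G -> chom (H \o G).
Proof.
move=> [h1 h2 h3 h4] [g1 g2 g3 g4]; split=> [f g|f g|c|N g] /=.
- by rewrite g1 h1.
- by rewrite g2 h2.
- by rewrite g3 h3.
- by move=> /g4 /h4.
Qed.
Lemma chom_siota n : chom (@siota k n).
Proof.
split; [exact: raddfD|exact: rmorphM|exact: siota_C|].
by move=> N g hg; apply/ordge_iota.
Qed.

Section ChomTheory.
Variables (n m : nat) (H : series k n -> series k m).
Hypothesis hH : chom H.

Lemma chomD : {morph H : f g / f + g}. Proof. by case: hH. Qed.
Lemma chomM : {morph H : f g / f * g}. Proof. by case: hH. Qed.
Lemma chomC c : H (sC c) = sC c. Proof. by case: hH. Qed.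
Lemma chom_ord N g : ordge N g -> ordge N (H g). Proof. by case: hH => _ _ _; apply. Qed.
Lemma chom0 : H 0 = 0. Proof. by rewrite -(rmorph0 (@sC k n)) chomC rmorph0. Qed.
Lemma chom1 : H 1 = 1. Proof. by rewrite -(rmorph1 (@sC k n)) chomC rmorph1. Qed.

Lemma chom_rmorph : exists th : {rmorphism series k n -> series k m}, th =1 H.
Proof.
have zm : zmod_morphism H.
  move=> f g; by rewrite -[f in RHS](subrK g) [in RHS]chomD addrK.
have mm : monoid_morphism H by split; [exact: chom1|exact: chomM].
pose th : {rmorphism series k n -> series k m} :=
  HB.pack H (GRing.isZmodMorphism.Build _ _ H zm) (GRing.isMonoidMorphism.Build _ _ H mm).
by exists th.
Qed.

Lemma chomB : {morph H : f g / f - g}.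
Proof. by have [th e] := chom_rmorph; move=> f g; rewrite -!e rmorphB. Qed.
Lemma chomX e : {morph H : f / f ^+ e}.
Proof. by have [th e'] := chom_rmorph; move=> f; rewrite -!e' rmorphXn. Qed.
Lemma chom_sum I r (P : pred I) F :
  H (\sum_(i <- r | P i) F i) = \sum_(i <- r | P i) H (F i).
Proof. by apply: big_morph; [exact: chomD|exact: chom0]. Qed.
Lemma chom_prod I r (P : pred I) F :
  H (\prod_(i <- r | P i) F i) = \prod_(i <- r | P i) H (F i).
Proof. by apply: big_morph; [exact: chomM|exact: chom1]. Qed.
Lemma chom_s0 f : s0 (H f) = s0 f.
Proof.
have : ordge 1 (H (f - sC (s0 f))).
  by apply: chom_ord; apply/ordge1P; rewrite rmorphB /= s0C subrr.
by rewrite chomB chomC => /ordge1P; rewrite rmorphB /= s0C => /eqP; rewrite subr_eq0 => /eqP.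
Qed.

End ChomTheory.

Section Monpow.
Variables (n m : nat).

Definition gmonpow (phi : 'I_n -> series k m) (M : mon n) : series k m :=
  \prod_(i < n) phi i ^+ M i.

Lemma gmonpowD phi a b : gmonpow phi (madd a b) = gmonpow phi a * gmonpow phi b.
Proof. by rewrite -big_split; apply: eq_bigr => i _; rewrite ffunE exprD. Qed.

Lemma ordge_gmonpow phi M : (forall i, ordge 1 (phi i)) -> ordge (mdeg M) (gmonpow phi M).
Proof.
by move=> h; apply: ordge_prod => i _; apply: ordgeX1.
Qed.

Definition gsubst (phi : 'I_n -> series k m) (g : series k n) : series k m :=
  fun a => \sum_(M <- mons_upto n (mdeg a)) g M * gmonpow phi M a.

Variable phi : 'I_n -> series k m.
Hypothesis hphi : forall i, ordge 1 (phi i).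

Definition gtrunc D (g : series k n) : series k m :=
  \sum_(M <- mons_upto n D) sC (g M) * gmonpow phi M.

Lemma gsubst_trunc D g : ordge D.+1 (gsubst phi g - gtrunc D g).
Proof.
move=> a; rewrite ltnS => aD; rewrite sEB; apply/eqP; rewrite subr_eq0; apply/eqP.
rewrite /gtrunc sEsum; under [RHS]eq_bigr do rewrite sCM.
rewrite [RHS](bigID (fun M => mdeg M <= mdeg a)%N) /= [X in _ + X]big1 ?addr0; last first.
  by move=> M; rewrite -ltnNge => h; rewrite (ordge_gmonpow hphi h) mulr0.
rewrite -big_filter; apply: perm_big.
apply: uniq_perm; [exact: uniq_mons_upto|exact/filter_uniq/uniq_mons_upto|move=> M].
rewrite [RHS]mem_filter !mem_mons_upto; case: leqP => //= h.
by rewrite (leq_trans h).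
Qed.

(** The two terms differ by pairs of monomials of total degree above [D], and their images have
    order above [D] because every variable goes into the maximal ideal. *)
Lemma gtruncM D f g : ordge D.+1 (gtrunc D f * gtrunc D g - gtrunc D (f * g)).
Proof.
rewrite /gtrunc big_distrlr /=.
under [X in _ - X]eq_bigr => L _.
  rewrite sEM rmorph_sum /= big_distrl /=.
  under eq_bigr => a _ do rewrite rmorphM /=.
  over.
have -> : \sum_(L <- mons_upto n D) \sum_(a <- divs L) sC (f a) * sC (g (msub L a)) * gmonpow phi L =
   \sum_(L <- mons_upto n D) \sum_(a <- divs L)
     sC (f a) * sC (g (msub L a)) * gmonpow phi (madd a (msub L a)).
  by apply: eq_bigr => L _; apply: eq_big_seq => a; rewrite mem_divs => /msubK ->.
rewrite (big_upto_divs D (fun a b => sC (f a) * sC (g b) * gmonpow phi (madd a b))) -sumrB.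
apply: ordge_sum => a _; rewrite (bigID (fun b => mdeg a + mdeg b <= D)%N) /=.
rewrite addrAC -sumrB; apply: ordgeD; last first.
  apply: ordge_sum => b; rewrite -ltnNge => h; rewrite mulrACA -gmonpowD.
  apply: ordgeMl; apply: (ordgeW _ (ordge_gmonpow hphi)).
  by rewrite mdegD.
by rewrite big1 // => b _; rewrite mulrACA gmonpowD subrr.
Qed.

Lemma gsubstM : {morph gsubst phi : f g / f * g}.
Proof.
move=> f g; apply: ordge_eq => N; apply: (ordgeW (leqnSn N)).
apply: (ordge_sub_trans (@gsubst_trunc N _)).
apply: (ordge_sub_trans (ordgeBC (@gtruncM N f g))).
have e (a b c d : series k m) : a * b - c * d = a * (b - d) + (a - c) * d by ring.
rewrite e; apply: ordgeD; first by apply/ordgeMl/ordgeBC/gsubst_trunc.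
by apply/ordgeMr/ordgeBC/gsubst_trunc.
Qed.

Lemma gsubstD : {morph gsubst phi : f g / f + g}.
Proof.
move=> f g; apply: series_ext => a; rewrite sED /gsubst -big_split.
by apply: eq_bigr => M _; rewrite sED mulrDl.
Qed.

Lemma gsubst_ord N g : ordge N g -> ordge N (gsubst phi g).
Proof.
move=> h a ha; rewrite /gsubst big_seq big1 // => M; rewrite mem_mons_upto => hM.
by rewrite h ?mul0r //; apply: leq_ltn_trans ha.
Qed.

Lemma gsubst_smon M : gsubst phi (smon k M) = gmonpow phi M.
Proof.
apply: series_ext => a; rewrite /gsubst; case: (leqP (mdeg M) (mdeg a)) => h.
  rewrite (bigD1_seq M) ?mem_mons_upto ?uniq_mons_upto //= /smon eqxx mul1r big1 ?addr0 //.
  by move=> b /negPf ->; rewrite mul0r.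
rewrite (ordge_gmonpow hphi h) big_seq big1 // => b; rewrite mem_mons_upto /smon.
by case: eqP => [->|_ _]; rewrite ?mul0r // leqNgt h.
Qed.

Lemma gsubstC c : gsubst phi (sC c) = sC c.
Proof.
have e : sC c * smon k (mon0 n) = sC c :> series k n.
  by apply: series_ext => a; rewrite smon0 mulr1.
apply: series_ext => a; rewrite /gsubst (bigD1_seq (mon0 n)) ?uniq_mons_upto ?mem_mons_upto ?mdeg0 //=.
rewrite {1}/sC eqxx big1 ?addr0; last by move=> b /negPf h; rewrite /sC h mul0r.
by rewrite -gsubst_smon -(sCM c) gsubst_smon /gmonpow big1 ?mulr1 // => i _; rewrite ffunE.
Qed.

Lemma gsubst_chom : chom (gsubst phi).
Proof. by split; [exact: gsubstD|exact: gsubstM|exact: gsubstC|exact: gsubst_ord]. Qed.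

Lemma gsubst_var i : gsubst phi (svar k i) = phi i.
Proof.
rewrite svarE gsubst_smon /gmonpow (bigD1 i) //= ffunE eqxx big1 ?mulr1 // => j h.
by rewrite ffunE (negPf h).
Qed.

End Monpow.

Lemma gmonpow_svar n (M : mon n) : gmonpow (@svar k n) M = smon k M.
Proof.
have sX i e : svar k i ^+ e = smon k [ffun j => (e * (j == i))%N] :> series k n.
  elim: e => [|e ih].
    by rewrite expr0 -smon0; congr (smon k); apply/ffunP => j; rewrite !ffunE.
  rewrite exprS ih svarE -smonD; congr (smon k); apply/ffunP => j.
  by rewrite !ffunE mulSn.
have sP (A : 'I_n -> mon n) (r : seq 'I_n) :
    \prod_(i <- r) smon k (A i) = smon k [ffun j => (\sum_(i <- r) A i j)%N].
  elim: r => [|i r ih].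
    by rewrite big_nil -smon0; congr (smon k); apply/ffunP => j; rewrite !ffunE big_nil.
  rewrite big_cons ih -smonD; congr (smon k); apply/ffunP => j.
  by rewrite !ffunE big_cons.
rewrite /gmonpow; under eq_bigr do rewrite sX.
rewrite sP; congr (smon k); apply/ffunP => j; rewrite ffunE (bigD1 j) //= ffunE eqxx muln1.
by rewrite big1 ?addn0 // => i h; rewrite ffunE eq_sym (negPf h) muln0.
Qed.

Lemma series_trunc n D (g : series k n) :
  ordge D.+1 (g - \sum_(M <- mons_upto n D) sC (g M) * smon k M).
Proof.
move=> a; rewrite ltnS => h; rewrite sEB sEsum (bigD1_seq a) ?mem_mons_upto ?uniq_mons_upto //=.
rewrite sCM /smon eqxx mulr1 big1 ?addr0 ?subrr // => b /negPf e.
by rewrite sCM eq_sym e mulr0.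
Qed.

Lemma chom_smon n m (H : series k n -> series k m) M : chom H ->
  H (smon k M) = gmonpow (fun i => H (svar k i)) M.
Proof.
move=> h; rewrite -gmonpow_svar /gmonpow chom_prod //; apply: eq_bigr => i _; exact: chomX.
Qed.

Lemma chom_ext n m (H1 H2 : series k n -> series k m) : chom H1 -> chom H2 ->
  (forall i, H1 (svar k i) = H2 (svar k i)) -> H1 =1 H2.
Proof.
move=> h1 h2 e g; apply: ordge_eq => N; apply: (ordgeW (leqnSn N)).
have t1 := chom_ord h1 (@series_trunc n N g); have t2 := chom_ord h2 (@series_trunc n N g).
rewrite chomB // in t1; rewrite chomB // in t2.
apply: (ordge_sub_trans t1); apply: ordgeBC.
rewrite (_ : H1 _ = H2 (\sum_(M <- mons_upto n N) sC (g M) * smon k M)) //.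
rewrite !chom_sum //; apply: eq_bigr => M _; rewrite !chomM // !chomC // !chom_smon //.
by congr (_ * _); apply: eq_bigr => i _; rewrite e.
Qed.

Lemma gsubst_id n (g : series k n) : gsubst (@svar k n) g = g.
Proof.
have h : chom (gsubst (@svar k n)) by apply/gsubst_chom/ordge_svar.
by apply: (chom_ext h (chom_id n)) => i; rewrite gsubst_var //; apply: ordge_svar.
Qed.

Lemma chom_gsubst n m l (H : series k n -> series k m) (phi : 'I_l -> series k n) g :
  chom H -> (forall i, ordge 1 (phi i)) ->
  H (gsubst phi g) = gsubst (fun i => H (phi i)) g.
Proof.
move=> hH hphi; have h2 i : ordge 1 (H (phi i)) by apply: chom_ord.
have c1 := chom_comp hH (gsubst_chom hphi).
by apply: (chom_ext c1 (gsubst_chom h2)) => i /=; rewrite !gsubst_var.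
Qed.

Lemma substE n (phi : 'I_n -> series k n) : subst phi = gsubst phi.
Proof.
apply: funext => g; apply: funext => a; apply: eq_bigr => M _; congr (_ * _).
suff -> : monpow phi M = gmonpow phi M by [].
by apply: eq_bigr => i _; rewrite spowE.
Qed.

Definition cchange n (phi : 'I_n -> series k n) :=
  (forall i, ordge 1 (phi i)) /\ bijective (gsubst phi).

Lemma coord_changeE n (phi : 'I_n -> series k n) : coord_change phi <-> cchange phi.
Proof.
rewrite /coord_change /cchange substE; split=> -[h1 h2]; split=> // i.
  by apply/ordge1P/h1.
by have /ordge1P := h1 i.
Qed.

Definition req n (f g : series k n) := exists phi, cchange phi /\ f = gsubst phi g.

Lemma right_equivE n (f g : series k n) : right_equiv f g <-> req f g.
Proof.
split=> -[phi [h1 h2]]; exists phi; move: h2; rewrite substE => h2; split=> //; exact/coord_changeE.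
Qed.

Lemma cchange_inv_ex n (phi : 'I_n -> series k n) : cchange phi ->
  exists psi, [/\ forall i, ordge 1 (psi i), (forall i, gsubst phi (psi i) = svar k i)
    & forall i, gsubst psi (phi i) = svar k i].
Proof.
move=> [h1 [H HK KH]]; have hc := gsubst_chom h1.
pose psi i := H (svar k i); have e i : gsubst phi (psi i) = svar k i by apply: KH.
have hp i : ordge 1 (psi i).
  by apply/ordge1P; rewrite -(chom_s0 hc) e; apply/ordge1P/ordge_svar.
exists psi; split=> // i; apply: (can_inj HK); rewrite chom_gsubst // gsubst_var //.
by rewrite (_ : (fun i => _) = @svar k n) ?gsubst_id //; apply: funext.
Qed.

Lemma cchange_of_inv n (phi psi : 'I_n -> series k n) :
  (forall i, ordge 1 (phi i)) -> (forall i, ordge 1 (psi i)) ->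
  (forall i, gsubst phi (psi i) = svar k i) ->
  (forall i, gsubst psi (phi i) = svar k i) -> cchange phi.
Proof.
move=> h1 h2 e1 e2; split=> //; exists (gsubst psi) => g.
  rewrite (chom_gsubst _ (gsubst_chom h2)) // (_ : (fun i => _) = @svar k n) ?gsubst_id //.
  exact: funext.
rewrite (chom_gsubst _ (gsubst_chom h1)) // (_ : (fun i => _) = @svar k n) ?gsubst_id //.
exact: funext.
Qed.

Lemma req_refl n (f : series k n) : req f f.
Proof.
exists (@svar k n); split; last by rewrite gsubst_id.
split; first exact: ordge_svar.
by exists id => g; rewrite gsubst_id.
Qed.

Lemma req_trans n (g f h : series k n) : req f g -> req g h -> req f h.
Proof.
move=> [phi [[p1 p2] ->]] [psi [[q1 q2] ->]].
exists (fun i => gsubst phi (psi i)); split; last by rewrite chom_gsubst //; apply: gsubst_chom.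
split=> [i|]; first exact: (chom_ord (gsubst_chom p1)).
apply: (eq_bij (bij_comp p2 q2)) => x /=; rewrite chom_gsubst //; exact: gsubst_chom.
Qed.

Lemma req_sym n (f g : series k n) : req f g -> req g f.
Proof.
move=> [phi [hc ->]]; have [psi [h1 h2 h3]] := cchange_inv_ex hc; case: hc => p1 p2.
exists psi; split; first exact: (cchange_of_inv h1 p1).
rewrite (chom_gsubst _ (gsubst_chom h1)) // (_ : (fun i => _) = @svar k n) ?gsubst_id //.
exact: funext.
Qed.

(** [L] is the identity on the associated graded ring. Surjectivity: [g] with [L g = h] is a fixed
    point of the contraction [g |-> h - (L g - g)]. Injectivity: [L g = 0] raises the order of [g]
    without end. *)
Lemma series_bij n (L : series k n -> series k n) : {morph L : f g / f + g} ->
  (forall N g, ordge N g -> ordge N.+1 (L g - g)) -> bijective L.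
Proof.
move=> LD Lg; have L0 : L 0 = 0 by apply: (addIr (L 0)); rewrite -LD !add0r.
have LN g : L (- g) = - L g by apply: (addIr (L g)); rewrite -LD !addNr.
have sur h : exists g, L g = h.
  have [//|N p q _ _ pq|g _ e] := @series_fix k n 0 (fun p => h - (L p - p)).
    have := Lg _ _ pq; rewrite LD LN => /ordgeBC; congr ordge; ring.
  exists g; have /eqP : g - (h - (L g - g)) = 0 by rewrite e subrr.
  by rewrite (_ : _ - _ = L g - h) ?subr_eq0 => [/eqP|]; last ring.
have inj g : L g = 0 -> g = 0.
  move=> g0; apply: ordge_eq0; elim=> // N ih.
  by have := Lg _ _ ih; rewrite g0 sub0r => /ordgeN; rewrite opprK.
pose K h := projT1 (cid (sur h)); have KP h : L (K h) = h by rewrite /K; case: cid.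
exists K => // g; apply/eqP; rewrite -subr_eq0; apply/eqP/inj.
by rewrite LD LN KP subrr.
Qed.

Lemma ordge_prodB n I (r : seq I) (e : I -> nat) (a b : I -> series k n) :
  (forall i, ordge (e i) (a i)) -> (forall i, ordge (e i) (b i)) ->
  (forall i, ordge (e i).+1 (a i - b i)) ->
  ordge (\sum_(i <- r) e i).+1 (\prod_(i <- r) a i - \prod_(i <- r) b i).
Proof.
move=> ha hb hab; elim: r => [|i r ih]; first by rewrite !big_nil subrr.
rewrite !big_cons; set A := \prod_(j <- r) a j in ih *; set B := \prod_(j <- r) b j in ih *.
have -> : a i * A - b i * B = a i * (A - B) + (a i - b i) * B by ring.
apply: ordgeD; first by rewrite -addnS; apply: ordgeM.
by rewrite -addSn; apply: ordgeM => //; apply: ordge_prod.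
Qed.

(** A substitution tangent to the identity falls under [series_bij], so no inverse has to be written
    down. *)
Lemma cchange_id n (phi : 'I_n -> series k n) :
  (forall i, ordge 2 (phi i - svar k i)) -> cchange phi.
Proof.
move=> h; have h1 i : ordge 1 (phi i).
  by rewrite -[phi i](subrK (svar k i)); apply: ordgeD (ordge_svar _ _); apply: ordgeW (h i).
split=> //; apply: series_bij; first exact: gsubstD.
have pw e i : ordge e.+1 (phi i ^+ e - svar k i ^+ e).
  have := @ordge_prodB n 'I_e (index_enum _) (fun=> 1%N) (fun=> phi i) (fun=> svar k i).
  rewrite sum1_card !prodr_const card_ord; apply=> // _; exact: ordge_svar.
have mp M : ordge (mdeg M).+1 (gmonpow phi M - smon k M).
  rewrite -gmonpow_svar; apply: ordge_prodB => i; rewrite ?pw //; apply: ordgeX1 => //; apply: ordge_svar.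
move=> N g gN a; rewrite ltnS => ha; rewrite sEB /gsubst big_seq.
rewrite (eq_bigr (fun M => g M * smon k M a)) => [|M]; last first.
  rewrite mem_mons_upto => hM; case: (ltnP (mdeg M) N) => h2; first by rewrite gN ?mul0r.
  by rewrite (ordge_coef (mp M)) //; lia.
rewrite -big_seq (bigD1_seq a) ?mem_mons_upto ?uniq_mons_upto //= /smon eqxx mulr1.
rewrite big1 ?addr0 ?subrr // => b /negPf e.
by rewrite eq_sym e mulr0.
Qed.

End Hom.

(** * Factorizations *)

Section Path.
Variables (R : comNzRingType) (d p : nat).
Implicit Types (phi : 'I_d -> 'M[R]_p).

(** Composite of [l] consecutive maps with cyclic indices, so that every rotation of the defining
    product is available. *)
Fixpoint dpath phi (i : 'I_d) l : 'M[R]_p :=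
  if l is l'.+1 then phi i *m dpath phi (ordS i) l' else 1%:M.

Lemma dpathD phi i a b :
  dpath phi i (a + b) = dpath phi i a *m dpath phi (iter a (@ordS d) i) b.
Proof.
elim: a i => [|a ih] i; first by rewrite mul1mx.
by rewrite addSn /= ih mulmxA -iterSr.
Qed.

Lemma dpathS phi i l : dpath phi i l.+1 = dpath phi i l *m phi (iter l (@ordS d) i).
Proof. by rewrite -addn1 dpathD /= mulmx1. Qed.

Lemma iter_ordS l (i : 'I_d) : iter l (@ordS d) i = ((i + l) %% d)%N :> nat.
Proof.
elim: l => [|l ih] /=; first by rewrite addn0 modn_small.
by rewrite ih -addn1 modnDml addn1 addnS.
Qed.

Lemma iter_ordS_d (i : 'I_d) : iter d (@ordS d) i = i.
Proof. by apply: val_inj; rewrite /= iter_ordS modnDr modn_small. Qed.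

Lemma dpath_prod phi (d0 : (0 < d)%N) :
  \prod_(i < d) phi i = dpath phi (Ordinal d0) d.
Proof.
pose F t := phi (insubd (Ordinal d0) t).
have -> : \prod_(i < d) phi i = \prod_(0 <= t < d) F t.
  by rewrite big_mkord; apply: eq_bigr => i _; rewrite /F valKd.
suff H l (i : 'I_d) : (i + l <= d)%N -> dpath phi i l = \prod_(i <= t < i + l) F t.
  by rewrite H.
elim: l i => [|l ih] i h; first by rewrite addn0 big_geq.
rewrite big_ltn; last by rewrite addnS ltnS leq_addr.
rewrite /= {1}/F valKd mulmxE; congr (_ * _).
case: (ltnP i.+1 d) => h2.
  have e : ordS i = i.+1 :> nat by rewrite /= modn_small.
  have h3 : (ordS i + l <= d)%N by rewrite e addSnnS.
  by rewrite ih // e addSnnS.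
have -> : l = 0%N by lia.
by rewrite addn1 big_geq.
Qed.

End Path.

Lemma dpath_map (R R' : comNzRingType) (th : {rmorphism R -> R'}) d p
  (phi : 'I_d -> 'M[R]_p) i l :
  map_mx th (dpath phi i l) = dpath (fun j => map_mx th (phi j)) i l.
Proof. by elim: l i => [|l ih] i /=; rewrite ?map_mx1 // map_mxM ih. Qed.

Section MxDomain.
Variable (R : idomainType).

(** [A (B A - f) = 0], and the adjugate of [A] cancels [A] because [det A] is nonzero. This is why
    every rotation of the product of a factorization equals [f]. *)
Lemma mulmx_scalC p (A B : 'M[R]_p) f : f != 0 -> A *m B = f%:M -> B *m A = f%:M.
Proof.
move=> f0 AB; have dA : \det A != 0.
  have /eqP := congr1 determinant AB; rewrite det_mulmx det_scalar.
  by apply: contraTneq => ->; rewrite mul0r eq_sym expf_neq0.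
have e : \adj A *m (A *m (B *m A - f%:M)) = 0.
  by rewrite mulmxBr mulmxA AB mul_scalar_mx mul_mx_scalar subrr mulmx0.
move: e; rewrite mulmxA mul_adj_mx mul_scalar_mx => /eqP.
by rewrite scalemx_eq0 (negPf dA) subr_eq0 => /eqP.
Qed.

End MxDomain.

Section DMF.
Variables (R : comNzRingType) (d : nat).

Definition dmor p q (phi : 'I_d -> 'M[R]_p) (psi : 'I_d -> 'M[R]_q)
    (al : 'I_d -> 'M[R]_(q, p)) :=
  forall i, al i *m phi i = psi i *m al (ordS i).

Definition diso p q (phi : 'I_d -> 'M[R]_p) (psi : 'I_d -> 'M[R]_q) := exists (al : 'I_d -> 'M[R]_(q, p)) (be : 'I_d -> 'M[R]_(p, q)),
  [/\ dmor phi psi al, dmor psi phi be,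
     forall i, be i *m al i = 1%:M & forall i, al i *m be i = 1%:M].

Section Raw.
Variables (p q r : nat).
Implicit Types (phi : 'I_d -> 'M[R]_p) (psi : 'I_d -> 'M[R]_q) (chi : 'I_d -> 'M[R]_r).

Lemma dmor_comp phi psi chi al be : dmor phi psi al -> dmor psi chi be ->
  dmor phi chi (fun i => be i *m al i).
Proof. by move=> h1 h2 i; rewrite -mulmxA h1 mulmxA h2 mulmxA. Qed.

Lemma dmorD phi psi al be : dmor phi psi al -> dmor phi psi be ->
  dmor phi psi (fun i => al i + be i).
Proof. by move=> h1 h2 i; rewrite mulmxDl mulmxDr h1 h2. Qed.

Lemma dmor0 phi psi : dmor phi psi (fun=> 0).
Proof. by move=> i; rewrite mul0mx mulmx0. Qed.

Lemma dmor1 phi : dmor phi phi (fun=> 1%:M).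
Proof. by move=> i; rewrite mul1mx mulmx1. Qed.

Lemma dmor_path phi psi al i l : dmor phi psi al ->
  al i *m dpath phi i l = dpath psi i l *m al (iter l (@ordS d) i).
Proof.
move=> h; elim: l i => [|l ih] i; first by rewrite mulmx1 mul1mx.
by rewrite iterSr -mulmxA -ih !mulmxA h.
Qed.

Lemma dmor_inv phi psi al be : dmor phi psi al ->
  (forall i, be i *m al i = 1%:M) -> (forall i, al i *m be i = 1%:M) -> dmor psi phi be.
Proof.
move=> h e1 e2 i.
by rewrite -[psi i]mulmx1 -(e2 (ordS i)) [psi i *m _]mulmxA -h -mulmxA !mulmxA e1 mul1mx.
Qed.

End Raw.

Lemma diso_sym p q (phi : 'I_d -> 'M[R]_p) (psi : 'I_d -> 'M[R]_q) :
  diso phi psi -> diso psi phi.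
Proof. by move=> [al [be [h1 h2 h3 h4]]]; exists be, al. Qed.


Lemma diso_trans p q r (phi : 'I_d -> 'M[R]_p) (psi : 'I_d -> 'M[R]_q) (chi : 'I_d -> 'M[R]_r) :
  diso phi psi -> diso psi chi -> diso phi chi.
Proof.
move=> [a [b [h1 h2 h3 h4]]] [a' [b' [k1 k2 k3 k4]]].
exists (fun i => a' i *m a i), (fun i => b i *m b' i); split.
- exact: dmor_comp k1.
- exact: dmor_comp h2.
- by move=> i; rewrite -mulmxA (mulmxA (b' i)) k3 mul1mx h3.
- by move=> i; rewrite -mulmxA (mulmxA (a i)) h4 mul1mx k4.
Qed.

Definition dsumx p q (phi : 'I_d -> 'M[R]_p) (psi : 'I_d -> 'M[R]_q) i : 'M[R]_(p + q) :=
  block_mx (phi i) 0 0 (psi i).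

Lemma diso_sum p q p' q' (phi : 'I_d -> 'M[R]_p) (psi : 'I_d -> 'M[R]_q)
  (phi' : 'I_d -> 'M[R]_p') (psi' : 'I_d -> 'M[R]_q') :
  diso phi phi' -> diso psi psi' -> diso (dsumx phi psi) (dsumx phi' psi').
Proof.
move=> [a [b [h1 h2 h3 h4]]] [a' [b' [k1 k2 k3 k4]]].
exists (fun i => block_mx (a i) 0 0 (a' i)), (fun i => block_mx (b i) 0 0 (b' i)).
split=> i; rewrite /dsumx !mulmx_block !(mul0mx, mulmx0, addr0, add0r).
- by rewrite h1 k1.
- by rewrite h2 k2.
- by rewrite h3 k3 -scalar_mx_block.
- by rewrite h4 k4 -scalar_mx_block.
Qed.

(** Counterpart of [MF] over library matrices and any commutative ring; [finite_MF_typeE] compares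
    the two. *)
Record dmf (f : R) := Dmf {
  rk : nat;
  dmx :> 'I_d -> 'M[R]_rk;
  dmfP : \prod_(i < d) dmx i = f%:M }.

Variable f : R.
Notation MF := (dmf f).

Lemma dsumP (X Y : MF) : \prod_(i < d) dsumx X Y i = f%:M.
Proof.
rewrite (_ : \prod_(i < d) _ = block_mx (\prod_(i < d) X i) 0 0 (\prod_(i < d) Y i)).
  by rewrite !dmfP -scalar_mx_block.
elim/big_ind3: _ => [|x y z x' y' z' -> ->|//]; first by rewrite -scalar_mx_block.
by rewrite -!mulmxE mulmx_block !(mul0mx, mulmx0, addr0, add0r).
Qed.
Definition dsum (X Y : MF) : MF := Dmf (dsumP X Y).

Definition indec (X : MF) := (0 < rk X)%N /\
  ~ exists Y Z : MF, [/\ (0 < rk Y)%N, (0 < rk Z)%N & diso X (dsum Y Z)].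

Definition fint := exists l : seq MF, forall X, indec X -> exists2 D, List.In D l & diso X D.

(** The ideal of morphisms generated by the identities of the objects in [P]. That the identity of
    [X] lies in it says that [X] is a summand of a finite sum of such objects, without forming the
    sum. *)
Inductive fac (P : MF -> Prop) (X Y : MF) : ('I_d -> 'M[R]_(rk Y, rk X)) -> Prop :=
| fac0 : fac P (fun=> 0)
| facD g h : fac P g -> fac P h -> fac P (fun i => g i + h i)
| facC C al be : P C -> dmor X C al -> dmor C Y be -> fac P (fun i => be i *m al i).

Lemma fac_mor P (X Y : MF) g : @fac P X Y g -> dmor X Y g.
Proof.
elim=> [|g1 g2 _ h1 _ h2|C al be _ h1 h2]; [exact: dmor0|exact: dmorD|exact: dmor_comp h2].
Qed.

Lemma fac_comp P (X' X Y Y' : MF) g al be : @fac P X Y g -> dmor X' X al -> dmor Y Y' be ->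
  @fac P X' Y' (fun i => be i *m g i *m al i).
Proof.
move=> hg ha hb; elim: hg => [|g1 g2 _ h1 _ h2|C a b PC h1 h2].
- rewrite (_ : (fun i => _) = fun=> 0); first exact: fac0.
  by apply: funext => i; rewrite mulmx0 mul0mx.
- rewrite (_ : (fun i => _) = fun i => be i *m g1 i *m al i + be i *m g2 i *m al i).
    exact: facD.
  by apply: funext => i; rewrite mulmxDr mulmxDl.
- rewrite (_ : (fun i => _) = fun i => (be i *m b i) *m (a i *m al i)).
    by apply: (facC PC); [exact: dmor_comp h1|exact: dmor_comp hb].
  by apply: funext => i; rewrite !mulmxA.
Qed.

Definition facid P (X : MF) := @fac P X X (fun=> 1%:M).

Lemma fac_trans P Q (X Y : MF) g : @fac P X Y g -> (forall C, P C -> facid Q C) -> @fac Q X Y g.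
Proof.
move=> hg PQ; elim: hg => [|g1 g2 _ h1 _ h2|C a b PC h1 h2]; [exact: fac0|exact: facD|].
have := fac_comp (PQ _ PC) h1 h2; congr fac; apply: funext => i.
by rewrite mulmx1.
Qed.

Lemma facid_retract (P : MF -> Prop) (X C : MF) al be : P C -> dmor X C al -> dmor C X be ->
  (forall i, be i *m al i = 1%:M) -> facid P X.
Proof.
move=> PC ha hb e; rewrite /facid (_ : (fun=> _) = fun i => be i *m al i); first exact: (facC PC).
exact: funext.
Qed.

Lemma facid_self (P : MF -> Prop) X : P X -> facid P X.
Proof.
move=> PX; apply: (facid_retract PX); [exact: dmor1|exact: dmor1|].
by move=> i; rewrite mulmx1.
Qed.

Lemma facid_sum P (X Y : MF) : facid P X -> facid P Y -> facid P (dsum X Y).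
Proof.
move=> hX hY.
have m1 : dmor X (dsum X Y) (fun=> col_mx 1%:M 0).
  by move=> i; rewrite mul_col_mx mul_block_col !(mul0mx, mul1mx, mulmx1, mulmx0, addr0).
have m2 : dmor Y (dsum X Y) (fun=> col_mx 0 1%:M).
  by move=> i; rewrite mul_col_mx mul_block_col !(mul0mx, mul1mx, mulmx1, mulmx0, add0r).
have m3 : dmor (dsum X Y) X (fun=> row_mx 1%:M 0).
  by move=> i; rewrite mul_mx_row mul_row_block !(mul0mx, mul1mx, mulmx1, mulmx0, addr0).
have m4 : dmor (dsum X Y) Y (fun=> row_mx 0 1%:M).
  by move=> i; rewrite mul_mx_row mul_row_block !(mul0mx, mul1mx, mulmx1, mulmx0, add0r).
have := facD (fac_comp hX m3 m1) (fac_comp hY m4 m2).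
congr fac; apply: funext => i; rewrite !mulmx1 !mul_col_row !(mul0mx, mul1mx, mulmx0).
by rewrite add_block_mx !(addr0, add0r) -scalar_mx_block.
Qed.

Lemma facid_iso P (X Y : MF) : diso X Y -> facid P Y -> facid P X.
Proof.
move=> [al [be [h1 h2 h3 _]]] hY; have := fac_comp hY h1 h2; congr fac.
by apply: funext => i; rewrite mulmx1.
Qed.

Lemma fac_list P (X Y : MF) g : @fac P X Y g ->
  exists2 l : seq MF, (forall C, List.In C l -> P C) & @fac (fun C => List.In C l) X Y g.
Proof.
elim=> [|g1 g2 _ [l1 h1 k1] _ [l2 h2 k2]|C a b PC h1 h2].
- by exists [::] => //; exact: fac0.
- exists (l1 ++ l2) => [C hC|]; first by case: (List.in_app_or _ _ _ hC) => [/h1|/h2].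
  by apply: facD; [apply: (fac_trans k1)|apply: (fac_trans k2)] => C hC;
     apply: facid_self; apply: List.in_or_app; [left|right].
- exists [:: C] => [D /= [<-|]//|]; apply: facC h2 => //=; by left.
Qed.

End DMF.

(** * Idempotents and Krull-Schmidt *)

Section MxOrd.
Variables (k : fieldType) (n : nat).
Notation A := (series k n).

Definition mxord p q N (M : 'M[A]_(p, q)) := forall i j, ordge N (M i j).

Lemma mxordD p q N (M M' : 'M[A]_(p, q)) : mxord N M -> mxord N M' -> mxord N (M + M').
Proof. by move=> h h' i j; rewrite mxE; apply: ordgeD. Qed.
Lemma mxordN p q N (M : 'M[A]_(p, q)) : mxord N M -> mxord N (- M).
Proof. by move=> h i j; rewrite mxE; apply: ordgeN. Qed.
Lemma mxordM p q r N N' (M : 'M[A]_(p, q)) (M' : 'M[A]_(q, r)) :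
  mxord N M -> mxord N' M' -> mxord (N + N') (M *m M').
Proof. by move=> h h' i j; rewrite mxE; apply: ordge_sum => l _; apply: ordgeM. Qed.
Lemma mxordMl p q r N (M : 'M[A]_(p, q)) (M' : 'M[A]_(q, r)) :
  mxord N M' -> mxord N (M *m M').
Proof. by move=> h'; apply: (@mxordM _ _ _ 0). Qed.
Lemma mxordMr p q r N (M : 'M[A]_(p, q)) (M' : 'M[A]_(q, r)) :
  mxord N M -> mxord N (M *m M').
Proof. by move=> h; rewrite -[N]addn0; apply: mxordM. Qed.
Lemma mxord_eq p q (M M' : 'M[A]_(p, q)) : (forall N, mxord N (M - M')) -> M = M'.
Proof.
by move=> h; apply/matrixP => i j; apply: ordge_eq => N; have := h N i j; rewrite !mxE.
Qed.
Lemma mxord1P p q (M : 'M[A]_(p, q)) : mxord 1 M <-> map_mx (@s0 k n) M = 0.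
Proof.
split=> [h|h i j]; first by apply/matrixP => i j; rewrite !mxE; apply/ordge1P.
by apply/ordge1P; have /matrixP/(_ i j) := h; rewrite !mxE.
Qed.

Lemma mx_lim p q (u : nat -> 'M[A]_(p, q)) : (forall N, mxord N (u N.+1 - u N)) ->
  exists M, forall N, mxord N (M - u N).
Proof.
move=> h; have ex i j : exists f, forall N, ordge N (f - u N i j).
  by apply: (series_lim (u := fun N => u N i j)) => N; have := h N i j; rewrite !mxE.
exists (\matrix_(i, j) projT1 (cid (ex i j))) => N i j; rewrite !mxE; case: cid => f /= hf.
exact: hf.
Qed.

Lemma unitmx_s0 p (M : 'M[A]_p) : (M \in unitmx) = (map_mx (@s0 k n) M \in unitmx).
Proof. by rewrite !unitmxE det_map_mx s_unitE unitfE. Qed.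

Notation cmx := (map_mx (@sC k n)).

Lemma s0_cmx p q (M : 'M[k]_(p, q)) : map_mx (@s0 k n) (cmx M) = M.
Proof. by apply/matrixP => i j; rewrite !mxE s0C. Qed.

(** Split the residue of [E] over the field and lift the two factors by constants. The resulting
    idempotent [B C] agrees with [E] modulo the maximal ideal, and [F = E - B C] is an idempotent
    with zero residue; then [1 - F] is a unit killing [F]. *)
Lemma idem_split p (E : 'M[A]_p) : E *m E = E ->
  exists r (B : 'M[A]_(p, r)) (C : 'M[A]_(r, p)), C *m B = 1%:M /\ B *m C = E.
Proof.
move=> EE; pose E0 := map_mx (@s0 k n) E.
have E0E : E0 *m E0 = E0 by rewrite -map_mxM EE.
have [r [b [c [bc bf cf]]]] : exists r (b : 'M_(p, r)) (c : 'M_(r, p)),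
    [/\ b *m c = E0, row_full b & row_free c].
  by exists (\rank E0), (col_base E0), (row_base E0); rewrite mulmx_base row_base_free col_base_full.
have cb : c *m b = 1%:M.
  apply: (row_full_inj bf); apply: (row_free_inj cf).
  by rewrite mulmx1 -!mulmxA bc mulmxA bc.
pose B := E *m cmx b; pose C0 := cmx c *m E; pose u := C0 *m B.
have u0 : map_mx (@s0 k n) u = 1%:M.
  rewrite !map_mxM !s0_cmx -/E0 -mulmxA (mulmxA E0) E0E -bc.
  by rewrite !mulmxA cb mul1mx cb.
have uU : u \in unitmx by rewrite unitmx_s0 u0 unitmx1.
pose C := invmx u *m C0; exists r, B, C.
have CB : C *m B = 1%:M by rewrite -mulmxA mulVmx.
split=> //; pose F := E - B *m C.
have EB : E *m B = B by rewrite mulmxA EE.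
have CE : C *m E = C by rewrite -!mulmxA EE.
have FF : F *m F = F.
  have e1 : E *m (B *m C) = B *m C by rewrite mulmxA EB.
  have e2 : B *m C *m E = B *m C by rewrite -mulmxA CE.
  have e3 : B *m C *m (B *m C) = B *m C by rewrite -mulmxA (mulmxA C) CB mul1mx.
  by rewrite /F mulmxBl !mulmxBr EE e1 e2 e3 subrr subr0.
have F0 : map_mx (@s0 k n) (1%:M - F) = 1%:M.
  rewrite map_mxB map_mx1 /F map_mxB map_mxM -/E0.
  have -> : map_mx (@s0 k n) C = c *m E0.
    rewrite -[LHS]mul1mx -u0 -map_mxM /C mulKVmx // map_mxM; congr (_ *m _).
    exact: s0_cmx.
  rewrite map_mxM s0_cmx -/E0 -!mulmxA (mulmxA b) bc !E0E.
  by rewrite subrr subr0.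
have : (1%:M - F) *m F = 0 by rewrite mulmxBl mul1mx FF subrr.
have FU : 1%:M - F \in unitmx by rewrite unitmx_s0 F0 unitmx1.
move/(congr1 (mulmx (invmx (1%:M - F)))); rewrite mulKmx // mulmx0 => /eqP.
by rewrite subr_eq0 => /eqP.
Qed.

End MxOrd.

Section Lift.
Variables (k : fieldType) (n d p : nat).
Notation A := (series k n).
Variable al : 'I_d -> 'M[A]_p.+1.
Notation res := (map_mx (@s0 k n)).

Let Psi i (P : {poly k}) : 'M[A]_p.+1 := horner_mx (al i) (map_poly (@sC k n) P).

Let PsiM i P Q : Psi i (P * Q) = Psi i P *m Psi i Q.
Proof. by rewrite /Psi !rmorphM. Qed.

Let PsiB i P Q : Psi i (P - Q) = Psi i P - Psi i Q.
Proof. by rewrite /Psi rmorphB; apply: raddfB. Qed.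

Let Psi_res i P : res (Psi i P) = horner_mx (res (al i)) P.
Proof.
rewrite map_horner_mx -map_poly_comp /=; congr horner_mx.
by rewrite map_poly_id // => x _; rewrite /= s0C.
Qed.

(** One polynomial killing the residues of all components, so that one sequence of polynomials
    serves every index; this makes the limit commute with the maps of a factorization. *)
Let mu : {poly k} := \prod_i char_poly (res (al i)).

Let Psi_mu i N : mxord N (Psi i (mu ^+ N)).
Proof.
have h : mxord 1 (Psi i mu).
  apply/mxord1P; rewrite Psi_res /mu (bigD1 i) //= rmorphM /= Cayley_Hamilton.
  exact: mul0r.
elim: N => [|N ih]; first by [].
by rewrite exprS PsiM; apply: (mxordM h ih).
Qed.

(** The hypotheses make 0 and 1 roots of [mu]. The idempotent polynomial separating the root 0 from
    the rest is improved by Newton steps and evaluated at each [al i]. The limit at [i0] is not 1,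
    since [X] divides the polynomial and [al i0] is not a unit; the limit at [i1] is not 0, since
    [X - 1] divides its complement. *)
Lemma idem_lift : (exists i, al i \notin unitmx) -> (exists i, 1%:M - al i \notin unitmx) ->
  exists E : 'I_d -> 'M[A]_p.+1,
    [/\ forall i, E i *m E i = E i, (exists i, E i <> 1%:M), (exists i, E i <> 0) &
     forall phi : 'I_d -> 'M[A]_p.+1, dmor phi phi al -> dmor phi phi E].
Proof.
move=> [i0 h0] [i1 h1].
have root_mu i a : res (al i) - a%:M \notin unitmx -> root mu a.
  move=> nu; rewrite /mu (bigD1 i) //= rootM; apply/orP; left.
  by rewrite -eigenvalue_root_char /eigenvalue /eigenspace kermx_eq0 row_free_unit.
have r0 : root mu 0 by apply: (root_mu i0); rewrite raddf0 subr0 -unitmx_s0.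
have r1 : root mu 1.
  apply: (root_mu i1); rewrite -[_ - _]opprB.
  have -> : - (1%:M - res (al i1)) = (-1) *: (1%:M - res (al i1)) by rewrite scaleN1r.
  by rewrite unitmxZ ?unitrN1 // -[1%:M](map_mx1 (@s0 k n)) -map_mxB -unitmx_s0.
have mu0 : mu != 0 by apply/monic_neq0/monic_prod => i _; apply: char_poly_monic.
have [m [q]] := multiplicity_XsubC mu 0; rewrite mu0 /= => q0 emu.
have m0 : (0 < m)%N.
  by case: (posnP m) => // e; move: r0; rewrite emu e mulr1 (negPf q0).
rewrite subr0 in emu.
have q1 : root q 1.
  move: r1; rewrite emu rootM => /orP[//|]; rewrite /root hornerXn expr1n.
  by rewrite oner_eq0.
have [[u v] /= uv] : exists uv, uv.1 * q + uv.2 * 'X^m = 1.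
  apply/Bezout_eq1_coprimepP; rewrite coprimep_expr // -[X in coprimep _ X]subr0.
  by rewrite -[0 : {poly k}]/(0%:P) coprimep_XsubC.
pose st (P : {poly k}) := 3%:R * P ^+ 2 - 2%:R * P ^+ 3.
(* The start [v X^m] is 0 modulo [X^m] and 1 modulo [q], hence idempotent modulo [mu]; each step
   [st] squares the error up to a factor. *)
pose P N := iter N st (v * 'X^m).
have Pidem N : exists s, P N ^+ 2 - P N = s * mu ^+ N.+1.
  elim: N => [|N [s hs]].
    exists (- (u * v)); rewrite /P /= emu expr1.
    have e : u * q = 1 - v * 'X^m by rewrite -uv addrK.
    rewrite (_ : - (u * v) * (q * 'X^m) = - (u * q) * (v * 'X^m)); last by ring.
    by rewrite e; ring.
  exists (s ^+ 2 * mu ^+ N * (4%:R * P N ^+ 2 - 4%:R * P N - 3%:R)).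
  rewrite /P iterS -/(P N) /st.
  have -> : (3%:R * P N ^+ 2 - 2%:R * P N ^+ 3) ^+ 2 - (3%:R * P N ^+ 2 - 2%:R * P N ^+ 3)
    = (P N ^+ 2 - P N) ^+ 2 * (4%:R * P N ^+ 2 - 4%:R * P N - 3%:R) by ring.
  by rewrite hs !exprS; ring.
have Pstep N : exists s, P N.+1 - P N = s * mu ^+ N.+1.
  have [s hs] := Pidem N; exists ((1 - 2%:R * P N) * s).
  by rewrite -mulrA -hs /P iterS -/(P N) /st; ring.
have lim i : exists E, forall N, mxord N (E - Psi i (P N)).
  apply: mx_lim => N; have [s hs] := Pstep N.
  have -> : Psi i (P N.+1) - Psi i (P N) = Psi i (s * mu ^+ N.+1) by rewrite -hs; apply/esym/PsiB.
  rewrite PsiM; apply: mxordMl => a b; exact: (ordgeW (leqnSn N) (@Psi_mu i N.+1 a b)).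
have [E hE] := choice lim; exists E.
have resE i : res (E i) = horner_mx (res (al i)) (v * 'X^m).
  apply/eqP; rewrite -subr_eq0 -(Psi_res i (P 0%N)) -map_mxB; apply/eqP/mxord1P.
  have [s hs] := Pstep 0%N.
  have -> : E i - Psi i (P 0%N) = (E i - Psi i (P 1%N)) + Psi i (s * mu ^+ 1).
    by rewrite -hs (PsiB i (P 1%N)) addrA subrK.
  by apply: mxordD; [exact: hE|rewrite PsiM; apply: mxordMl; exact: (@Psi_mu i 1)].
split.
- move=> i; apply: mxord_eq => N.
  have [s hs] := Pidem N.
  have eQ : Psi i (s * mu ^+ N.+1) = Psi i (P N) *m Psi i (P N) - Psi i (P N).
    by rewrite -hs -PsiM -expr2; apply: PsiB.
  have zB (V : zmodType) (x y z t : V) : x - y - (z - t) + (y - t) = x - z.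
    have e : t - z + (y - t) = y - z by rewrite addrC addrA subrK.
    by rewrite opprB -addrA e addrA subrK.
  have -> : E i *m E i - E i = E i *m (E i - Psi i (P N)) + (E i - Psi i (P N)) *m Psi i (P N)
     - (E i - Psi i (P N)) + Psi i (s * mu ^+ N.+1).
    have e1 : E i *m (E i - Psi i (P N)) + (E i - Psi i (P N)) *m Psi i (P N) =
       E i *m E i - Psi i (P N) *m Psi i (P N) by rewrite mulmxBr mulmxBl addrA subrK.
    by rewrite e1 eQ zB.
  apply: mxordD; last by rewrite PsiM; apply: mxordMl => a b; exact: (ordgeW (leqnSn N) (@Psi_mu i N.+1 a b)).
  apply: mxordD; last exact/mxordN/hE.
  by apply: mxordD; [exact/mxordMl/hE|exact/mxordMr/hE].
- exists i0 => e; move: h0; rewrite unitmx_s0; apply/negP; rewrite negbK.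
  have := resE i0; rewrite e map_mx1 -(prednK m0) exprSr mulrA rmorphM /= horner_mx_X.
  by rewrite -mulmxE => /esym /mulmx1_unit [].
- exists i1 => e; move: h1; rewrite unitmx_s0; apply/negP; rewrite negbK.
  have [q' hq] := factor_theorem _ _ q1.
  have e2 := resE i1; rewrite e map_mx0 in e2.
  have : horner_mx (res (al i1)) (u * q' * ('X - 1%:P)) = 1%:M.
    rewrite -mulrA -hq -[u * q](addrK (v * 'X^m)) uv rmorphB /= -e2 subr0; exact: rmorph1.
  rewrite rmorphM rmorphB /= horner_mx_X horner_mx_C -mulmxE => /mulmx1_unit [_ h].
  rewrite map_mxB map_mx1 -opprB.
  have -> : - (res (al i1) - 1%:M) = (-1) *: (res (al i1) - 1%:M) by rewrite scaleN1r.
  by rewrite unitmxZ ?unitrN1.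
move=> phi hphi i; apply: mxord_eq => N.
have comm (Q : {poly k}) : Psi i Q *m phi i = phi i *m Psi (ordS i) Q.
  elim/poly_ind: Q => [|Q c ih]; first by rewrite /Psi !rmorph0 mul0mx mulmx0.
  rewrite /Psi !rmorphD !rmorphM /= !map_polyX !map_polyC /= !horner_mx_X !horner_mx_C.
  rewrite -/(Psi i Q) -/(Psi (ordS i) Q) -!mulmxE mulmxDl mulmxDr -mulmxA hphi mulmxA ih mulmxA.
  by rewrite scalar_mxC.
have -> : E i *m phi i - phi i *m E (ordS i) =
  (E i - Psi i (P N)) *m phi i - phi i *m (E (ordS i) - Psi (ordS i) (P N)).
  by rewrite mulmxBl mulmxBr comm opprB addrA subrK.
apply: mxordD; first exact/mxordMr/hE.
exact/mxordN/mxordMl/hE.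
Qed.

End Lift.

Lemma dpath_pred (R : comNzRingType) d p (phi : 'I_d -> 'M[R]_p) i l : (0 < l)%N ->
  dpath phi i l = phi i *m dpath phi (ordS i) l.-1.
Proof. by case: l. Qed.

Section Cyc.
Variables (R : idomainType) (d : nat) (f : R).
Hypotheses (d0 : (0 < d)%N) (f0 : f != 0).

Lemma ord_iter (i : 'I_d) : i = iter i (@ordS d) (Ordinal d0).
Proof. by apply: val_inj; rewrite /= iter_ordS add0n modn_small. Qed.

Lemma dpath_cyc p (phi : 'I_d -> 'M[R]_p) : \prod_(i < d) phi i = f%:M ->
  forall i, dpath phi i d = f%:M.
Proof.
move=> h i; rewrite (ord_iter i); elim: (nat_of_ord i) => [|j]; first by rewrite -dpath_prod.
rewrite iterS; move: (iter j _ _) => i1 ih.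
have e l : dpath phi l d = dpath phi l d.-1.+1 by rewrite prednK.
rewrite e dpathS -iterSr prednK // iter_ordS_d; apply: (mulmx_scalC f0).
by rewrite -ih e.
Qed.

(** [E i] and [E (ordS i)] are conjugate by [phi i] over the fraction field; multiplying by [f]
    avoids fractions. *)
Lemma dmor_trace p (phi : 'I_d -> 'M[R]_p) E : \prod_(i < d) phi i = f%:M ->
  dmor phi phi E -> forall i j, \tr (E i) = \tr (E j).
Proof.
move=> h hE; suff step i : \tr (E (ordS i)) = \tr (E i).
  have H i : \tr (E i) = \tr (E (Ordinal d0)).
    by rewrite (ord_iter i); elim: (nat_of_ord i) => //= j <-; rewrite step.
  by move=> i j; rewrite H [RHS]H.
have c1 : phi i *m dpath phi (ordS i) d.-1 = f%:M.
  by rewrite -(dpath_cyc h i) [RHS]dpath_pred.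
have c2 := mulmx_scalC f0 c1.
apply: (mulfI f0); rewrite -!mxtraceZ -!mul_mx_scalar -{1}c2 -c1.
by rewrite mulmxA mxtrace_mulC mulmxA -hE -mulmxA.
Qed.

End Cyc.

Lemma diso_split (R : comNzRingType) d p r r' (phi : 'I_d -> 'M[R]_p)
    (psi : 'I_d -> 'M[R]_r) (psi' : 'I_d -> 'M[R]_r') B C B' C' :
  dmor phi psi C -> dmor psi phi B -> dmor phi psi' C' -> dmor psi' phi B' ->
  (forall i, B i *m C i + B' i *m C' i = 1%:M) ->
  (forall i, C i *m B i = 1%:M) -> (forall i, C' i *m B' i = 1%:M) ->
  (forall i, C i *m B' i = 0) -> (forall i, C' i *m B i = 0) ->
  diso phi (dsumx psi psi').
Proof.
move=> m1 m2 m3 m4 e CB CB' e1 e2.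
exists (fun i => col_mx (C i) (C' i)), (fun i => row_mx (B i) (B' i)); split=> i.
- by rewrite mul_col_mx mul_block_col !mul0mx addr0 add0r m1 m3.
- by rewrite mul_mx_row mul_row_block !mulmx0 addr0 add0r m2 m4.
- by rewrite mul_row_col e.
- by rewrite mul_col_row CB CB' e1 e2 -scalar_mx_block.
Qed.

Section Local.
Variables (k : fieldType) (n d : nat).
Notation A := (series k n).
Hypothesis char0 : [pchar k] =i pred0.

Lemma natr_inj_series a b : a%:R = b%:R :> A -> a = b.
Proof.
move=> /(congr1 (@s0 k n)); rewrite !rmorph_nat.
have H c e : (c <= e)%N -> c%:R = e%:R :> k -> c = e.
  move=> /subnK <-; rewrite natrD => /eqP; rewrite -subr_eq0 opprD addrCA subrr addr0 oppr_eq0.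
  have /pcharf0P -> := char0.
  by move=> /eqP ->.
case: (leqP a b) => [/H//|/ltnW/H h e]; by rewrite h.
Qed.

Lemma mxtrace_idem p r (B : 'M[A]_(p, r)) (C : 'M[A]_(r, p)) : C *m B = 1%:M ->
  \tr (B *m C) = r%:R.
Proof. by move=> h; rewrite mxtrace_mulC h mxtrace1. Qed.

Lemma diso_rk p q (phi : 'I_d -> 'M[A]_p) (psi : 'I_d -> 'M[A]_q) : (0 < d)%N ->
  diso phi psi -> p = q.
Proof.
move=> d0 [al [be [_ _ h1 h2]]]; apply: natr_inj_series.
by rewrite -(mxtrace1 _ p) -(mxtrace1 _ q) -(h1 (Ordinal d0)) -(h2 (Ordinal d0)) mxtrace_mulC.
Qed.

Variable (f : A).
Hypotheses (d0 : (0 < d)%N) (f0 : f != 0).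

Lemma split_prod p r (phi : 'I_d -> 'M[A]_p) (B : 'I_d -> 'M[A]_(p, r)) (C : 'I_d -> 'M[A]_(r, p)) :
  \prod_(i < d) phi i = f%:M -> (forall i, C i *m B i = 1%:M) ->
  dmor phi phi (fun i => B i *m C i) ->
  [/\ \prod_(i < d) (C i *m phi i *m B (ordS i)) = f%:M,
     dmor phi (fun i => C i *m phi i *m B (ordS i)) C &
     dmor (fun i => C i *m phi i *m B (ordS i)) phi B].
Proof.
move=> h CB hE; pose psi i := C i *m phi i *m B (ordS i); rewrite -/psi.
have hB : dmor psi phi B.
  by move=> i; rewrite /psi !mulmxA hE -!mulmxA CB mulmx1.
have hC : dmor phi psi C.
  by move=> i; rewrite /psi -!mulmxA -hE !mulmxA CB mul1mx.
split=> //; rewrite (dpath_prod psi d0).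
have := dmor_path (Ordinal d0) d hB; rewrite iter_ordS_d -(dpath_prod phi d0) h => /(congr1 (mulmx (C (Ordinal d0)))).
by rewrite mulmxA CB mul1mx => ->; rewrite -scalar_mxC mulmxA CB mul1mx.
Qed.

(** Each [E i] splits separately. All ranks agree because the rank is the trace, the trace does not
    depend on [i], and characteristic 0 recovers the number from its image in the ring. *)
Lemma idem_dsplit p (phi : 'I_d -> 'M[A]_p) E : \prod_(i < d) phi i = f%:M ->
  dmor phi phi E -> (forall i, E i *m E i = E i) ->
  exists r (B : 'I_d -> 'M[A]_(p, r)) (C : 'I_d -> 'M[A]_(r, p)),
    (forall i, C i *m B i = 1%:M) /\ E = fun i => B i *m C i.
Proof.
move=> h hE EE; have [r [B0 [C0 [cb bc]]]] := idem_split (EE (Ordinal d0)).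
exists r; have H i : exists BC : 'M[A]_(p, r) * 'M[A]_(r, p), BC.2 *m BC.1 = 1%:M /\ BC.1 *m BC.2 = E i.
  have [r' [B [C [cb' bc']]]] := idem_split (EE i).
  have e : r' = r.
    apply: natr_inj_series; rewrite -(mxtrace_idem cb) -(mxtrace_idem cb') bc bc'.
    exact: (dmor_trace d0 f0 h hE).
  by subst r'; exists (B, C).
have [F hF] := choice H; exists (fun i => (F i).1), (fun i => (F i).2).
split=> [i|]; first by case: (hF i).
by apply: funext => i; case: (hF i).
Qed.

(** The local ring property: otherwise [idem_lift] gives a nontrivial idempotent endomorphism, and
    its image and that of its complement decompose [X]. *)
Lemma indec_local (X : dmf d f) al : indec X -> dmor X X al ->
  (forall i, al i \in unitmx) \/ (forall i, 1%:M - al i \in unitmx).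
Proof.
case: X al => -[|p] phi hX al [rk0 Xi] hal //=; apply: contrapT => /not_orP[h1 h2].
have {h1} h1 : exists i, al i \notin unitmx by move/existsNP: h1 => [i /negP hi]; exists i.
have {h2} h2 : exists i, 1%:M - al i \notin unitmx by move/existsNP: h2 => [i /negP hi]; exists i.
have [E [EE [i0 E1] [i1 E0] hE]] := idem_lift h1 h2.
have {hE} hE : dmor phi phi E by apply: hE.
have hF : dmor phi phi (fun i => 1%:M - E i).
  by move=> i; rewrite mulmxBl mulmxBr mul1mx mulmx1 hE.
have FF i : (1%:M - E i) *m (1%:M - E i) = 1%:M - E i.
  by rewrite mulmxBl !mulmxBr mul1mx mulmx1 mul1mx EE subrr subr0.
have [r [B [C [CB eE]]]] := idem_dsplit hX hE EE.
have [r' [B' [C' [CB' eF]]]] := idem_dsplit hX hF FF.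
have eEi i : B i *m C i = E i by rewrite eE.
have eFi i : B' i *m C' i = 1%:M - E i by rewrite -[RHS]/((fun i => 1%:M - E i) i) eF.
have [P1 m1 m2] := split_prod (B := B) (C := C) hX CB (eq_ind _ (dmor phi phi) hE _ eE).
have [P2 m3 m4] := split_prod (B := B') (C := C') hX CB' (eq_ind _ (dmor phi phi) hF _ eF).
apply: Xi; exists (Dmf P1), (Dmf P2); split=> /=.
- case: (posnP r) => // e; case: E0; rewrite -eEi.
  by move: (B i1) (C i1); rewrite e => b c; rewrite [b]thinmx0 mul0mx.
- case: (posnP r') => // e; case: E1; apply/eqP; rewrite eq_sym -subr_eq0 -eFi; apply/eqP.
  by move: (B' i0) (C' i0); rewrite e => b c; rewrite [b]thinmx0 mul0mx.
apply: (diso_split m1 m2 m3 m4 _ CB CB') => i; first by rewrite eEi eFi addrC subrK.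
- have CE : C i *m E i = C i by rewrite -eEi mulmxA CB mul1mx.
  rewrite -[B' i]mulmx1 -(CB' i) (mulmxA (B' i)) eFi mulmxBl mul1mx mulmxBr mulmxA CE subrr.
  by [].
- have EB : E i *m B i = B i by rewrite -eEi -mulmxA CB mulmx1.
  rewrite -[C' i]mul1mx -(CB' i) -(mulmxA (C' i)) eFi mulmxBr mulmx1 mulmxBl -mulmxA EB subrr.
  by [].
Qed.

Lemma dmor_invmx p (phi : 'I_d -> 'M[A]_p) (psi : 'I_d -> 'M[A]_p) al :
  dmor phi psi al -> (forall i, al i \in unitmx) -> dmor psi phi (fun i => invmx (al i)).
Proof. by move=> h u; apply: (dmor_inv h) => i; rewrite ?mulVmx ?mulmxV. Qed.

(** Induction on the certificate: if [g1 + g2] is invertible then [g1] or [g2] is, so eventually a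
    single term through one [C] is invertible. *)
Lemma fac_retract P (X : dmf d f) g : indec X -> @fac _ _ _ P X X g ->
  (forall i, g i \in unitmx) ->
  exists C al be, [/\ P C, dmor X C al, dmor C X be & forall i, be i *m al i = 1%:M].
Proof.
move=> Xi hg; elim: hg => [|g1 g2 h1 ih1 h2 ih2|C al be PC ha hb] u.
- case: Xi => p0 _; have Z p : (0 < p)%N -> (0 : 'M[A]_p) \notin unitmx.
    by case: p => // p _; rewrite unitmxE det0 unitr0.
  by have := u (Ordinal d0); rewrite (negPf (Z _ p0)).
- have m1 := fac_mor h1; have m2 := fac_mor h2.
  have mi := dmor_invmx (dmorD m1 m2) u.
  case: (indec_local Xi (dmor_comp m1 mi)) => hu.
    by apply: ih1 => i; have := hu i; rewrite unitmx_mul => /andP[].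
  apply: ih2 => i; have := hu i; rewrite -{1}(mulVmx (u i)) -mulmxBr addrAC subrr add0r unitmx_mul.
  by case/andP.
exists C, al, (fun i => invmx (be i *m al i) *m be i); split=> //.
  exact: dmor_comp hb (dmor_invmx (dmor_comp ha hb) u).
by move=> i; rewrite -mulmxA mulVmx.
Qed.

(** [al be] is an idempotent endomorphism of the indecomposable [D], hence 1 or 0; the value 0 would
    force [X] to have rank 0. *)
Lemma retract_iso (X D : dmf d f) al be : indec X -> indec D ->
  dmor X D al -> dmor D X be -> (forall i, be i *m al i = 1%:M) -> diso X D.
Proof.
move=> [X0 _] Di ha hb e.
have ee i : al i *m be i *m (al i *m be i) = al i *m be i.
  by rewrite -mulmxA (mulmxA (be i)) e mul1mx.
case: (indec_local Di (dmor_comp hb ha)) => u.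
  exists al, be; split=> // i.
  by have := congr1 (mulmx (invmx (al i *m be i))) (ee i); rewrite mulKmx ?mulVmx.
have z i : al i *m be i = 0.
  have : (1%:M - al i *m be i) *m (al i *m be i) = 0 by rewrite mulmxBl mul1mx ee subrr.
  by move/(congr1 (mulmx (invmx (1%:M - al i *m be i)))); rewrite mulKmx // mulmx0.
have : be (Ordinal d0) *m (al (Ordinal d0) *m be (Ordinal d0)) *m al (Ordinal d0) = 1%:M.
  by rewrite mulmxA e mul1mx e.
rewrite z mulmx0 mul0mx.
have Z p : (0 < p)%N -> (0 : 'M[A]_p) != 1%:M.
  by case: p => // p _; rewrite eq_sym oner_eq0.
by move=> /eqP; rewrite (negPf (Z _ X0)).
Qed.

End Local.

(** * Finite type through finite lists *)

Section Finite.
Variables (k : fieldType) (n d : nat).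
Notation A := (series k n).
Hypothesis char0 : [pchar k] =i pred0.
Variable (f : A).
Hypotheses (d0 : (0 < d)%N).

Lemma decompose (X : dmf d f) : (0 < rk X)%N -> ~ indec X ->
  exists Y Z : dmf d f, [/\ (rk Y < rk X)%N, (rk Z < rk X)%N & diso X (dsum Y Z)].
Proof.
move=> X0 Xi; apply: contrapT => H; apply: Xi; split=> // -[Y [Z [Y0 Z0 h]]].
apply: H; exists Y, Z; have /= e := diso_rk char0 d0 h.
by split=> //; rewrite e; lia.
Qed.

Lemma facid_rk0 P (X : dmf d f) : rk X = 0%N -> facid P X.
Proof.
case: X => p phi hX /= e; subst p; rewrite /facid (_ : (fun=> _) = fun=> 0); first exact: fac0.
by apply: funext => i; apply: flatmx0.
Qed.

Lemma indec_facid (X : dmf d f) : facid (@indec _ d f) X.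
Proof.
have [p] := ubnP (rk X); elim: p X => // p ih X; rewrite ltnS => hX.
case: (posnP (rk X)) => [/facid_rk0 //|X0].
case: (pselect (indec X)) => Xi; first exact: facid_self.
have [Y [Z [hY hZ h]]] := decompose X0 Xi.
by apply: (facid_iso h); apply: facid_sum; apply: ih; apply: leq_trans hX.
Qed.

Lemma finite_indec (l : seq (dmf d f)) : exists2 L : seq (dmf d f),
  (forall D, List.In D L -> indec D) &
  (forall C, List.In C l -> facid (fun D => List.In D L) C).
Proof.
elim: l => [|C l [L h1 h2]]; first by exists [::].
have [L' k1 k2] := fac_list (indec_facid C).
exists (L' ++ L) => [D hD|D [<-|hD]].
- by case: (List.in_app_or _ _ _ hD) => [/k1|/h1].
- apply: (fac_trans k2) => E hE; apply: facid_self; apply: List.in_or_app; by left.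
- apply: (fac_trans (h2 _ hD)) => E hE; apply: facid_self; apply: List.in_or_app; by right.
Qed.

(** Replace the list by the indecomposables through which its members factor; an indecomposable [X]
    is then a retract of one of them, hence isomorphic to it. *)
Lemma fint_criterion (l : seq (dmf d f)) : f != 0 ->
  (forall X : dmf d f, indec X -> facid (fun C => List.In C l) X) -> fint d f.
Proof.
move=> f0 h; have [L h1 h2] := finite_indec l; exists L => X Xi.
have hX := fac_trans (h X Xi) h2.
have [C [al [be [CL ha hb e]]]] :=
  fac_retract char0 d0 f0 Xi hX (fun i => unitmx1 _ _).
exists C => //; exact: (retract_iso char0 d0 f0 Xi (h1 _ CL) ha hb e).
Qed.

Lemma fint_facid : fint d f -> exists l : seq (dmf d f),
  forall X : dmf d f, facid (fun C => List.In C l) X.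
Proof.
move=> [l hl]; exists l => X; apply: (fac_trans (indec_facid X)) => D /hl [E EL h].
by apply: (facid_iso h); apply: facid_self.
Qed.

(** Induction on the rank bound: a factorization is empty, indecomposable, or a sum of two of
    smaller rank. This is what frees the infinite families from any proof of indecomposability. *)
Lemma fint_rk p : fint d f -> exists L : seq (dmf d f),
  forall X : dmf d f, (rk X <= p)%N -> exists2 D, List.In D L & diso X D.
Proof.
move=> [l hl]; have z : \prod_(i < d) (0 : 'M[A]_0) = f%:M by rewrite [LHS]flatmx0 [RHS]flatmx0.
elim: p => [|p [L hL]].
  exists [:: Dmf z] => X; rewrite leqn0 => /eqP X0; exists (Dmf z); first by left.
  case: X X0 => q phi hX /= e; subst q.
  by exists (fun=> 0), (fun=> 0); split=> i; rewrite [LHS]flatmx0 [RHS]flatmx0.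
exists (Dmf z :: l ++ List.flat_map (fun Y => List.map (fun Z => dsum Y Z) L) L) => X hX.
case: (posnP (rk X)) => X0.
  exists (Dmf z); first by left.
  case: X X0 {hX} => q phi hX /= e; subst q.
  by exists (fun=> 0), (fun=> 0); split=> i; rewrite [LHS]flatmx0 [RHS]flatmx0.
case: (pselect (indec X)) => Xi.
  have [D Dl h] := hl X Xi; exists D => //; right; apply: List.in_or_app; by left.
have [Y [Z [hY hZ h]]] := decompose X0 Xi.
have [Y' Y'L hY'] := hL Y (leq_trans hY hX).
have [Z' Z'L hZ'] := hL Z (leq_trans hZ hX).
exists (dsum Y' Z'); last exact: (diso_trans h (diso_sum hY' hZ')).
right; apply: List.in_or_app; right; apply/List.in_flat_map; exists Y'; split=> //.
by apply/List.in_map_iff; exists Z'.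
Qed.

Lemma list_In_nth T (l : seq T) x : List.In x l -> exists2 i, (i < size l)%N & forall x0, nth x0 l i = x.
Proof.
elim: l => //= y l ih [->|/ih [i hi e]]; first by exists 0%N.
by exists i.+1.
Qed.

Lemma fint_pigeon p (X : nat -> dmf d f) : fint d f -> (forall t, (rk (X t) <= p)%N) ->
  exists t t', (t < t')%N /\ diso (X t) (X t').
Proof.
move=> hf hX; have [L hL] := fint_rk p hf.
have H t : exists i, (i < size L)%N /\ diso (X t) (nth (X 0%N) L i).
  have [D DL hD] := hL (X t) (hX t); have [i hi e] := list_In_nth DL.
  by exists i; split=> //; rewrite (e (X 0%N)).
have [g hg] := choice H.
pose F (t : 'I_(size L).+1) : 'I_(size L) := Ordinal (proj1 (hg t)).
have /injectivePn [t [t' ne e]] : ~~ injectiveb F.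
  by apply/injectiveP => /leq_card; rewrite !card_ord ltnn.
have hd : diso (X t) (X t').
  apply: (diso_trans (proj2 (hg t))); apply: diso_sym.
  by have -> : g t = g t'; [have := congr1 val e|exact: (proj2 (hg t'))].
have : t != t' :> nat by [].
rewrite neq_ltn => /orP[h|h]; first by exists t, t'.
by exists t', t; split=> //; apply: diso_sym.
Qed.

End Finite.

(** * Change of base ring and of coordinates *)

Section Transport.
Variables (R R' : comNzRingType) (d : nat) (th : {rmorphism R -> R'}).

Lemma dmapP f f' (e : th f = f') (X : dmf d f) : \prod_(i < d) map_mx th (X i) = f'%:M.
Proof.
rewrite -e -map_scalar_mx -(dmfP X); elim/big_rec2: _ => [|i y1 y2 _ ->]; first by rewrite map_mx1.
by rewrite -!mulmxE map_mxM.
Qed.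
Definition dmap f f' (e : th f = f') (X : dmf d f) : dmf d f' := Dmf (dmapP e X).

Lemma dmor_map p q (phi : 'I_d -> 'M[R]_p) (psi : 'I_d -> 'M[R]_q) al :
  dmor phi psi al ->
  dmor (fun i => map_mx th (phi i)) (fun i => map_mx th (psi i)) (fun i => map_mx th (al i)).
Proof. by move=> h i; rewrite -!map_mxM h. Qed.

Lemma diso_map p q (phi : 'I_d -> 'M[R]_p) (psi : 'I_d -> 'M[R]_q) : diso phi psi ->
  diso (fun i => map_mx th (phi i)) (fun i => map_mx th (psi i)).
Proof.
move=> [al [be [h1 h2 h3 h4]]].
exists (fun i => map_mx th (al i)), (fun i => map_mx th (be i)).
by split; [exact: dmor_map|exact: dmor_map|..] => i; rewrite -map_mxM ?h3 ?h4 map_mx1.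
Qed.

Lemma map_dsumx p q (phi : 'I_d -> 'M[R]_p) (psi : 'I_d -> 'M[R]_q) :
  (fun i => map_mx th (dsumx phi psi i)) =
  dsumx (fun i => map_mx th (phi i)) (fun i => map_mx th (psi i)).
Proof. by apply: funext => i; rewrite /dsumx map_block_mx !map_mx0. Qed.

End Transport.

Lemma fint_transport (R R' : comNzRingType) d (th : {rmorphism R -> R'})
    (th' : {rmorphism R' -> R}) f f' :
  cancel th th' -> cancel th' th -> th f = f' -> fint d f -> fint d f'.
Proof.
move=> K K' e [l hl]; have e' : th' f' = f by rewrite -e K.
have mK p (M : 'M[R']_p) : map_mx th (map_mx th' M) = M.
  by apply/matrixP => i j; rewrite !mxE K'.
exists (List.map (dmap e) l) => X [X0 Xi].
have [|D Dl h] := hl (dmap e' X).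
  split=> // -[Y [Z [Y0 Z0 h]]]; apply: Xi; exists (dmap e Y), (dmap e Z); split=> //.
  have := diso_map th h; rewrite map_dsumx /= (_ : (fun i => _) = X) //.
  by apply: funext => i; rewrite mK.
exists (dmap e D); first by apply/List.in_map_iff; exists D.
have := diso_map th h; rewrite /= (_ : (fun i => map_mx th (map_mx _ _)) = X) //.
by apply: funext => i; rewrite mK.
Qed.

Lemma fint_req (k : fieldType) n d (f g : series k n) : req f g -> fint d f <-> fint d g.
Proof.
suff H : forall f' g' : series k n, req f' g' -> fint d g' -> fint d f'.
  by move=> h; split; apply: H => //; apply: req_sym.
move=> f' g' [phi [hc ->]]; have [psi [h1 h2 h3]] := cchange_inv_ex hc; case: hc => p1 _.
have [th eth] := chom_rmorph (gsubst_chom p1).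
have [th' eth'] := chom_rmorph (gsubst_chom h1).
apply: (@fint_transport _ _ d th th'); last exact: eth.
- move=> x; rewrite eth eth' (chom_gsubst _ (gsubst_chom h1)) // (_ : (fun i => _) = @svar k n) ?gsubst_id //.
  exact: funext.
- move=> x; rewrite eth eth' (chom_gsubst _ (gsubst_chom p1)) // (_ : (fun i => _) = @svar k n) ?gsubst_id //.
  exact: funext.
Qed.

(** * Translation between the given definitions and library matrices *)

Section Defs.
Variables (k : fieldType) (n d : nat).
Notation A := (series k n).

Definition tomx p q (M : smat k n p q) : 'M[A]_(p, q) := \matrix_(i, j) M i j.
Definition ofmx p q (M : 'M[A]_(p, q)) : smat k n p q := fun i j => M i j.

Lemma tomxK p q (M : smat k n p q) : ofmx (tomx M) = M.
Proof. by apply: funext => i; apply: funext => j; rewrite /ofmx mxE. Qed.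
Lemma ofmxK p q (M : 'M[A]_(p, q)) : tomx (ofmx M) = M.
Proof. by apply/matrixP => i j; rewrite mxE. Qed.
Lemma tomxM p q r (M : smat k n p q) (M' : smat k n q r) : tomx (mmul M M') = tomx M *m tomx M'.
Proof. by apply/matrixP => i j; rewrite !mxE; apply: eq_bigr => l _; rewrite !mxE. Qed.
Lemma tomx1 p : tomx (@mid k n p) = 1%:M.
Proof. by apply/matrixP => i j; rewrite !mxE /mid; case: eqP. Qed.
Lemma tomx_scal (f : A) p : tomx (@mscal k n f p) = f%:M.
Proof. by apply/matrixP => i j; rewrite !mxE /mscal; case: eqP. Qed.
Lemma tomx_prod p (phi : 'I_d -> smat k n p p) :
  tomx (mprod phi) = \prod_(i < d) tomx (phi i).
Proof.
transitivity (\prod_(i <- enum 'I_d) tomx (phi i)); last by rewrite enumT [index_enum _]unlock.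
rewrite /mprod; elim: (enum 'I_d) => [|i s ih] /=; first by rewrite big_nil tomx1.
by rewrite big_cons tomxM ih.
Qed.
Lemma tomx_diag p q (M : smat k n p p) (M' : smat k n q q) :
  tomx (bdiag M M') = block_mx (tomx M) 0 0 (tomx M').
Proof.
apply/matrixP => i j; rewrite !mxE /bdiag; case: splitP => a _; rewrite !mxE;
by case: splitP => b _; rewrite !mxE.
Qed.
Lemma tomx_inj p q (M M' : smat k n p q) : tomx M = tomx M' -> M = M'.
Proof. by move=> h; rewrite -(tomxK M) h tomxK. Qed.

Lemma iso_rawE p q (phi : 'I_d -> smat k n p p) (psi : 'I_d -> smat k n q q) :
  iso_raw phi psi <-> diso (fun i => tomx (phi i)) (fun i => tomx (psi i)).
Proof.
split=> [[al [be [h1 h2 h3 h4]]]|[al [be [h1 h2 h3 h4]]]].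
  exists (fun i => tomx (al i)), (fun i => tomx (be i)).
  by split=> i; rewrite -!tomxM ?h1 ?h2 ?h3 ?h4 // tomx1.
exists (fun i => ofmx (al i)), (fun i => ofmx (be i)).
by split=> i; apply: tomx_inj; rewrite !tomxM !ofmxK ?h1 ?h2 ?h3 ?h4 // tomx1.
Qed.

Variable f : A.

Lemma toP (X : MF d f) : \prod_(i < d) tomx (@mf_phi k n d f X i) = f%:M.
Proof. by rewrite -tomx_prod mf_eq tomx_scal. Qed.
Definition todmf (X : MF d f) : dmf d f := Dmf (toP X).
Lemma ofP (X : dmf d f) : mprod (fun i => ofmx (X i)) = mscal f (p := rk X).
Proof.
apply: tomx_inj; rewrite tomx_prod tomx_scal -dmfP.
by apply: eq_bigr => i _; rewrite ofmxK.
Qed.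
Definition ofdmf (X : dmf d f) : MF d f := Build_MF (ofP X).

Lemma todmfK (X : dmf d f) : (fun i => tomx (@mf_phi k n d f (ofdmf X) i)) = X.
Proof. by apply: funext => i; rewrite /= ofmxK. Qed.

Lemma ofdmfK (X : dmf d f) : todmf (ofdmf X) = X.
Proof.
case: X => p phi hX; have H psi (h' : \prod_(i < d) psi i = f%:M) : psi = phi -> Dmf h' = Dmf hX.
  by move=> e; subst psi; congr Dmf; apply: Prop_irrelevance.
by apply: H; apply: funext => i; rewrite /= ofmxK.
Qed.

Lemma tomx_dsum (Y Z : MF d f) :
  (fun i => tomx (dsum_phi (X := Y) (Y := Z) i)) = dsumx (todmf Y) (todmf Z).
Proof. by apply: funext => i; rewrite /dsum_phi tomx_diag. Qed.

Lemma indecE (X : MF d f) : indecomposable X <-> indec (todmf X).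
Proof.
split=> -[X0 h]; split=> //= -[Y [Z [Y0 Z0 hi]]]; apply: h.
  exists (ofdmf Y), (ofdmf Z); split=> //; apply/iso_rawE; rewrite tomx_dsum.
  by rewrite /= !todmfK.
by exists (todmf Y), (todmf Z); split=> //; move/iso_rawE: hi; rewrite tomx_dsum.
Qed.

Lemma finite_MF_typeE : finite_MF_type d f <-> fint d f.
Proof.
split=> [[N [L hL]]|[l hl]].
  exists (List.map (fun i => todmf (L i)) (enum 'I_N)) => X Xi.
  have [|i hi] := hL (ofdmf X).
    by apply/indecE; rewrite ofdmfK.
  exists (todmf (L i)); last by move/iso_rawE: hi; rewrite todmfK.
  apply/List.in_map_iff; exists i; split=> //.
  by have := mem_enum 'I_N i; elim: (enum _) => //= j s ih; rewrite inE => /orP[/eqP->|/ih]; [left|right].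
pose L (i : 'I_(size l)) := ofdmf (tnth (in_tuple l) i).
exists (size l), L => X /indecE /hl [D Dl hD].
have [i hi e] := list_In_nth Dl; exists (Ordinal hi); apply/iso_rawE.
have eD : D = tnth (in_tuple l) (Ordinal hi) by rewrite (tnth_nth D) /= e.
by move: hD; rewrite eD -[tnth _ _]ofdmfK.
Qed.

End Defs.

(** * Adding a square *)

Section FreeModules.
Variable R : comNzRingType.

(** Free modules with chosen coordinates. The action is a field of the record and not a canonical
    structure, because [k[[u, v]]] is later a module over [k[[y, x]]] through a substitution,
    besides being a ring itself. *)
Record fmod := Fmod {
  car : zmodType;
  act : R -> car -> car;
  fdim : nat;
  vec : car -> 'cV[R]_fdim;
  unvec : 'cV[R]_fdim -> car;
  vecK : cancel vec unvec;
  unvecK : cancel unvec vec;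
  vecD : forall u v, vec (u + v) = vec u + vec v;
  vecZ : forall a v, vec (act a v) = a *: vec v }.

Implicit Types U V W : fmod.

Definition flin V W (g : car V -> car W) :=
  (forall u v, g (u + v) = g u + g v) /\ (forall a v, g (act a v) = act a (g v)).

Lemma vec_inj V : injective (@vec V). Proof. exact: can_inj (@vecK V). Qed.
Lemma unvecD V u v : @unvec V (u + v) = unvec u + unvec v.
Proof. by apply: vec_inj; rewrite vecD !unvecK. Qed.
Lemma unvecZ V a v : @unvec V (a *: v) = act a (unvec v).
Proof. by apply: vec_inj; rewrite vecZ !unvecK. Qed.
Lemma vec0 V : @vec V 0 = 0.
Proof. by apply: (addIr (vec 0)); rewrite -vecD !add0r. Qed.

Definition mxof V W (g : car V -> car W) : 'M[R]_(fdim W, fdim V) :=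
  \matrix_(i, j) vec (g (unvec (delta_mx j 0))) i 0.

Lemma flin0 V W (g : car V -> car W) : flin g -> g 0 = 0.
Proof. by case=> gD _; apply: (addIr (g 0)); rewrite -gD !add0r. Qed.

Lemma flin_comp U V W (g : car V -> car W) (h : car U -> car V) :
  flin g -> flin h -> flin (g \o h).
Proof. by move=> [g1 g2] [h1 h2]; split=> [u v|a v] /=; rewrite ?h1 ?g1 ?h2 ?g2. Qed.

Lemma mxofP V W (g : car V -> car W) v : flin g -> vec (g v) = mxof g *m vec v.
Proof.
move=> gl; have [gD gZ] := gl.
rewrite -{1}(vecK v); move: (vec v) => c.
have -> : c = \sum_j c j 0 *: delta_mx j 0.
  apply/matrixP => i j; rewrite summxE (bigD1 i) //= big1 ?addr0 => [|l h]; rewrite !mxE ord1.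
    by rewrite !eqxx mulr1.
  by rewrite eq_sym (negPf h) mulr0.
have H (r : seq 'I_(fdim V)) (a : 'I_(fdim V) -> R) :
    vec (g (unvec (\sum_(j <- r) a j *: delta_mx j 0))) = mxof g *m (\sum_(j <- r) a j *: delta_mx j 0).
  elim: r => [|j r ih].
    have e : @unvec V 0 = 0 by apply: vec_inj; rewrite unvecK vec0.
    by rewrite !big_nil e (flin0 gl) vec0 mulmx0.
  rewrite !big_cons unvecD gD vecD ih mulmxDr unvecZ gZ vecZ -scalemxAr; congr (_ *: _ + _).
  apply/matrixP => i l; rewrite !mxE ord1 (bigD1 j) //= big1 ?addr0 => [|b h]; rewrite !mxE.
    by rewrite !eqxx mulr1.
  by rewrite (negPf h) mulr0.
exact: H.
Qed.

Lemma mx_cV_ext p q (M N : 'M[R]_(p, q)) : (forall v : 'cV_q, M *m v = N *m v) -> M = N.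
Proof.
move=> h; apply/matrixP => i j; have /matrixP/(_ i 0) := h (delta_mx j 0).
by rewrite -!colE !mxE.
Qed.

Lemma mxof_comp U V W (g : car V -> car W) (h : car U -> car V) :
  flin g -> flin h -> mxof (g \o h) = mxof g *m mxof h.
Proof.
move=> gl hl; apply: mx_cV_ext => v; rewrite -(unvecK v) -mxofP; last exact: flin_comp.
by rewrite -mulmxA -!mxofP.
Qed.

Lemma mxof_eq V W (g : car V -> car W) M : (forall v, vec (g v) = M *m vec v) -> flin g -> mxof g = M.
Proof. by move=> h gl; apply: mx_cV_ext => v; rewrite -(unvecK v) -mxofP. Qed.

Lemma flin_id V : flin (@id (car V)). Proof. by []. Qed.

Lemma mxof_id V : mxof (@id (car V)) = 1%:M.
Proof. by apply: mxof_eq => // v; rewrite mul1mx. Qed.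

Lemma flin_act V a : flin (@act V a).
Proof.
split=> [u v|b v]; apply: vec_inj; rewrite !(vecZ, vecD) ?scalerDr //.
by rewrite scalerA mulrC -scalerA.
Qed.

Lemma mxof_act V a : mxof (@act V a) = a%:M.
Proof. by apply: (mxof_eq _ (flin_act V a)) => v; rewrite vecZ mul_scalar_mx. Qed.

Lemma flinD V W (g h : car V -> car W) : flin g -> flin h -> flin (fun v => g v + h v).
Proof.
move=> [g1 g2] [h1 h2]; split=> [u v|a v]; first by rewrite g1 h1 addrACA.
by rewrite g2 h2; case: (flin_act W a) => ->.
Qed.

Lemma mxofD V W (g h : car V -> car W) : flin g -> flin h ->
  mxof (fun v => g v + h v) = mxof g + mxof h.
Proof.
move=> gl hl; apply: mxof_eq; last exact: flinD.
by move=> v; rewrite vecD mulmxDl -!mxofP.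
Qed.

Definition fcV p : fmod := @Fmod 'cV[R]_p (fun a v => a *: v) p id id
  (fun=> erefl) (fun=> erefl) (fun _ _ => erefl) (fun _ _ => erefl).

Lemma mxof_mul p q (M : 'M[R]_(p, q)) : @mxof (fcV q) (fcV p) (mulmx M) = M.
Proof.
apply: mxof_eq => //; split=> [u v|a v]; [exact: mulmxDr|by rewrite /= scalemxAr].
Qed.
Lemma flin_mul p q (M : 'M[R]_(p, q)) : flin (mulmx M : car (fcV q) -> car (fcV p)).
Proof. by split=> [u v|a v]; [exact: mulmxDr|rewrite /= scalemxAr]. Qed.

Section FM.
Variables p q : nat.
Definition mxcol (v : 'M[R]_(p, q)) : 'cV[R]_(p * q) := (mxvec v)^T.
Definition colmx (v : 'cV[R]_(p * q)) : 'M[R]_(p, q) := vec_mx v^T.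
Fact mxcolK : cancel mxcol colmx. Proof. by move=> v; rewrite /colmx trmxK mxvecK. Qed.
Fact colmxK : cancel colmx mxcol. Proof. by move=> v; rewrite /mxcol vec_mxK trmxK. Qed.
Fact mxcolD u v : mxcol (u + v) = mxcol u + mxcol v.
Proof. by rewrite /mxcol !linearD. Qed.
Fact mxcolZ a v : mxcol (a *: v) = a *: mxcol v.
Proof. by rewrite /mxcol !linearZ. Qed.
Definition fM : fmod := @Fmod 'M[R]_(p, q) (fun a v => a *: v) (p * q) mxcol colmx mxcolK colmxK mxcolD mxcolZ.
End FM.

Section Fpath.
Variables (d : nat) (V : fmod) (psi : 'I_d -> car V -> car V).
Hypothesis psil : forall i, flin (psi i).

Fixpoint fpath i l : car V -> car V := if l is l'.+1 then psi i \o fpath (ordS i) l' else id.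

Lemma flin_fpath i l : flin (fpath i l).
Proof. by elim: l i => [|l ih] i; [exact: flin_id|apply: flin_comp]. Qed.

Lemma dpath_mxof i l : dpath (fun j => mxof (psi j)) i l = mxof (fpath i l).
Proof.
elim: l i => [|l ih] i; first by rewrite mxof_id.
by rewrite /= ih mxof_comp //; apply: flin_fpath.
Qed.

Lemma mxof_prod f : (0 < d)%N -> (forall i v, fpath i d v = act f v) ->
  \prod_(i < d) mxof (psi i) = f%:M.
Proof.
move=> d0 h; rewrite dpath_prod dpath_mxof -mxof_act; congr mxof.
by apply: funext => v; rewrite h.
Qed.

End Fpath.

Lemma dmor_mxof d V W (psi : 'I_d -> car V -> car V) (chi : 'I_d -> car W -> car W) al :
  (forall i, flin (psi i)) -> (forall i, flin (chi i)) -> (forall i, flin (al i)) ->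
  (forall i v, al i (psi i v) = chi i (al (ordS i) v)) ->
  dmor (fun i => mxof (psi i)) (fun i => mxof (chi i)) (fun i => mxof (al i)).
Proof.
move=> h1 h2 h3 h i; rewrite -!mxof_comp //; congr mxof.
by apply: funext => v /=; rewrite h.
Qed.

End FreeModules.

(** * The ring A[z] / (z^d - F) and its map onto a factorization *)

Section Companion.
Variables (R : comNzRingType) (e p : nat) (F : R).
Notation d := e.+1.
Notation V := 'M[R]_(p, d).

Lemma mx_col_ext q (u v : 'M[R]_(p, q)) : (forall l, col l u = col l v) -> u = v.
Proof. by move=> h; apply/matrixP => a l; have /matrixP/(_ a 0) := h l; rewrite !mxE. Qed.

Lemma colD q (l : 'I_q) (u v : 'M[R]_(p, q)) : col l (u + v) = col l u + col l v.
Proof. exact: linearD. Qed.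
Lemma colZ q (l : 'I_q) a (u : 'M[R]_(p, q)) : col l (a *: u) = a *: col l u.
Proof. exact: linearZ. Qed.

Lemma ord_pred0 : ord_pred ord0 = ord_max :> 'I_d.
Proof. by apply: val_inj; rewrite /= modn_small. Qed.
Lemma ord_predS (l : 'I_e) : ord_pred (lift ord0 l) = widen_ord (leqnSn e) l.
Proof.
by apply: val_inj; rewrite /= add0n modnDr modn_small // ltnS ltnW.
Qed.

(* Multiplication by [z] on [(A[z] / (z^d - F))^p]; column [l] is the coefficient of [z^l]. *)
Definition zP (v : V) : V :=
  \matrix_(a, l) ((if l == 0%N :> nat then F else 1) * v a (ord_pred l)).

Lemma col_zP0 v : col ord0 (zP v) = F *: col ord_max v.
Proof. by apply/matrixP => a b; rewrite !mxE /= ord_pred0. Qed.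
Lemma col_zPS v l : col (lift ord0 l) (zP v) = col (widen_ord (leqnSn e) l) v.
Proof. by apply/matrixP => a b; rewrite !mxE /= mul1r ord_predS. Qed.

Lemma zPD u v : zP (u + v) = zP u + zP v.
Proof. by apply/matrixP => a l; rewrite !mxE mulrDr. Qed.
Lemma zPZ b v : zP (b *: v) = b *: zP v.
Proof. by apply/matrixP => a l; rewrite !mxE mulrCA. Qed.

(** In [d] steps every column passes position 0 exactly once and picks up one factor [F]. *)
Lemma iter_zP v : iter d zP v = F *: v.
Proof.
have H j : (j <= d)%N -> forall a l, iter j zP v a l =
    (if (l < j)%N then F else 1) * v a (iter j (@ord_pred d) l).
  elim: j => [|j ih] h a l; first by rewrite mul1r.
  rewrite iterS mxE ih ?(ltnW h) // iterSr mulrA; congr (_ * _).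
  case: (unliftP ord0 l) => [l' ->|->].
    by rewrite ord_predS /= mul1r /bump.
  by rewrite ord_pred0 /= ltnNge -ltnS h mulr1.
apply/matrixP => a l; rewrite H // ltn_ord mxE; congr (_ * v a _).
have H2 t (m : 'I_d) : iter t (@ord_pred d) (iter t (@ordS d) m) = m.
  by elim: t m => // t ih m; rewrite iterSr iterS ordSK ih.
by rewrite -{1}(iter_ordS_d l) H2.
Qed.

(* The quotient map [z^l w |-> phi_j ... phi_(j+l-1) w] onto the factorization [phi]. *)
Definition pimap (phi : 'I_d -> 'M[R]_p) j (v : V) : 'cV[R]_p :=
  \sum_(l < d) dpath phi j l *m col l v.

Lemma pimap_recl phi j v : pimap phi j v =
  col ord0 v + \sum_(l < e) dpath phi j l.+1 *m col (lift ord0 l) v.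
Proof. by rewrite /pimap big_ord_recl mul1mx. Qed.

(** For [F = G] the map [pimap] turns [z] into [phi]. For [F = G + x^2] the defect is [x^2] times
    the last column, still divisible by [x]; this is what keeps the submodule behind [ofC] stable
    under [z]. *)
Lemma pimap_zP phi G j v : (forall i, dpath phi i d = G%:M) ->
  pimap phi j (zP v) = phi j *m pimap phi (ordS j) v + (F - G) *: col ord_max v.
Proof.
move=> h; rewrite /pimap big_ord_recl mul1mx col_zP0 [in RHS]big_ord_recr mulmxDr /=.
under eq_bigr => l _ do rewrite col_zPS /bump /= -mulmxA.
rewrite -mulmx_sumr [phi j *m (_ *m _)]mulmxA -[phi j *m dpath _ _ _]/(dpath phi j d) h.
by rewrite mul_scalar_mx -addrA -scalerDl addrC [G + _]addrC subrK.
Qed.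

Lemma pimapD phi j u v : pimap phi j (u + v) = pimap phi j u + pimap phi j v.
Proof. by rewrite -big_split; apply: eq_bigr => l _; rewrite linearD mulmxDr. Qed.
Lemma pimapZ phi j b v : pimap phi j (b *: v) = b *: pimap phi j v.
Proof. by rewrite scaler_sumr; apply: eq_bigr => l _; rewrite linearZ /= -scalemxAr. Qed.

Definition mk (w : 'cV[R]_p) (v : V) : V := \matrix_(a, l) if l == 0%N :> nat then w a 0 else v a l.

Lemma col_mk0 w v : col ord0 (mk w v) = w.
Proof. by apply/matrixP => a b; rewrite !mxE /= ord1. Qed.
Lemma col_mkS w v l : col (lift ord0 l) (mk w v) = col (lift ord0 l) v.
Proof. by apply/matrixP => a b; rewrite !mxE. Qed.
Lemma col_ext0S (u v : V) : col ord0 u = col ord0 v ->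
  (forall l : 'I_e, col (lift ord0 l) u = col (lift ord0 l) v) -> u = v.
Proof. by move=> h0 hS; apply: mx_col_ext => l; case: (unliftP ord0 l) => [l' ->|->]. Qed.

End Companion.

Lemma flin_of_inj (R : comNzRingType) (U V W : fmod R) (h : car V -> car W) (g : car U -> car V) :
  injective h -> flin h -> flin (h \o g) -> flin g.
Proof.
move=> hi [hD hZ] [gD gZ]; split=> [u v|a v]; apply: hi; first by rewrite hD; exact: gD.
by rewrite hZ; exact: gZ.
Qed.

Section Knorrer.
Variables (k : fieldType) (n e : nat).
Notation d := e.+1.
Notation S := (series k n).
Notation A := (series k n.+1).
Notation x := (@xl k n).

Definition sext (f : S) : A := siota f + x ^+ 2.

Lemma slice0_sext f : slice 0 (sext f) = f.
Proof. by rewrite raddfD /= slice0_iota slice_xlX addr0. Qed.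

Lemma x_neq0 : x != 0.
Proof. by apply/eqP => /(congr1 (slice 1)); rewrite slice_xl raddf0 => /eqP; rewrite oner_eq0. Qed.

Lemma xscale_inj p q : injective (fun v : 'M[A]_(p, q) => x *: v).
Proof.
move=> u v /matrixP h; apply/matrixP => i j; have := h i j; rewrite !mxE.
exact: xlM_inj.
Qed.

Section KObj.
Variables (p : nat) (N : 'I_d -> 'M[S]_p) (f : S).
Hypothesis Nf : forall i, dpath N i d = f%:M.
Notation V := 'M[A]_(p, d).
Notation VM := (fM A p d).
Notation F := (sext f).

Let Nt i := map_mx (@siota k n) (N i).
Let Ntf i : dpath Nt i d = (siota f)%:M.
Proof. by rewrite -dpath_map Nf map_scalar_mx. Qed.

(* Embeds [V] as the submodule of those [v] with [pimap v] divisible by [x]; multiplication by [z] there is [Kz]. *)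
Definition ofC j (c : V) : V :=
  mk (x *: col ord0 c - \sum_(l < e) dpath Nt j l.+1 *m col (lift ord0 l) c) c.

Lemma col_ofC0 j c : col ord0 (ofC j c) =
  x *: col ord0 c - \sum_(l < e) dpath Nt j l.+1 *m col (lift ord0 l) c.
Proof. exact: col_mk0. Qed.
Lemma col_ofCS j c l : col (lift ord0 l) (ofC j c) = col (lift ord0 l) c.
Proof. exact: col_mkS. Qed.

Lemma pimap_ofC j c : pimap Nt j (ofC j c) = x *: col ord0 c.
Proof.
rewrite pimap_recl col_ofC0; under [X in _ + X]eq_bigr do rewrite col_ofCS.
by rewrite subrK.
Qed.

Lemma ofC_mk j w v : pimap Nt j v = x *: w -> ofC j (mk w v) = v.
Proof.
move=> h; apply: col_ext0S => [|l]; last by rewrite col_ofCS col_mkS.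
rewrite col_ofC0 col_mk0 -h pimap_recl; under [X in _ - X]eq_bigr do rewrite col_mkS.
by rewrite addrK.
Qed.

Lemma ofC_inj j : injective (ofC j).
Proof.
move=> u v h; apply: col_ext0S => [|l].
  by apply: xscale_inj; rewrite -!(pimap_ofC j) h.
by have := congr1 (col (lift ord0 l)) h; rewrite !col_ofCS.
Qed.

Lemma ofCD j (u v : V) : ofC j (u + v) = ofC j u + ofC j v.
Proof.
apply: col_ext0S => [|l]; last by rewrite colD !col_ofCS colD.
rewrite [RHS]colD !col_ofC0 colD scalerDr.
under [X in _ - X]eq_bigr => l _ do rewrite colD mulmxDr.
by rewrite big_split opprD addrACA.
Qed.

Lemma ofCZ j a (v : V) : ofC j (a *: v) = a *: ofC j v.
Proof.
apply: col_ext0S => [|l]; last by rewrite colZ !col_ofCS colZ.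
rewrite [RHS]colZ !col_ofC0 colZ scalerBr !scalerA mulrC scaler_sumr; congr (_ - _).
by apply: eq_bigr => l _; rewrite colZ scalemxAr.
Qed.

Lemma flin_ofC j : @flin A VM VM (ofC j).
Proof. by split=> [u v|a v]; [exact: ofCD|exact: ofCZ]. Qed.

(** Multiplication by [z] in the coordinates of [ofC]. The new column 0 is [pimap] of the product
    divided by [x], which explains the term with a single factor [x]. *)
Definition Kz j (c : V) : V :=
  mk (Nt j *m col ord0 c + x *: col ord_max (ofC (ordS j) c)) (zP F (ofC (ordS j) c)).

Lemma ofC_Kz j c : ofC j (Kz j c) = zP F (ofC (ordS j) c).
Proof.
have eF : F - siota f = x ^+ 2 by rewrite /sext addrAC subrr add0r.
apply: ofC_mk; rewrite (pimap_zP _ _ _ Ntf) pimap_ofC eF.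
by rewrite scalerDr scalerA -expr2 -scalemxAr addrC.
Qed.

Lemma flin_zP : @flin A VM VM (zP F).
Proof. by split=> [u v|a v]; [exact: zPD|exact: zPZ]. Qed.

Lemma flin_Kz j : @flin A VM VM (Kz j).
Proof.
apply: (@flin_of_inj A VM VM VM (ofC j) (Kz j) (@ofC_inj j) (flin_ofC j)).
rewrite (_ : ofC j \o Kz j = zP F \o ofC (ordS j)).
  exact: (@flin_comp A VM VM VM _ _ flin_zP (flin_ofC _)).
by apply: funext => c; exact: ofC_Kz.
Qed.

Definition Kmx j := @mxof A VM VM (Kz j).

(** Through the injection [ofC] this is [z^d = F]. *)
Lemma Kmx_prod : \prod_(i < d) Kmx i = F%:M.
Proof.
apply: mxof_prod => // [i|i v]; first exact: flin_Kz.
have H l j c : ofC j (@fpath A d VM Kz j l c) = iter l (zP F) (ofC (iter l (@ordS d) j) c).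
  elim: l j c => [|l ih] j c; first by [].
  by rewrite iterS (iterSr l (@ordS d) j) -ih -ofC_Kz.
apply: (@ofC_inj i); rewrite H iter_ordS_d iter_zP.
exact/esym/ofCZ.
Qed.

End KObj.
End Knorrer.

Lemma fac_ext (R : comNzRingType) d (f : R) P (X Y : dmf d f) g h :
  @fac R d f P X Y g -> (forall i, g i = h i) -> fac P h.
Proof. by move=> hg e; rewrite (_ : h = g) //; apply: funext => i; rewrite e. Qed.

Lemma fac_map (R R' : comNzRingType) d (th : {rmorphism R -> R'}) (f : R) (f' : R') (e : th f = f')
    P (X Y : dmf d f) g :
  fac P g -> @fac R' d f' (fun C => exists2 C0, P C0 & C = dmap e C0) (dmap e X) (dmap e Y)
    (fun i => map_mx th (g i)).
Proof.
elim=> [|g1 g2 _ h1 _ h2|C al be PC h1 h2].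
- by apply: (fac_ext (fac0 _ _ _)) => i; rewrite map_mx0.
- by apply: (fac_ext (facD h1 h2)) => i; rewrite map_mxD.
- apply: (fac_ext (@facC R' d f' _ (dmap e X) (dmap e Y) (dmap e C) _ _ _ (dmor_map th h1) (dmor_map th h2))) => [|i]; last by rewrite map_mxM.
  by exists C.
Qed.

Section KFunctor.
Variables (k : fieldType) (n e : nat).
Notation d := e.+1.
Notation S := (series k n).
Notation A := (series k n.+1).
Notation x := (@xl k n).
Notation io := (map_mx (@siota k n)).

Definition mapcols (R : comNzRingType) p q (h : 'I_d -> 'M[R]_(q, p)) (c : 'M[R]_(p, d)) : 'M[R]_(q, d) :=
  \matrix_(a, l) (h l *m col l c) a 0.

Lemma col_mapcols (R : comNzRingType) p q (h : 'I_d -> 'M[R]_(q, p)) c l :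
  col l (mapcols h c) = h l *m col l c.
Proof. by apply/matrixP => a b; rewrite ord1 !mxE. Qed.

Lemma flin_mapcols (R : comNzRingType) p q (h : 'I_d -> 'M[R]_(q, p)) :
  @flin R (fM R p d) (fM R q d) (mapcols h).
Proof.
split=> [u v|a v]; apply: mx_col_ext => l.
  by rewrite col_mapcols !colD !col_mapcols mulmxDr.
by rewrite col_mapcols !colZ !col_mapcols scalemxAr.
Qed.

(** Column [l] at place [j] carries [z^l w] with [w] in the module of index [j + l], hence the
    shifted component of [g]. *)
Definition Kg p q (g : 'I_d -> 'M[S]_(q, p)) (j : 'I_d) :=
  mapcols (fun l : 'I_d => io (g (iter l (@ordS d) j))).

Section Mor.
Variables (f : S) (p q : nat) (N : 'I_d -> 'M[S]_p) (N' : 'I_d -> 'M[S]_q) (g : 'I_d -> 'M[S]_(q, p)).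
Hypothesis hg : dmor N N' g.
Notation F := (sext f).

Lemma Kg_ofC j c : Kg g j (ofC N j c) = ofC N' j (Kg g j c).
Proof.
apply: col_ext0S => [|l]; last by rewrite col_mapcols !col_ofCS col_mapcols.
rewrite col_mapcols !col_ofC0 col_mapcols mulmxBr scalemxAr mulmx_sumr; congr (_ - _).
apply: eq_bigr => l _; rewrite col_mapcols.
have key := congr1 (map_mx (@siota k n)) (dmor_path j l.+1 hg).
rewrite !map_mxM !dpath_map in key.
etransitivity; first exact: mulmxA.
etransitivity; first exact: (congr1 (fun M => M *m _) key).
exact/esym/mulmxA.
Qed.

Lemma Kg_zP j v : Kg g j (zP F v) = zP F (Kg g (ordS j) v).
Proof.
apply: col_ext0S => [|l].
  rewrite col_mapcols !col_zP0 col_mapcols scalemxAr; congr (io (g _) *m _).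
  by rewrite -iterSr iter_ordS_d.
by rewrite col_mapcols !col_zPS col_mapcols -iterSr.
Qed.

End Mor.

Variable f : S.
Hypothesis f0 : f != 0.
Notation F := (sext f).
Notation MF := (dmf d f).

Lemma dmf_cyc (X : MF) i : dpath X i d = f%:M.
Proof. by apply: (dpath_cyc (ltn0Sn e) f0); apply: dmfP. Qed.

Definition KM (X : MF) : dmf d F := Dmf (Kmx_prod (dmf_cyc X)).

Lemma Kg_Kz (X Y : MF) g j c : dmor X Y g ->
  Kg g j (Kz X f j c) = Kz Y f j (Kg g (ordS j) c).
Proof.
move=> hg; apply: (@ofC_inj _ _ _ _ Y j).
etransitivity; first exact/esym/(Kg_ofC hg).
etransitivity; first exact: (congr1 (Kg g j) (ofC_Kz (dmf_cyc X) j c)).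
etransitivity; last exact/esym/(ofC_Kz (dmf_cyc Y)).
etransitivity; first exact: Kg_zP.
exact: (congr1 (zP F) (Kg_ofC hg _ _)).
Qed.

Definition KgM p q (g : 'I_d -> 'M[S]_(q, p)) j := @mxof A (fM A p d) (fM A q d) (Kg g j).

Lemma dmor_Kg (X Y : MF) g : dmor X Y g -> dmor (KM X) (KM Y) (KgM g).
Proof.
move=> hg; apply: dmor_mxof => [i|i|i|i v].
- exact: (flin_Kz (dmf_cyc X)).
- exact: (flin_Kz (dmf_cyc Y)).
- exact: flin_mapcols.
- exact: Kg_Kz.
Qed.

Lemma KgM0 p q j : KgM (fun=> 0 : 'M[S]_(q, p)) j = 0.
Proof.
apply: mxof_eq; last exact: flin_mapcols.
move=> v; rewrite mul0mx; have -> : Kg (fun=> 0 : 'M[S]_(q, p)) j v = 0.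
  by apply: mx_col_ext => l; rewrite col_mapcols map_mx0 mul0mx col0.
exact: (@vec0 A (fM A q d)).
Qed.

Lemma mapcolsD p q (h h' : 'I_d -> 'M[A]_(q, p)) c :
  mapcols (fun l => h l + h' l) c = mapcols h c + mapcols h' c.
Proof.
apply: mx_col_ext => l; rewrite [RHS]colD.
etransitivity; first exact: col_mapcols.
by etransitivity; first exact: mulmxDl; congr (_ + _); apply/esym/col_mapcols.
Qed.

Lemma mapcolsM p q r (h : 'I_d -> 'M[A]_(q, p)) (h' : 'I_d -> 'M[A]_(r, q)) c :
  mapcols (fun l => h' l *m h l) c = mapcols h' (mapcols h c).
Proof. by apply: mx_col_ext => l; rewrite !col_mapcols mulmxA. Qed.

Lemma KgMD p q (g h : 'I_d -> 'M[S]_(q, p)) j : KgM (fun i => g i + h i) j = KgM g j + KgM h j.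
Proof.
rewrite /KgM -(mxofD (flin_mapcols _) (flin_mapcols _)); congr mxof.
apply: funext => v; rewrite -mapcolsD; congr mapcols.
by apply: funext => l; rewrite map_mxD.
Qed.

Lemma KgMM p q r (g : 'I_d -> 'M[S]_(q, p)) (h : 'I_d -> 'M[S]_(r, q)) j :
  KgM (fun i => h i *m g i) j = KgM h j *m KgM g j.
Proof.
rewrite /KgM -(mxof_comp (flin_mapcols _) (flin_mapcols _)); congr mxof.
apply: funext => v; rewrite /= -mapcolsM; congr mapcols.
by apply: funext => l; rewrite map_mxM.
Qed.

Lemma KgM1 p j : KgM (fun=> 1%:M : 'M[S]_p) j = 1%:M.
Proof.
rewrite -mxof_id; congr mxof; apply: funext => v; apply: mx_col_ext => l.
by rewrite col_mapcols map_mx1 mul1mx.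
Qed.

Lemma fac_KM P (X Y : MF) g : fac P g ->
  @fac A d F (fun C => exists2 C0, P C0 & C = KM C0) (KM X) (KM Y) (KgM g).
Proof.
elim=> [|g1 g2 _ h1 _ h2|C al be PC h1 h2].
- by apply: (fac_ext (fac0 _ _ _)) => i; rewrite KgM0.
- by apply: (fac_ext (facD h1 h2)) => i; rewrite KgMD.
- apply: (fac_ext (@facC A d F _ (KM X) (KM Y) (KM C) _ _ _ (dmor_Kg h1) (dmor_Kg h2))) => [|i]; last by rewrite KgMM.
  by exists C.
Qed.

Lemma facid_KM P (X : MF) : facid P X ->
  @facid A d F (fun C => exists2 C0, P C0 & C = KM C0) (KM X).
Proof. by move=> h; apply: (fac_ext (fac_KM h)) => i; rewrite KgM1. Qed.

Hypothesis char0 : [pchar k] =i pred0.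

Lemma s0_mxof_eq (V W : fmod A) (g h : car V -> car W) :
  (forall v, exists u, vec (g v) = vec (h v) + x *: u) ->
  map_mx (slice 0 : {rmorphism A -> S}) (mxof g) = map_mx (slice 0 : {rmorphism A -> S}) (mxof h).
Proof.
move=> H; apply/matrixP => i j; rewrite !mxE; have [u ->] := H (unvec (delta_mx j 0)).
by rewrite !mxE rmorphD rmorphM /= slice_xl mul0r addr0.
Qed.

Lemma fac_sub (P Q : MF -> Prop) (X Y : MF) g : fac P g -> (forall C, P C -> Q C) -> @fac S d f Q X Y g.
Proof. by move=> h PQ; apply: (fac_trans h) => C /PQ; apply: facid_self. Qed.

Section SplitOff.
Variable X : MF.
Let Nt i := io (X i).
Let VM := fM A (rk X) d.
Let W := fcV A (rk X).
Let inc (w : 'cV[A]_(rk X)) : 'M[A]_(rk X, d) := mk w 0.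
Let pr (c : 'M[A]_(rk X, d)) : 'cV[A]_(rk X) := col ord0 c.

Lemma incD u v : inc (u + v) = inc u + inc v.
Proof. by apply: col_ext0S => [|l]; rewrite colD ?col_mk0 // !col_mkS col0 addr0. Qed.
Lemma incZ a v : inc (a *: v) = a *: inc v.
Proof. by apply: col_ext0S => [|l]; rewrite colZ ?col_mk0 // !col_mkS col0 scaler0. Qed.

Lemma flin_inc : @flin A W VM inc.
Proof. by split; [exact: incD|exact: incZ]. Qed.

Lemma flin_pr : @flin A VM W pr.
Proof. by split=> [u v|a v]; [exact: colD|exact: colZ]. Qed.

Lemma ofC_inc j w : ofC X j (inc w) = x *: inc w.
Proof.
apply: col_ext0S => [|l]; rewrite colZ.
  rewrite col_ofC0 !col_mk0 big1 ?subr0 // => l _; by rewrite col_mkS col0 mulmx0.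
by rewrite col_ofCS col_mkS col0 scaler0.
Qed.

(** [ofC] sends [inc w] to [x * inc w], so modulo [x] only the map of [X] itself survives: [X] sits
    inside the reduction of [KM X]. *)
Lemma Kz_inc j w : exists u, Kz X f j (inc w) = inc (Nt j *m w) + x *: u.
Proof.
exists (mk (x *: col ord_max (inc w)) (zP F (inc w))).
rewrite /Kz ofC_inc zPZ; apply: col_ext0S => [|l].
  by rewrite colD 2!colZ 4!col_mk0.
by rewrite colD 2!colZ 3!col_mkS colZ col0 add0r.
Qed.

Lemma Kz_pr j c : exists u, pr (Kz X f j c) = Nt j *m pr c + x *: u.
Proof. by exists (col ord_max (ofC X (ordS j) c)); rewrite /pr /Kz col_mk0. Qed.

Notation s0m := (map_mx (slice 0 : {rmorphism A -> S})).

Lemma s0_io p q (M : 'M[S]_(p, q)) : s0m (io M) = M.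
Proof. by apply/matrixP => i j; rewrite !mxE; apply: slice0_iota. Qed.

Lemma dmor_inc : dmor X (fun i => s0m (Kmx X f i)) (fun=> s0m (@mxof A W VM inc)).
Proof.
move=> i; rewrite -[X i in LHS]s0_io -!map_mxM -(mxof_mul (io (X i))) /Kmx.
rewrite -(mxof_comp flin_inc (flin_mul _)) -(mxof_comp (flin_Kz (dmf_cyc X) i) flin_inc).
symmetry; apply: (@s0_mxof_eq W VM) => v /=; have [u hu] := Kz_inc i v; exists (mxcol u).
by rewrite -mxcolZ -mxcolD -hu.
Qed.

Lemma dmor_pr : dmor (fun i => s0m (Kmx X f i)) X (fun=> s0m (@mxof A VM W pr)).
Proof.
move=> i; rewrite -[X i in RHS]s0_io -!map_mxM -(mxof_mul (io (X i))) /Kmx.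
rewrite -(mxof_comp flin_pr (flin_Kz (dmf_cyc X) i)) -(mxof_comp (flin_mul _) flin_pr).
apply: (@s0_mxof_eq VM W) => v /=; have [u hu] := Kz_pr i v; by exists u.
Qed.

Lemma pr_inc : s0m (@mxof A VM W pr) *m s0m (@mxof A W VM inc) = 1%:M.
Proof.
rewrite -map_mxM -(mxof_comp flin_pr flin_inc) -(map_mx1 (slice 0 : {rmorphism A -> S})).
congr (s0m _); rewrite -(mxof_id W); congr mxof; apply: funext => w; exact: col_mk0.
Qed.

End SplitOff.

(** Every [X] is a retract of [KM X] at [x = 0], through [inc] and [pr]; reducing a finite list for
    [F] therefore gives one for [f]. *)
Lemma step_down : fint d F -> fint d f.
Proof.
move=> /(fint_facid char0 (ltn0Sn e)) [l hl].
have e0 : slice 0 F = f by apply: slice0_sext.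
apply: (@fint_criterion k n d char0 f (ltn0Sn e) (List.map (dmap e0) l) f0) => X _.
have hX := fac_comp (fac_map e0 (hl (KM X))) (@dmor_inc X) (@dmor_pr X).
apply: (fac_ext (fac_sub hX _)) => [C [C0 h ->]|i]; first by apply/List.in_map_iff; exists C0.
by rewrite map_mx1 mulmx1 pr_inc.
Qed.

End KFunctor.

(** * Derivative in the last variable *)

Section Derivative.
Variables (k : fieldType) (n : nat).
Notation A := (series k n.+1).

Definition sder (h : A) : A := unslice (fun j => slice j.+1 h *+ j.+1).

Lemma slice_sder j h : slice j (sder h) = slice j.+1 h *+ j.+1.
Proof. exact: unsliceK. Qed.

Fact sder_zmod : zmod_morphism sder.
Proof. by move=> g h; apply: slice_ext => j; rewrite raddfB /= !slice_sder raddfB mulrnBl. Qed.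
HB.instance Definition _ := GRing.isZmodMorphism.Build A A sder sder_zmod.

Lemma sderM g h : sder (g * h) = sder g * h + g * sder h.
Proof.
apply: slice_ext => j; rewrite raddfD /= !sliceM slice_sder sliceM.
have e1 : \sum_(i < j.+2) slice i g * slice (j.+1 - i) h *+ i =
    \sum_(i < j.+1) slice i (sder g) * slice (j - i) h.
  rewrite big_ord_recl mulr0n add0r; apply: eq_bigr => i _.
  by rewrite slice_sder mulrnAl /bump /= ?add1n subSS.
have e2 : \sum_(i < j.+2) slice i g * slice (j.+1 - i) h *+ (j.+1 - i) =
    \sum_(i < j.+1) slice i g * slice (j - i) (sder h).
  rewrite big_ord_recr /= subnn mulr0n addr0; apply: eq_bigr => i _.
  by rewrite slice_sder mulrnAr subSn // -ltnS.
rewrite -e1 -e2 -big_split -sumrMnl; apply: eq_bigr => i _ /=.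
by rewrite -mulrnDr subnKC // -ltnS.
Qed.

Lemma sder_sext (f : series k n) : sder (sext f) = @xl k n *+ 2.
Proof.
apply: slice_ext => j; rewrite slice_sder raddfD raddfMn /= slice_iota slice_xlX slice_xl add0r eqSS.
by case: j => [|[|j]] //=; rewrite ?mul0rn.
Qed.

Notation Dm := (map_mx sder).

Lemma Dm_mul p q r (M : 'M[A]_(p, q)) (M' : 'M[A]_(q, r)) :
  Dm (M *m M') = Dm M *m M' + M *m Dm M'.
Proof.
apply/matrixP => i j; rewrite !mxE raddf_sum -big_split; apply: eq_bigr => l _.
by rewrite !mxE; apply: sderM.
Qed.

Lemma sder1 : sder 1 = 0.
Proof. by have := sderM 1 1; rewrite !mulr1 mul1r => /eqP; rewrite -subr_eq0 opprD addrA subrr add0r oppr_eq0 => /eqP. Qed.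

Lemma Dm_path d p (phi : 'I_d -> 'M[A]_p) i l : Dm (dpath phi i l) =
  \sum_(a < l) dpath phi i a *m Dm (phi (iter a (@ordS d) i))
     *m dpath phi (iter a.+1 (@ordS d) i) (l - a.+1).
Proof.
elim: l i => [|l ih] i.
  by rewrite big_ord0; apply/matrixP => a b; rewrite !mxE raddfMn /= sder1 mul0rn.
rewrite [dpath _ _ _]/= Dm_mul ih big_ord_recl mul1mx mulmx_sumr; congr (_ + _).
  by rewrite /= subn1.
apply: eq_bigr => a _; rewrite /bump ?add1n -!iterSr [dpath phi i a.+1]/= -!mulmxA.
by rewrite subSS.
Qed.

End Derivative.

Section StepUp.
Variables (k : fieldType) (n e : nat).
Notation d := e.+1.
Notation S := (series k n).
Notation A := (series k n.+1).
Notation x := (@xl k n).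
Notation io := (map_mx (@siota k n)).
Notation s0m := (map_mx (slice 0 : {rmorphism A -> S})).
Notation Dm := (map_mx (@sder k n)).
Hypothesis char0 : [pchar k] =i pred0.
Variable f : S.
Hypothesis f0 : f != 0.
Notation F := (sext f).

Lemma sext_neq0 : F != 0.
Proof. by apply: contra_neq f0 => h; rewrite -(slice0_sext f) h raddf0. Qed.

Let half : A := (2%:R)^-1.
Lemma half2 : half * 2%:R = 1.
Proof.
rewrite mulVr // s_unitE rmorph_nat; have /pcharf0P -> := char0; by [].
Qed.

Variable X : dmf d F.
Let e0 : slice 0 F = f := slice0_sext f.
Let Xb : dmf d f := dmap e0 X.
Let Nt i := io (Xb i).
Notation p := (rk X).
Notation V := 'M[A]_(p, d).
Let VM := fM A p d.
Let W := fcV A p.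

Let XF i : dpath X i d = F%:M.
Proof. by apply: (dpath_cyc (ltn0Sn e) sext_neq0); apply: dmfP. Qed.

Lemma s0_pimap j (v : V) : s0m (pimap X j v) = s0m (pimap Nt j v).
Proof.
etransitivity; first exact: raddf_sum.
etransitivity; last exact/esym/raddf_sum.
apply: eq_bigr => l _.
etransitivity; first exact: map_mxM.
etransitivity; last exact/esym/map_mxM.
congr (_ *m _); etransitivity; first exact: dpath_map.
etransitivity; last exact/esym/dpath_map.
 congr dpath; apply: funext => i.
by rewrite /Nt s0_io.
Qed.

Lemma sshift_mx q r (M : 'M[A]_(q, r)) : s0m M = 0 -> x *: map_mx (@sshift k n) M = M.
Proof.
move=> h; apply/matrixP => i j; rewrite !mxE [RHS]slice0_xl //.
by have /matrixP/(_ i j) := h; rewrite !mxE.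
Qed.

Lemma s0_xscale q r (M : 'M[A]_(q, r)) : s0m (x *: M) = 0.
Proof. by apply/matrixP => i j; rewrite !mxE rmorphM /= slice_xl mul0r. Qed.

(** [X] and its restriction agree modulo [x], so [pimap X] is divisible by [x] on the image of
    [ofC]; [rho] is the quotient. *)
Definition rho j (c : V) : 'cV[A]_p := map_mx (@sshift k n) (pimap X j (ofC Xb j c)).

Lemma rhoE j c : x *: rho j c = pimap X j (ofC Xb j c).
Proof. by apply: sshift_mx; rewrite s0_pimap (@pimap_ofC k n e p Xb) s0_xscale. Qed.

Lemma rhoD j u v : rho j (u + v) = rho j u + rho j v.
Proof.
apply: xscale_inj; etransitivity; first exact: rhoE.
etransitivity; last exact/esym/scalerDr.
rewrite ofCD pimapD; congr (_ + _); apply/esym/rhoE.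
Qed.

Lemma rhoZ j a v : rho j (a *: v) = a *: rho j v.
Proof.
apply: xscale_inj; etransitivity; first exact: rhoE.
rewrite ofCZ pimapZ -rhoE; etransitivity; first exact: scalerA.
by rewrite mulrC; apply/esym/scalerA.
Qed.

Lemma flin_rho j : @flin A VM W (rho j).
Proof. by split; [exact: rhoD|exact: rhoZ]. Qed.

Lemma rho_Kz j c : rho j (Kz Xb f j c) = X j *m rho (ordS j) c.
Proof.
apply: xscale_inj; rewrite rhoE (ofC_Kz (dmf_cyc f0 Xb)) (pimap_zP _ _ _ XF) subrr scale0r addr0.
by rewrite -rhoE scalemxAr.
Qed.

(* The section of [pimap] up to the factor [x]: [w |-> 1/2 sum_l z^l (dz/dx) z^(d-1-l) w], where [d(z^d)/dx = 2x]. *)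
Definition vP j (w : 'cV[A]_p) : V := \matrix_(a, l)
  (half *: (Dm (X (iter l (@ordS d) j)) *m dpath X (iter l.+1 (@ordS d) j) (e - l) *m w)) a 0.

Lemma col_vP j w l : col l (vP j w) =
  half *: (Dm (X (iter l (@ordS d) j)) *m dpath X (iter l.+1 (@ordS d) j) (e - l) *m w).
Proof. by apply/matrixP => a b; rewrite ord1 mxE [LHS]mxE. Qed.

(** The sum over [l] is the Leibniz expansion of the derivative of the full rotation [F], which is
    [2x]. *)
Lemma pimap_vP j w : pimap X j (vP j w) = x *: w.
Proof.
rewrite /pimap; under eq_bigr => l _.
  rewrite col_vP -scalemxAr mulmxA mulmxA; over.
rewrite -scaler_sumr -mulmx_suml.
have := Dm_path X j d; rewrite XF.
under [X in _ = X -> _]eq_bigr => l _ do rewrite subSS.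
move=> <-; rewrite (_ : Dm F%:M = (x *+ 2)%:M).
  by rewrite mul_scalar_mx scalerA -[x *+ 2]mulr_natl mulrA half2 mul1r.
by rewrite -(sder_sext f); apply/matrixP => a b; rewrite !mxE raddfMn.
Qed.

(** Multiplication by [z] shifts the columns; in column 0 the composite closes up to a full
    rotation, which gives the factor [F]. *)
Lemma vP_mor j w : vP j (X j *m w) = zP F (vP (ordS j) w).
Proof.
apply: col_ext0S => [|l].
  rewrite col_vP col_zP0 col_vP subn0 subnn /= mulmx1 -iterSr iter_ordS_d !scalerA mulrC -scalerA.
  congr (_ *: _); rewrite mulmxA -[Dm _ *m _ *m X j]mulmxA.
  have -> : dpath X (ordS j) e *m X j = F%:M.
    by rewrite -(XF (ordS j)) dpathS -iterSr iter_ordS_d.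
  by rewrite mul_mx_scalar -scalemxAl.
rewrite col_vP col_zPS col_vP -iterSr lift0; congr (_ *: _).
rewrite mulmxA -!mulmxA -[iter l.+1 _ (ordS j)]iterSr; congr (_ *m _); rewrite !mulmxA; congr (_ *m _).
have -> : (e - widen_ord (leqnSn e) l = (e - l.+1).+1)%N by have := ltn_ord l => /=; lia.
rewrite dpathS; congr (_ *m X _); rewrite -iterD.
by have -> : (e - l.+1 + l.+2 = d)%N; [have := ltn_ord l; lia|rewrite iter_ordS_d].
Qed.

Lemma vPD j u w : vP j (u + w) = vP j u + vP j w.
Proof.
apply: mx_col_ext => l; etransitivity; last exact/esym/colD.
etransitivity; last exact: (esym (f_equal2 (fun a b => a + b) (col_vP j u l) (col_vP j w l))).
etransitivity; first exact: col_vP.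
etransitivity; first exact: (congr1 (fun M => half *: M) (mulmxDr _ _ _)).
exact: scalerDr.
Qed.
Lemma vPZ j a w : vP j (a *: w) = a *: vP j w.
Proof.
apply: mx_col_ext => l; etransitivity; last exact/esym/colZ.
etransitivity; last exact: (esym (congr1 (fun M => a *: M) (col_vP j w l))).
etransitivity; first exact: col_vP.
etransitivity; first exact: (congr1 (fun M => half *: M) (esym (scalemxAr _ _ _))).
etransitivity; first exact: scalerA.
etransitivity; last exact/esym/scalerA.
by rewrite mulrC.
Qed.

(** The coordinates of [vP j w]: by [pimap_vP] it lies in the submodule described by [ofC], see
    [ofC_sig]. *)
Definition sig j (w : 'cV[A]_p) : V := mk (map_mx (@sshift k n) (pimap Nt j (vP j w))) (vP j w).

Lemma ofC_sig j w : ofC Xb j (sig j w) = vP j w.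
Proof. by apply: ofC_mk; rewrite sshift_mx // -s0_pimap pimap_vP s0_xscale. Qed.

Lemma sigD j u v : sig j (u + v) = sig j u + sig j v.
Proof.
apply: (@ofC_inj _ _ _ _ Xb j); etransitivity; first exact: ofC_sig.
rewrite vPD; etransitivity; last exact/esym/ofCD.
by congr (_ + _); apply/esym/ofC_sig.
Qed.

Lemma sigZ j a v : sig j (a *: v) = a *: sig j v.
Proof.
apply: (@ofC_inj _ _ _ _ Xb j); etransitivity; first exact: ofC_sig.
rewrite vPZ; etransitivity; last exact/esym/ofCZ.
by congr (_ *: _); apply/esym/ofC_sig.
Qed.

Lemma flin_sig j : @flin A W VM (sig j).
Proof. by split; [exact: sigD|exact: sigZ]. Qed.

Lemma sig_Kz j w : sig j (X j *m w) = Kz Xb f j (sig (ordS j) w).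
Proof.
by apply: (@ofC_inj _ _ _ _ Xb j); rewrite ofC_sig vP_mor (ofC_Kz (dmf_cyc f0 Xb)) ofC_sig.
Qed.

Lemma rho_sig j w : rho j (sig j w) = w.
Proof. by apply: xscale_inj; rewrite rhoE ofC_sig pimap_vP. Qed.

(** [rho (sig w) = w], because [pimap] maps [vP j w] to [x w] and [rho] divides by [x]. *)
Lemma KM_retract : exists al be, [/\ dmor X (KM f0 Xb) al, dmor (KM f0 Xb) X be &
  forall i, be i *m al i = 1%:M].
Proof.
have hs := @dmor_mxof A d W VM (fun i => mulmx (X i)) (fun i => Kz Xb f i) sig
  (fun i => flin_mul (X i)) (flin_Kz (dmf_cyc f0 Xb)) flin_sig sig_Kz.
have hr := @dmor_mxof A d VM W (fun i => Kz Xb f i) (fun i => mulmx (X i)) rho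
  (flin_Kz (dmf_cyc f0 Xb)) (fun i => flin_mul (X i)) flin_rho rho_Kz.
exists (fun j => @mxof A W VM (sig j)), (fun j => @mxof A VM W (rho j)); split=> i.
- by have := hs i; rewrite mxof_mul.
- by have := hr i; rewrite mxof_mul.
- rewrite -(mxof_comp (flin_rho i) (flin_sig i)).
  apply: (@mxof_eq A W W) (flin_comp (flin_rho i) (flin_sig i)) => v.
  by rewrite mul1mx /= rho_sig.
Qed.

End StepUp.

Lemma step_up (k : fieldType) n e (f : series k n) : [pchar k] =i pred0 -> f != 0 ->
  fint e.+1 f -> fint e.+1 (sext f).
Proof.
move=> char0 f0 /(fint_facid char0 (ltn0Sn e)) [l hl].
apply: (@fint_criterion k n.+1 e.+1 char0 _ (ltn0Sn e) (List.map (KM f0) l) (sext_neq0 f0)) => X _.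
have [al [be [ha hb hab]]] := KM_retract char0 f0 X.
have hX := fac_comp (facid_KM f0 (hl (dmap (slice0_sext f) X))) ha hb.
have hX' := fac_ext hX (h := fun=> 1%:M) (fun i => etrans (congr1 (fun M => M *m _) (mulmx1 _)) (hab i)).
apply: (fac_trans hX') => C [C0 h ->]; apply: facid_self.
by apply/List.in_map_iff; exists C0.
Qed.

(** * Kernels over [k[[u, v]]] *)

Section KernelFree.
Variable k : fieldType.

Lemma series1_unit_part (f : series k 1) : f != 0 ->
  exists j g, s0 g != 0 /\ f = @xl k 0 ^+ j * g.
Proof.
move=> /slice_neq0 [j [fj lo]]; exists j, (unslice (fun i => slice (i + j) f)).
split.
  rewrite -s0_slice0 unsliceK; apply: contra_neq fj => h; apply: s0_inj0.
  by rewrite h rmorph0.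
apply: slice_ext => i; rewrite slice_xlXM unsliceK; case: ltnP => h; first exact: lo.
by rewrite subnK.
Qed.

Definition submod (R : comNzRingType) b (U : 'cV[R]_b -> Prop) :=
  [/\ U 0, (forall u v, U u -> U v -> U (u + v)) & forall a v, U v -> U (a *: v)].

Definition mxbasis (R : comNzRingType) b q (U : 'cV[R]_b -> Prop) (W : 'M[R]_(b, q)) :=
  [/\ (forall t, U (W *m t)), (forall v, U v -> exists t, v = W *m t) &
      forall t : 'cV[R]_q, W *m t = 0 -> t = 0].

(** Induction on [b]: an element whose first coordinate has least valuation divides all first
    coordinates, and what remains has first coordinate 0. The submodule is any predicate, without
    finiteness assumption. *)
Lemma dvr_submod_free b (U : 'cV[series k 1]_b -> Prop) : submod U ->
  exists q (W : 'M[series k 1]_(b, q)), mxbasis U W.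
Proof.
elim: b U => [|b ih].
  move=> U [U0 UD UZ]; exists 0%N, 0; split=> [t|v _|t _]; first by rewrite mul0mx.
    by exists 0; rewrite [v]flatmx0 mulmx0.
  exact: flatmx0.
rewrite -[b.+1]/(1 + b)%N => U [U0 UD UZ].
pose U' (w : 'cV[series k 1]_b) := U (col_mx (0 : 'cV_1) w).
have [|q [W [h1 h2 h3]]] := ih U'.
  split=> [|u v|a v]; rewrite /U'; first by rewrite col_mx0.
    by move=> hu hv; rewrite -[0 : 'cV_1](addr0 0) -add_col_mx; apply: UD.
  by move=> hv; rewrite -[0 : 'cV_1](scaler0 _ a) -scale_col_mx; apply: UZ.
have [H|/existsNP [v0 /not_implyP [Uv0 v00]]] := pselect (forall v, U v -> v (lshift b 0) 0 = 0).
  exists q, (col_mx (0 : 'M_(1, q)) W); split=> [t|v Uv|t].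
  - by rewrite mul_col_mx mul0mx; apply: h1.
  - have e : v = col_mx (0 : 'cV_1) (dsubmx v).
      rewrite -[LHS]vsubmxK; congr col_mx.
      by apply/matrixP => i j; rewrite !ord1 !mxE H.
    have [|t et] := h2 (dsubmx v); first by rewrite /U' -e.
    by exists t; rewrite e et mul_col_mx mul0mx.
  - by rewrite mul_col_mx mul0mx -[X in _ = X](@col_mx0 _ 1 b) => /eq_col_mx [_ /h3].
(* [Q j]: some element of [U] has a first coordinate of valuation [j]. *)
pose Q j := exists v g, [/\ U v, s0 g != 0 & v (lshift b 0) 0 = @xl k 0 ^+ j * g].
have exQ : exists j, `[< Q j >].
  have [|j [g [g0 e]]] := @series1_unit_part (v0 (lshift b 0) 0); first exact/eqP.
  by exists j; apply/asboolP; exists v0, g.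
case: (ex_minnP exQ) => j /asboolP [v1 [g [Uv1 g0 ev1]]] jmin.
have gU : g \is a GRing.unit by rewrite s_unitE.
pose v2 : 'cV_(1 + b) := g^-1 *: v1.
have Uv2 : U v2 by apply: UZ.
have ev2 : v2 (lshift b 0) 0 = @xl k 0 ^+ j by rewrite mxE ev1 mulrCA mulVr // mulr1.
have div v : U v -> exists c, v (lshift b 0) 0 = c * @xl k 0 ^+ j.
  move=> Uv; have [->|n0] := eqVneq (v (lshift b 0) 0) 0; first by exists 0; rewrite mul0r.
  have [i [h [h0 e]]] := series1_unit_part n0.
  have ij : (j <= i)%N by apply: jmin; apply/asboolP; exists v, h.
  by exists (@xl k 0 ^+ (i - j) * h); rewrite e -{1}(subnK ij) exprD -!mulrA [h * _]mulrC.
have usub m (v : 'cV[series k 1]_(1 + m)) : usubmx v = (v (lshift m 0) 0)%:M.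
  by apply/matrixP => i l; rewrite !ord1 !mxE eqxx mulr1n.
exists (1 + q)%N, (row_mx v2 (col_mx (0 : 'M_(1, q)) W)); split=> [t|v Uv|t].
- rewrite -[t]vsubmxK mul_row_col; apply: UD.
    by rewrite usub mul_mx_scalar; apply: UZ.
  by rewrite mul_col_mx mul0mx; apply: h1.
- have [c ec] := div v Uv.
  have Uw : U (v - c *: v2) by apply: UD => //; rewrite -scaleN1r; apply/UZ/UZ.
  have e : v - c *: v2 = col_mx (0 : 'cV_1) (dsubmx (v - c *: v2)).
    rewrite -[LHS]vsubmxK; congr col_mx.
    by rewrite usub !mxE -/v2 ec -ev2 mxE subrr raddf0.
  have [|t et] := h2 (dsubmx (v - c *: v2)); first by rewrite /U' -e.
  exists (col_mx (c%:M : 'cV_1) t); rewrite mul_row_col mul_mx_scalar mul_col_mx mul0mx -et -e.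
  by rewrite addrC subrK.
- rewrite -[t]vsubmxK mul_row_col usub mul_mx_scalar mul_col_mx mul0mx => e.
  have c0 : t (lshift q 0) 0 = 0.
    have /matrixP/(_ (lshift b 0) 0) := e.
    rewrite mxE [X in X + _]mxE ev2 col_mxEu !mxE addr0 => /eqP.
    by rewrite mulf_eq0 => /orP[/eqP//|]; rewrite expf_eq0 (negPf (x_neq0 k 0)) andbF.
  move: e; rewrite c0 scale0r add0r -[X in _ = X](@col_mx0 _ 1 b) => /eq_col_mx [_ /h3 ->].
  by rewrite raddf0 col_mx0.
Qed.

Lemma mx_div_all n b (v : 'cV[series k n.+1]_b) :
  (forall N, exists u, v = @xl k n ^+ N *: u) -> v = 0.
Proof.
move=> h; apply/matrixP => i j; rewrite mxE; apply: slice_ext => N; rewrite raddf0.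
by have [u ->] := h N.+1; rewrite mxE slice_xlXM ltnSn.
Qed.

Notation D := (series k 1).
Notation T := (series k 2).
Notation x := (@xl k 1).
Notation s0m := (map_mx (slice 0 : {rmorphism T -> D})).
Notation io := (map_mx (@siota k 1)).

(** The kernel contains [u] as soon as it contains [x u], so its reduction modulo [x] is its image
    in [D^b], which is free over the one-variable ring. A lifted basis spans by successive
    approximation in [x], and is independent because a relation is divisible by every power of
    [x]. *)
Lemma kernel_free a b (M : 'M[T]_(a, b)) :
  exists q (W : 'M[T]_(b, q)), mxbasis (fun v => M *m v = 0) W.
Proof.
pose K (v : 'cV[T]_b) := M *m v = 0.
pose K0 (w : 'cV[D]_b) := exists2 v, K v & s0m v = w.
have [|q [W0 [h1 h2 h3]]] := @dvr_submod_free b K0.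
  split=> [|u v [u' hu <-] [v' hv <-]|c v [v' hv <-]].
  - by exists 0; [rewrite /K mulmx0|rewrite raddf0].
  - by exists (u' + v'); [rewrite /K mulmxDr hu hv addr0|rewrite raddfD].
  - exists (siota c *: v'); first by rewrite /K -scalemxAr hv scaler0.
    apply/matrixP => i j; rewrite !mxE; etransitivity; first exact: slice0M.
    by congr (_ * _); exact: slice0_iota.
have ex j : exists w, K w /\ s0m w = col j W0.
  by have [w hw e] := h1 (delta_mx j 0); exists w; rewrite e -colE.
have [w hw] := choice ex.
pose W : 'M[T]_(b, q) := \matrix_(i, j) w j i 0.
have colW j : col j W = w j by apply/matrixP => i l; rewrite !mxE ord1.
have MW : M *m W = 0.
  apply: mx_col_ext => j; rewrite col0 -[RHS](proj1 (hw j)) -(colW j).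
  by apply/matrixP => i l; rewrite !mxE; apply: eq_bigr => s _; rewrite !mxE.
have W0E : s0m W = W0.
  apply: mx_col_ext => j; rewrite -(proj2 (hw j)) -(colW j).
  by apply/matrixP => i l; rewrite !mxE.
have xinj u : M *m (x *: u) = 0 -> M *m u = 0.
  rewrite -scalemxAr => h; apply: (@xscale_inj k 1); rewrite h scaler0 //.
(* One digit of the [x]-adic expansion: subtracting a combination of the lifted basis leaves [x]
   times a kernel vector. Off the kernel the pair is a dummy, so that [choice] gives a total
   function. *)
have step (v : 'cV[T]_b) : exists tv : 'cV[D]_q * 'cV[T]_b, K v ->
    K tv.2 /\ v = W *m io tv.1 + x *: tv.2.
  case: (pselect (K v)) => [Kv|nK]; last by exists (0, 0).
  have [|t et] := h2 (s0m v); first by exists v.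
  have e0 : s0m (v - W *m io t) = 0.
    rewrite raddfB /= map_mxM W0E et [X in W0 *m X](_ : _ = t) ?subrr //.
    by apply/matrixP => i j; rewrite !mxE; apply: slice0_iota.
  have e1 : v - W *m io t = x *: map_mx (@sshift k 1) (v - W *m io t).
    exact/esym/sshift_mx.
  exists (t, map_mx (@sshift k 1) (v - W *m io t)) => _ /=; split.
    by apply: xinj; rewrite -e1 mulmxBr mulmxA MW mul0mx Kv subrr.
  by rewrite -e1 addrC subrK.
have [st hst] := choice step.
exists q, W; split=> [t|v Kv|t Wt].
- by rewrite mulmxA MW mul0mx.
- pose r N := iter N (fun u => (st u).2) v.
  have Kr N : K (r N) by elim: N => [//|N ih]; case: (hst (r N) ih).
  (* [tl N] gathers the digits from the [N]-th on into series in [x]; [tl 0] is the coordinate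
     vector of [v]. *)
  pose tl N : 'cV[T]_q := \matrix_(i, j) unslice (fun l => (st (r (N + l)%N)).1 i j).
  have tlE N : tl N = io (st (r N)).1 + x *: tl N.+1.
    apply/matrixP => i j; rewrite !mxE; apply: slice_ext => l.
    rewrite raddfD /= slice_iota slice_xlM unsliceK; case: l => [|l]; first by rewrite /= addn0 addr0.
    by rewrite -addSnnS -[X in _ = X + _]/0 add0r unsliceK.
  have H N : v - W *m tl 0%N = x ^+ N *: (r N - W *m tl N).
    elim: N => [|N ih]; first by rewrite scale1r.
    have [_ e] := hst (r N) (Kr N).
    rewrite ih exprSr -scalerA; congr (_ *: _).
    rewrite {1}e [in LHS](tlE N) mulmxDr opprD addrACA subrr add0r -scalemxAr scalerBr.
    by [].
  exists (tl 0%N); apply/eqP; rewrite -subr_eq0; apply/eqP/(@mx_div_all 1) => N.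
  by exists (r N - W *m tl N).
- apply: (@mx_div_all 1) => N; elim: N t Wt => [|N ih] t Wt; first by exists t; rewrite scale1r.
  have e0 : s0m t = 0.
    by apply: h3; rewrite -W0E -map_mxM Wt raddf0.
  have e1 : t = x *: map_mx (@sshift k 1) t.
    exact/esym/sshift_mx.
  have [|u hu] := ih (map_mx (@sshift k 1) t).
    by apply: (@xscale_inj k 1); rewrite scalemxAr -e1 Wt scaler0.
  by exists u; rewrite e1 {1}hu scalerA -exprS.
Qed.

End KernelFree.

(** * Finite freeness of [k[[u, v]]] *)

Section MonDiv.
Variables (k : comNzRingType) (n : nat).
Notation A := (series k n).

Definition mquo (a : mon n) (t : A) : A := fun m => t (madd a m).
Definition mrem (a : mon n) (t : A) : A := fun m => if mle a m then 0 else t m.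

Lemma mquo_rem a t : t = smon k a * mquo a t + mrem a t.
Proof.
apply: series_ext => m; rewrite sED smonM /mquo /mrem; case: ifP => am; last by rewrite add0r.
by rewrite msubK // addr0.
Qed.

Lemma smonX (a : mon n) e : smon k a ^+ e = smon k [ffun i => (e * a i)%N].
Proof.
elim: e => [|e ih].
  by rewrite expr0 -smon0; congr (smon k _); apply/ffunP => i; rewrite !ffunE.
rewrite exprS ih -smonD; congr (smon k _); apply/ffunP => i.
by rewrite !ffunE mulSn.
Qed.

Lemma svarX (i : 'I_n) e : svar k i ^+ e = smon k [ffun j => (e * (j == i))%N].
Proof. by rewrite svarE smonX; congr (smon k _); apply/ffunP => j; rewrite !ffunE. Qed.

End MonDiv.

Section FreeT.
Variables (k : fieldType).
Notation T := (series k 2).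
Notation u := (svar k ord0 : T).
Notation v := (svar k ord_max : T).
Variables (X Y : T) (E : nat).

Definition inI (t : T) := exists a b, t = X * a + Y * b.

Lemma inI0 : inI 0. Proof. by exists 0, 0; rewrite !mulr0 addr0. Qed.
Lemma inID s t : inI s -> inI t -> inI (s + t).
Proof. by move=> [a [b ->]] [c [d ->]]; exists (a + c), (b + d); ring. Qed.
Lemma inIM s t : inI t -> inI (s * t).
Proof. by move=> [a [b ->]]; exists (s * a), (s * b); ring. Qed.
Lemma inIX t : inI (X * t). Proof. by exists t, 0; ring. Qed.
Lemma inIY t : inI (Y * t). Proof. by exists 0, t; ring. Qed.
Lemma inI_sum I (r : seq I) (P : pred I) F : (forall i, P i -> inI (F i)) -> inI (\sum_(i <- r | P i) F i).
Proof. by move=> h; apply: (big_ind inI) => //; [exact: inI0|exact: inID]. Qed.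
Lemma inIN t : inI t -> inI (- t).
Proof. by rewrite -mulN1r; apply: inIM. Qed.

Hypotheses (X1 : ordge 1 X) (Y1 : ordge 1 Y) (X0 : X != 0).
Hypotheses (uI : inI (u ^+ E)) (vI : inI (v ^+ E)).

Let au : mon 2 := [ffun j => (E * (j == ord0))%N].
Let av : mon 2 := [ffun j => (E * (j == ord_max))%N].

(** A monomial of degree at least [2E] in two variables is divisible by [u^E] or by [v^E]. *)
Lemma ordge_inI t : ordge (E + E) t -> inI t.
Proof.
move=> ht; rewrite (mquo_rem au t) (mquo_rem av (mrem au t)) -!svarX.
have -> : mrem av (mrem au t) = 0.
  apply: series_ext => m; rewrite /mrem; case: ifP => // h1; case: ifP => // h2.
  apply: ht; move: h1 h2; rewrite /mdeg big_ord_recl big_ord1.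
  move=> /negP h1 /negP h2; rewrite ltnNge; apply/negP => h3; case: (leqP E (m ord0)) => h4.
    apply: h2; apply/mleP => i; rewrite ffunE; case: eqP => [->|_]; rewrite ?muln1 ?muln0 //.
  apply: h1; apply/mleP => i; rewrite ffunE; case: eqP => [->|_]; rewrite ?muln1 ?muln0 //.
  have -> : ord_max = lift ord0 ord0 :> 'I_2 by apply: val_inj.
  by lia.
rewrite addr0; apply: inID; first by rewrite mulrC; apply: inIM.
by rewrite mulrC; apply: inIM.
Qed.

(** [X, Y] is a regular sequence: since [u^E] and [v^E] lie in [(X, Y)], both [u^E t] and [v^E t]
    are multiples [X r] and [X r']; then [v^E r = u^E r'], so [u^E] divides [r] and cancels. *)
Lemma regular t s : Y * t = X * s -> exists q, t = X * q.
Proof.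
move=> h; have [a [b eu]] := uI; have [c [d ev]] := vI.
have e1 : u ^+ E * t = X * (a * t + b * s).
  by rewrite eu mulrDl -!mulrA mulrDr; congr (_ + _); rewrite mulrCA h; ring.
have e2 : v ^+ E * t = X * (c * t + d * s).
  by rewrite ev mulrDl -!mulrA mulrDr; congr (_ + _); rewrite mulrCA h; ring.
set r := a * t + b * s in e1; set r' := c * t + d * s in e2.
have e3 : v ^+ E * r = u ^+ E * r'.
  by apply: (mulfI X0); rewrite mulrCA -e1 [RHS]mulrCA -e2 mulrCA.
have rz : mrem au r = 0.
  apply: series_ext => m; rewrite /mrem; case: ifP => // h1.
  have := congr1 (fun f : T => f (madd av m)) e3; rewrite !svarX -/au -/av !smonM mle_madd maddK => ->.
  case: ifP => // h2; case/negP: h1; apply/mleP => i; have /mleP/(_ i) := h2.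
  rewrite !ffunE; case: eqP => [->|_]; rewrite ?muln0 ?muln1 //=.
have er : r = u ^+ E * mquo au r by rewrite {1}(mquo_rem au r) rz addr0 svarX.
have u0 : u ^+ E != 0.
  apply: expf_neq0; apply/eqP => /(congr1 (fun f : T => f (mone ord0))).
  by rewrite svarE /smon eqxx => /eqP; rewrite oner_eq0.
by exists (mquo au r); apply: (mulfI u0); rewrite e1 {1}er mulrCA.
Qed.

Definition spanI N (b : 'I_N -> T) := forall t, exists c : 'I_N -> k, inI (t - \sum_j sC (c j) * b j).

Lemma span_ex : exists N (b : 'I_N -> T), spanI b.
Proof.
pose s := mons_upto 2 (E + E); exists (size s), (fun j => smon k (tnth (in_tuple s) j)) => t.
exists (fun j => t (tnth (in_tuple s) j)).
have := @series_trunc k 2 (E + E) t; rewrite -/s (big_tnth _ _ s) => h.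
by apply: ordge_inI; apply: ordgeW h.
Qed.

(** A basis of the vector space [T / (X, Y)], as a spanning family of least size. *)
Lemma basis_ex : exists N (b : 'I_N -> T), spanI b /\
  forall c : 'I_N -> k, inI (\sum_j sC (c j) * b j) -> forall j, c j = 0.
Proof.
have ex : exists N, `[< exists b : 'I_N -> T, spanI b >].
  by have [N [b h]] := span_ex; exists N; apply/asboolP; exists b.
case: (ex_minnP ex) => N /asboolP [b hb] Nmin; exists N, b; split=> // c hc j; apply: contrapT => /eqP cj.
case: N b hb Nmin c hc j cj => [|N] b hb Nmin c hc j cj; first by case: j cj.
have := Nmin N; rewrite ltnn => H; apply: notF; apply: H; apply/asboolP.
exists (fun i => b (lift j i)) => t; have [g hg] := hb t.
(* The relation [c] eliminates [b j], contradicting minimality. *)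
exists (fun i => g (lift j i) - g j / c j * c (lift j i)).
have := inID hg (inIM (sC (g j / c j)) hc); congr inI.
rewrite (bigD1_ord j) //= [X in _ + _ * X](bigD1_ord j) //=.
have -> : sC (g j) = sC (g j / c j) * sC (c j) :> T by rewrite -rmorphM /= divfK.
have -> : \sum_(i < N) sC (g (lift j i) - g j / c j * c (lift j i)) * b (lift j i) =
   \sum_(i < N) sC (g (lift j i)) * b (lift j i) - sC (g j / c j) * \sum_(i < N) sC (c (lift j i)) * b (lift j i).
  rewrite mulr_sumr -sumrB; apply: eq_bigr => i _.
  by rewrite rmorphB rmorphM /= mulrBl mulrA.
ring.
Qed.

Notation S0 := (series k 2).
Notation x := (@xl k 1 : S0).
Notation y := (svar k ord0 : S0).
Let phi (i : 'I_2) : T := if i == ord0 then Y else X.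
Lemma phi1 i : ordge 1 (phi i). Proof. by rewrite /phi; case: eqP. Qed.
Definition Th : S0 -> T := gsubst phi.
Lemma Th_chom : chom Th. Proof. exact: (gsubst_chom phi1). Qed.
Lemma Thx : Th x = X. Proof. exact: (gsubst_var phi1). Qed.
Lemma Thy : Th y = Y. Proof. exact: (gsubst_var phi1). Qed.

Section Basis.
Variables (N : nat) (b : 'I_N -> T).
Hypothesis b_span : spanI b.
Hypothesis b_free : forall c : 'I_N -> k, inI (\sum_j sC (c j) * b j) -> forall j, c j = 0.

Definition comb (g : 'I_N -> S0) : T := \sum_j Th (g j) * b j.

Lemma combD g h : comb (fun j => g j + h j) = comb g + comb h.
Proof. by rewrite -big_split; apply: eq_bigr => j _; rewrite (chomD Th_chom) mulrDl. Qed.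
Lemma combM s g : comb (fun j => s * g j) = Th s * comb g.
Proof. by rewrite mulr_sumr; apply: eq_bigr => j _; rewrite (chomM Th_chom) mulrA. Qed.
Lemma comb_ord M g : (forall j, ordge M (g j)) -> ordge M (comb g).
Proof. by move=> h; apply: ordge_sum => j _; apply/ordgeMr/(chom_ord Th_chom). Qed.
Lemma combB g h : comb (fun j => g j - h j) = comb g - comb h.
Proof. by rewrite -sumrB; apply: eq_bigr => j _; rewrite (chomB Th_chom) mulrBl. Qed.

(** Write [t] as a constant combination of the basis plus [X t1 + Y t2], and repeat with [t1] and
    [t2]; after [M] rounds the remainder is a form of degree [M] in [X, Y] with coefficients
    [R M i]. *)
Lemma comb_ex t : exists g, t = comb g.
Proof.
have ex s : exists cab : ('I_N -> k) * (T * T), s = \sum_j sC (cab.1 j) * b j + X * cab.2.1 + Y * cab.2.2.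
  have [c [a1 [a2 h]]] := b_span s; exists (c, (a1, a2)) => /=.
  by rewrite -addrA -h addrC subrK.
have [F hF] := choice ex.
pose c s := (F s).1; pose t1 s := (F s).2.1; pose t2 s := (F s).2.2.
(* The coefficient of [X^i Y^(M+1-i)] in the next round: a quotient by [X] raises the index, a
   quotient by [Y] keeps it. *)
pose step M (r : nat -> T) (i : nat) : T :=
  (if i is i'.+1 then t1 (r i') else 0) + (if (i <= M)%N then t2 (r i) else 0).
pose fix R M : nat -> T := if M is M'.+1 then step M' (R M') else fun i => if i == 0%N then t else 0.
pose G M j : S0 := \sum_(L < M) \sum_(i < L.+1) x ^+ i * y ^+ (L - i) * sC (c (R L i) j).
have HG M : t = comb (G M) + \sum_(i < M.+1) X ^+ i * Y ^+ (M - i) * R M i.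
  elim: M => [|M ih].
    rewrite big_ord_recl big_ord0 /comb big1 ?add0r ?mul1r ?addr0 // => j _.
    by rewrite /G big_ord0 (chom0 Th_chom) mul0r.
  have -> : comb (G M.+1) = comb (G M) + \sum_(i < M.+1) X ^+ i * Y ^+ (M - i) * \sum_j sC (c (R M i) j) * b j.
    rewrite (_ : G M.+1 = fun j => G M j + \sum_(i < M.+1) x ^+ i * y ^+ (M - i) * sC (c (R M i) j)).
      rewrite combD; congr (_ + _); rewrite /comb.
      under eq_bigr => j _.
        rewrite (chom_sum Th_chom) mulr_suml.
        under eq_bigr => i _ do rewrite !(chomM Th_chom) !(chomX Th_chom) Thx Thy (chomC Th_chom) -mulrA.
        over.
      by rewrite exchange_big; apply: eq_bigr => i _; rewrite mulr_sumr.
    by apply: funext => j; rewrite /G big_ord_recr.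
  rewrite {1}ih -addrA; congr (_ + _).
  have -> : \sum_(i < M.+2) X ^+ i * Y ^+ (M.+1 - i) * R M.+1 i =
     \sum_(i < M.+1) X ^+ i * Y ^+ (M - i) * (X * t1 (R M i) + Y * t2 (R M i)).
    under [RHS]eq_bigr do rewrite mulrDr.
    rewrite /= /step; under [LHS]eq_bigr do rewrite mulrDr.
    rewrite !big_split /=; congr (_ + _).
      rewrite big_ord_recl mulr0 add0r; apply: eq_bigr => i _.
      by rewrite lift0 subSS exprS; ring.
    rewrite big_ord_recr /= ltnn mulr0 addr0; apply: eq_bigr => i _.
    by rewrite -ltnS ltn_ord subSn -1?ltnS // exprS; ring.
  rewrite -big_split; apply: eq_bigr => i _ /=; rewrite -mulrDr addrA.
  by congr (_ * _); apply: hF.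
have lim j : exists g, forall M, ordge M (g - G M j).
  apply: series_lim => M; rewrite /G big_ord_recr /= addrAC subrr add0r.
  apply: ordge_sum => i _; apply: ordgeMr.
  apply: (@ordgeW _ _ (i + (M - i))); first by rewrite subnKC // -ltnS.
  by apply: ordgeM; apply: ordgeX1; apply: ordge_svar.
have [g hg] := choice lim; exists g; apply: ordge_eq => M.
rewrite {1}(HG M) addrAC -combB; apply: ordgeD.
  by apply: comb_ord => j; apply/ordgeBC/hg.
apply: ordge_sum => i _; apply: ordgeMr.
apply: (@ordgeW _ _ (i + (M - i))); first by rewrite subnKC // -ltnS.
by apply: ordgeM; apply: ordgeX1.
Qed.

Lemma siota_y : siota (@xl k 0) = y.
Proof. by rewrite /xl siota_var; congr svar; apply: val_inj. Qed.

(** The constant terms vanish by independence modulo [(X, Y)]; [regular] then divides the relation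
    by [Y], and the induction continues. *)
Lemma comb_y_inj (h : 'I_N -> series k 1) : (exists q, comb (fun j => siota (h j)) = X * q) ->
  forall j, h j = 0.
Proof.
move=> hX; suff H J : forall h : 'I_N -> series k 1, (exists q, comb (fun j => siota (h j)) = X * q) ->
    forall j, slice J (h j) = 0.
  by move=> j; apply: slice_ext => J; rewrite (H J h) // raddf0.
have z h' : (exists q, comb (fun j => siota (h' j)) = X * q) -> forall j, slice 0 (h' j) = 0.
  move=> [q hq] j; apply: s0_inj0; rewrite rmorph0 s0_slice0.
  apply: (b_free (c := fun j => s0 (h' j))).
  have e i : Th (siota (h' i)) = sC (s0 (h' i)) + Y * Th (siota (sshift (h' i))).
    rewrite {1}(sshiftE (h' i)) raddfD /= rmorphM /= siota_y (chomD Th_chom) (chomM Th_chom) Thy.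
    congr (_ + _); have -> : slice 0 (h' i) = sC (s0 (h' i)).
      by apply: s0_inj0; rewrite s0C s0_slice0.
    by rewrite !siota_C (chomC Th_chom).
  have -> : \sum_i sC (s0 (h' i)) * b i = X * q - Y * comb (fun i => siota (sshift (h' i))).
    rewrite -hq /comb mulr_sumr -sumrB; apply: eq_bigr => i _; rewrite e; ring.
  by apply: inID; [exact: inIX|apply/inIN/inIY].
elim: J => [|J ih] {hX}h hX j; first exact: z.
rewrite -slice_sshift; apply: (ih (fun j => sshift (h j))).
have hz := z h hX; case: hX => q hq.
apply: (@regular _ q); rewrite -hq -Thy -combM; congr comb; apply: funext => i.
by rewrite -siota_y -rmorphM {2}(slice0_xl (hz i)).
Qed.

(** At [x = 0] this is [comb_y_inj], after which the relation is divisible by [X]. *)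
Lemma comb_inj g : comb g = 0 -> forall j, g j = 0.
Proof.
move=> g0 j; apply: slice_ext => J; rewrite raddf0; elim: J g g0 j => [|J ih] g g0 j.
all: have z i : slice 0 (g i) = 0.
1,3: apply: (comb_y_inj (h := fun i => slice 0 (g i))); exists (- comb (fun i => sshift (g i))).
1,2: rewrite mulrN -Thx -combM -[LHS]addr0 -[in LHS](subrr (comb (fun j => x * sshift (g j)))) addrA -combD.
1,2: rewrite (_ : (fun j => _) = g) ?g0 ?add0r //; apply: funext => l; by rewrite -sshiftE.
- exact: z.
rewrite -slice_sshift; apply: (ih (fun j => sshift (g j))).
apply: (mulfI X0); rewrite -Thx -combM mulr0 -[RHS]g0; congr comb; apply: funext => i.
by rewrite -slice0_xl.
Qed.

End Basis.

Lemma T_free : exists N (b : 'I_N -> T), (forall t, exists g : 'I_N -> S0, t = \sum_j Th (g j) * b j) /\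
  forall g : 'I_N -> S0, \sum_j Th (g j) * b j = 0 -> forall j, g j = 0.
Proof.
have [N [b [h1 h2]]] := basis_ex; exists N, b; split; [exact: comb_ex|exact: comb_inj].
Qed.

Lemma Th_inI g : s0 g = 0 -> inI (Th g).
Proof.
move=> g0; rewrite (sshiftE g) (chomD Th_chom) (chomM Th_chom) Thx addrC.
apply: inID; first exact: inIX.
have e : slice 0 (slice 0 g) = 0 by apply: s0_inj0; rewrite !s0_slice0 g0 rmorph0.
rewrite (slice0_xl e).
rewrite rmorphM /= siota_y (chomM Th_chom) Thy; exact: inIY.
Qed.

End FreeT.

Lemma fac_bigsum (R : comNzRingType) d (f : R) P (X Y : dmf d f) q (g : 'I_q -> 'I_d -> 'M[R]_(rk Y, rk X)) :
  (forall r, @fac R d f P X Y (g r)) -> fac P (fun i => \sum_r g r i).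
Proof.
move=> h; have H (s : seq 'I_q) : fac P (fun i => \sum_(r <- s) g r i).
  elim: s => [|r s ih]; first by apply: (fac_ext (fac0 _ _ _)) => i; rewrite big_nil.
  by apply: (fac_ext (facD (h r) ih)) => i; rewrite big_cons.
exact: H.
Qed.

(** * Every factorization as a retract of copies of T *)

Section ThroughT.
Variables (k : fieldType) (e : nat).
Notation d := e.+1.
Notation T := (series k 2).
Notation S0 := (series k 2).
Hypothesis char0 : [pchar k] =i pred0.
Variables (X Y z : T) (E : nat) (f : S0).
Hypotheses (X1 : ordge 1 X) (Y1 : ordge 1 Y) (X0 : X != 0).
Hypotheses (uI : inI X Y (svar k ord0 ^+ E)) (vI : inI X Y (svar k ord_max ^+ E)).
Hypotheses (f0 : f != 0) (fz : Th X Y f = z ^+ d) (zI : ~ inI X Y (z ^+ e)).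

(** Number of steps from [i] to [j] in the cyclic order, between 0 and [e]. *)
Definition ll (i j : 'I_d) : nat := if (i <= j)%N then (j - i)%N else (j + d - i)%N.

Lemma ll_lt i j : (ll i j <= e)%N.
Proof.
rewrite /ll; case: (leqP i j) => h; have := ltn_ord j; rewrite ltnS => h2.
  exact: leq_trans (leq_subr _ _) h2.
by rewrite leq_subLR addnS -addSn leq_add2r.
Qed.
Lemma llii i : ll i i = 0%N. Proof. by rewrite /ll leqnn subnn. Qed.
Lemma ordS_val (i : 'I_d) : ordS i = (if i == e :> nat then 0 else i.+1)%N :> nat.
Proof.
rewrite /=; case: eqP => [->|h]; first by rewrite modnn.
by rewrite modn_small // ltnS ltn_neqAle -ltnS ltn_ord andbT; apply/eqP.
Qed.
Lemma ll_step i j : i != j -> ll i j = (ll (ordS i) j).+1.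
Proof.
move=> ij; have {}ij : nat_of_ord i <> j by move=> h; case/eqP: ij; apply: val_inj.
rewrite /ll ordS_val; move: (ltn_ord i) (ltn_ord j) ij.
move: (nat_of_ord i) (nat_of_ord j) => a b; clear.
by case: (a =P e) => [->|]; rewrite ?leq0n ?subn0; do 2?[case: ifP]; lia.
Qed.
Lemma ll_ordS j : ll (ordS j) j = e.
Proof.
rewrite /ll ordS_val; move: (ltn_ord j); move: (nat_of_ord j) => b; clear.
by case: (b =P e) => [->|]; rewrite ?leq0n ?subn0; do 2?[case: ifP]; lia.
Qed.
Lemma iter_ll i j : iter (ll i j) (@ordS d) i = j.
Proof.
apply: val_inj; rewrite /= iter_ordS /ll; case: leqP => h.
  by rewrite subnKC // modn_small.
by rewrite subnKC ?modnDr ?modn_small // (leq_trans (ltnW (ltn_ord i))) // leq_addl.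
Qed.
Lemma ll_ordSr i j : i != ordS j -> ll i (ordS j) = (ll i j).+1.
Proof.
move=> ij; have : nat_of_ord i <> ordS j by move=> h; case/eqP: ij; apply: val_inj.
rewrite /ll ordS_val; move: (ltn_ord i) (ltn_ord j).
move: (nat_of_ord i) (nat_of_ord j) => a b; clear.
by case: (b =P e) => [->|]; rewrite ?leq0n ?subn0; do 2?[case: ifP]; lia.
Qed.

(** A vector [w] at place [j] extends to a solution [V j w] over [T] whose [j]-th component is
    [z^e w]. Its coordinates in a basis of the solution module are the maps to [T]; the maps back
    apply the linear form [rh] to multiples of the basis solutions, and the composite is
    [rh (z^e w) = w]. *)
Lemma through_T : fint d f.
Proof.
have [th eth] := chom_rmorph (Th_chom X1 Y1).
have [N [b [bs bi]]] := T_free X1 Y1 X0 uI vI.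
have [co hco] := choice bs.
have co_uniq t g : t = \sum_j Th X Y (g j) * b j -> co t = g.
  move=> h; apply: funext => j; apply/eqP; rewrite -subr_eq0; apply/eqP.
  apply: (bi (fun j => co t j - g j)).
  transitivity (\sum_l Th X Y (co t l) * b l - \sum_l Th X Y (g l) * b l).
    by rewrite -sumrB; apply: eq_bigr => l _; rewrite -!eth rmorphB mulrBl.
  by rewrite -hco -h subrr.
pose vc t : 'cV[S0]_N := \col_j co t j.
pose uc (c : 'cV[S0]_N) : T := \sum_j th (c j 0) * b j.
have vcK : cancel vc uc.
  by move=> t; rewrite [RHS](hco t); apply: eq_bigr => j _; rewrite mxE eth.
have ucK : cancel uc vc.
  move=> c; apply/matrixP => i j; rewrite ord1 mxE (co_uniq _ (fun j => c j 0)) //.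
  by apply: eq_bigr => l _; rewrite eth.
have vcD s t : vc (s + t) = vc s + vc t.
  apply/matrixP => i j; rewrite !mxE (co_uniq _ (fun j => co s j + co t j)) //.
  rewrite {1}(hco s) {1}(hco t) -big_split; apply: eq_bigr => l _.
  by rewrite -!eth rmorphD mulrDl.
have vcZ a t : vc (th a * t) = a *: vc t.
  apply/matrixP => i j; rewrite !mxE (co_uniq _ (fun j => a * co t j)) //.
  rewrite {1}(hco t) mulr_sumr; apply: eq_bigr => l _.
  by rewrite -!eth rmorphM mulrA.
(* [T] as a module over [S0] through the substitution; multiplication by [z] on it is a
   factorization of [f]. *)
pose FT := @Fmod S0 T (fun a t => th a * t) N vc uc vcK ucK vcD vcZ.
pose psi (i : 'I_d) (t : car FT) : car FT := z * t.
have psil i : flin (psi i) by split=> [s t|a t]; rewrite /psi /= ?mulrDr // mulrCA.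
have TP : \prod_(i < d) mxof (psi i) = f%:M.
  apply: mxof_prod => // i t; have H l j s : @fpath S0 d FT psi j l s = z ^+ l * s.
    elim: l j s => [|l ih] j s; first by rewrite mul1r.
    by rewrite [LHS]/= ih exprS -mulrA.
  by rewrite H -fz /= eth.
pose TM := Dmf TP.
(* Were all coordinates of [z^e] in the maximal ideal of [S0], then [z^e] would lie in [(X, Y)]. So
   some coordinate is a unit, and dividing that coordinate function by it gives [rh]. *)
have [rh [rhD rhZ rh1]] : exists rh : T -> S0, [/\ (forall s t, rh (s + t) = rh s + rh t),
    (forall a t, rh (th a * t) = a * rh t) & rh (z ^+ e) = 1].
  have [j hj] : exists j, s0 (co (z ^+ e) j) != 0.
    apply: contrapT => H; apply: zI; rewrite (hco (z ^+ e)); apply: inI_sum => j _.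
    rewrite mulrC; apply: inIM; apply: Th_inI => //; apply: contrapT => /eqP h; apply: H; by exists j.
  have uj : co (z ^+ e) j \is a GRing.unit by rewrite s_unitE.
  exists (fun t => co t j / co (z ^+ e) j); split=> [s t|a t|]; last by rewrite divrr.
    by have /matrixP/(_ j 0) := vcD s t; rewrite !mxE => ->; rewrite mulrDl.
  by have /matrixP/(_ j 0) := vcZ a t; rewrite !mxE => ->; rewrite mulrA.
apply: (@fint_criterion k 2 d char0 f (ltn0Sn e) [:: TM] f0) => M _.
set p := rk M; pose thm m q (A : 'M[S0]_(m, q)) := map_mx th A.
have Mf i : dpath M i d = f%:M by apply: dmf_cyc.
(* The kernel of [L] consists of the tuples with [M_i v_(i+1) = z v_i]. *)
pose L (v : 'M[T]_(p, d)) : 'M[T]_(p, d) :=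
  \matrix_(a, i) (map_mx th (M i) *m col (ordS i) v - z *: col i v) a 0.
have colL v i : col i (L v) = map_mx th (M i) *m col (ordS i) v - z *: col i v.
  by apply/matrixP => a l; rewrite ord1 mxE [LHS]mxE.
have LD s t : L (s + t) = L s + L t.
  apply: mx_col_ext => i; etransitivity; last exact/esym/colD.
  etransitivity; last exact: (esym (f_equal2 (fun a b => a + b) (colL s i) (colL t i))).
  etransitivity; first exact: colL.
  etransitivity; first exact: (f_equal2 (fun a b => map_mx th (M i) *m a - z *: b) (colD _ s t) (colD _ s t)).
  by rewrite mulmxDr scalerDr opprD addrACA.
have LZ a t : L (a *: t) = a *: L t.
  apply: mx_col_ext => i; etransitivity; last exact/esym/colZ.
  etransitivity; last exact: (esym (congr1 (fun b => a *: b) (colL t i))).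
  etransitivity; first exact: colL.
  etransitivity; first exact: (f_equal2 (fun c d => map_mx th (M i) *m c - z *: d) (colZ _ a t) (colZ _ a t)).
  by rewrite -scalemxAr scalerBr !scalerA [z * a]mulrC.
have Ll : @flin T (fM T p d) (fM T p d) L by split; [exact: LD|exact: LZ].
have [q [W [W1 W2 W3]]] := kernel_free (@mxof T (fM T p d) (fM T p d) L).
have WL t : L (colmx (W *m t)) = 0.
  apply: (@vec_inj T (fM T p d)); rewrite (@mxofP T (fM T p d) (fM T p d) L _ Ll) vec0 /= colmxK; exact: W1.
have exW v : L v = 0 -> exists t, v = colmx (W *m t).
  move=> Lv; have [|t ht] := W2 (mxcol v).
    by have := @mxofP T (fM T p d) (fM T p d) L v Ll; rewrite Lv (@vec0 T (fM T p d)) => <-.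
  by exists t; rewrite -ht mxcolK.
have uniqW t t' : colmx (W *m t) = colmx (W *m t') -> t = t'.
  move=> h; apply/eqP; rewrite -subr_eq0; apply/eqP/W3; rewrite mulmxBr.
  by rewrite -[W *m t]colmxK h colmxK subrr.
(* Going from [j] back to [i] applies [M_i ... M_(j-1)], each step replacing one factor [z]; the
   wrap-around is consistent because [f = z^d] in [T]. *)
pose V j (w : 'cV[S0]_p) : 'M[T]_(p, d) :=
  \matrix_(a, i) (z ^+ (e - ll i j) *: map_mx th (dpath M i (ll i j) *m w)) a 0.
have colV j w i : col i (V j w) = z ^+ (e - ll i j) *: map_mx th (dpath M i (ll i j) *m w).
  by apply/matrixP => a l; rewrite ord1 mxE [LHS]mxE.
have thf w : map_mx th (f%:M *m w) = z ^+ d *: map_mx th w :> 'cV_p.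
  by apply/matrixP => a l; rewrite mul_scalar_mx !mxE rmorphM -fz eth.
have VL j w : L (V j w) = 0.
  apply: mx_col_ext => i; rewrite col0; etransitivity; first exact: colL.
  rewrite (colV j w (ordS i)) (colV j w i) scalerA -exprS -scalemxAr -map_mxM mulmxA.
  have [->|ij] := eqVneq i j.
    rewrite llii ll_ordS subnn subn0 scale1r mul1mx -[M j *m _]/(dpath M j d) Mf.
    by rewrite thf subrr.
  rewrite (ll_step ij) -[M i *m _]/(dpath M i (ll (ordS i) j).+1) subnSK ?subrr //.
  by rewrite -(ll_step ij) ll_lt.
have VD j u w : V j (u + w) = V j u + V j w.
  apply: mx_col_ext => i; etransitivity; last exact/esym/colD.
  etransitivity; last exact: (esym (f_equal2 (fun a b => a + b) (colV j u i) (colV j w i))).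
  by etransitivity; first exact: colV; rewrite mulmxDr map_mxD scalerDr.
have VZ j a w : V j (a *: w) = th a *: V j w.
  apply: mx_col_ext => i; etransitivity; last exact/esym/colZ.
  etransitivity; last exact: (esym (congr1 (fun b => th a *: b) (colV j w i))).
  by etransitivity; first exact: colV; rewrite -scalemxAr map_mxZ !scalerA mulrC.
have VM j w : V j (M j *m w) = z *: V (ordS j) w.
  apply: mx_col_ext => i; etransitivity; last exact/esym/colZ.
  etransitivity; last exact: (esym (congr1 (fun b => z *: b) (colV (ordS j) w i))).
  etransitivity; first exact: colV; rewrite scalerA -exprS mulmxA.
  have [->|ij] := eqVneq i (ordS j).
    rewrite llii ll_ordS subnn subn0 scale1r mul1mx.
    have -> : dpath M (ordS j) e *m M j = dpath M (ordS j) d.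
      by rewrite dpathS -iterSr iter_ordS_d.
    by rewrite Mf thf.
  rewrite (ll_ordSr ij) subnSK; last by rewrite -(ll_ordSr ij) ll_lt.
  by rewrite dpathS iter_ll.
have exV (jw : 'I_d * 'cV[S0]_p) : exists t, V jw.1 jw.2 = colmx (W *m t).
  by apply: exW; apply: VL.
have [tt htt] := choice exV.
have colmxD (s t : 'cV[T]_(p * d)) : colmx (s + t) = colmx s + colmx t by exact: (@unvecD T (fM T p d)).
have colmxZ a (t : 'cV[T]_(p * d)) : colmx (a *: t) = a *: colmx t by exact: (@unvecZ T (fM T p d)).
have tD j u w : tt (j, u + w) = tt (j, u) + tt (j, w).
  apply: uniqW; etransitivity; first exact: (esym (htt (j, u + w))).
  etransitivity; first exact: VD.
  rewrite mulmxDr colmxD; exact: (f_equal2 (fun a b => a + b) (htt (j, u)) (htt (j, w))).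
have tZ j a w : tt (j, a *: w) = th a *: tt (j, w).
  apply: uniqW; etransitivity; first exact: (esym (htt (j, a *: w))).
  etransitivity; first exact: VZ.
  rewrite -scalemxAr colmxZ; exact: (congr1 (fun b => th a *: b) (htt (j, w))).
have tM j w : tt (j, M j *m w) = z *: tt (ordS j, w).
  apply: uniqW; etransitivity; first exact: (esym (htt (j, M j *m w))).
  etransitivity; first exact: VM.
  rewrite -scalemxAr colmxZ; exact: (congr1 (fun b => z *: b) (htt (ordS j, w))).
pose FP := fcV S0 p.
pose al (r : 'I_q) j (w : car FP) : car FT := tt (j, w) r 0.
have all r j : flin (al r j).
  by split=> [u w|a w]; rewrite /al ?tD ?mxE //= tZ mxE.
(* The [r]-th basis solution. *)
pose wr (r : 'I_q) : 'M[T]_(p, d) := colmx (W *m delta_mx r 0).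
pose be (r : 'I_q) j (t : car FT) : car FP := \matrix_(a, c) rh (t * wr r a j).
have rh0 : rh 0 = 0 by apply: (addIr (rh 0)); rewrite -rhD !add0r.
have rh_sum (I : Type) (s : seq I) (F : I -> T) : rh (\sum_(i <- s) F i) = \sum_(i <- s) rh (F i).
  by apply: big_morph.
have bel r j : flin (be r j).
  split=> [u w|a w]; apply/matrixP => c l; rewrite !mxE ?mulrDl ?rhD //.
  by rewrite /= -mulrA rhZ.
have wrK r i : map_mx th (M i) *m col (ordS i) (wr r) = z *: col i (wr r).
  by apply/eqP; rewrite -subr_eq0 -colL WL col0.
have beE r j t a c : be r j t a c = rh (t * wr r a j) by rewrite mxE.
have wrE r i a : \sum_l th (M i a l) * wr r l (ordS i) = z * wr r a i.
  have /matrixP/(_ a 0) := wrK r i; rewrite [LHS]mxE [RHS]mxE [X in _ = z * X]mxE => <-.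
  by apply: eq_bigr => l _; rewrite [map_mx _ _ _ _]mxE [col _ _ _ _]mxE.
have beM r j t : be r j (z * t) = M j *m be r (ordS j) t.
  apply/matrixP => a c; rewrite [LHS]beE [RHS]mxE -mulrA mulrCA -wrE mulr_sumr rh_sum.
  apply: eq_bigr => l _; rewrite [be _ _ _ _ _]beE -rhZ; congr rh; exact: mulrCA.
have fin : fac (fun C => List.In C [:: TM]) (X := M) (Y := M)
   (fun j => \sum_(r < q) @mxof S0 FT FP (be r j) *m @mxof S0 FP FT (al r j)).
  have alM r i w : al r i (M i *m w) = psi i (al r (ordS i) w) by rewrite /al tM mxE.
  have ha r := @dmor_mxof S0 d FP FT (fun i => mulmx (M i)) psi (al r)
    (fun i => flin_mul (M i)) psil (all r) (alM r).
  have hb r := @dmor_mxof S0 d FT FP psi (fun i => mulmx (M i)) (be r)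
    psil (fun i => flin_mul (M i)) (bel r) (beM r).
  apply: fac_bigsum => r; apply: (@facC _ _ _ _ M M TM); first by left.
    by move=> i; have := ha r i; rewrite mxof_mul.
  by move=> i; have := hb r i; rewrite mxof_mul.
apply: (fac_ext fin) => j.
apply: mx_cV_ext => w; rewrite mul1mx mulmx_suml.
have H r : @mxof S0 FT FP (be r j) *m @mxof S0 FP FT (al r j) *m w = be r j (al r j w).
  by rewrite -(mxof_comp (bel r j) (all r j)) -(@mxofP S0 FP FP _ w (flin_comp (bel r j) (all r j))).
rewrite (eq_bigr _ (fun r _ => H r)).
apply/matrixP => a c; rewrite summxE ord1.
under eq_bigr do rewrite mxE.
rewrite -rh_sum.
have expand (v : 'cV[T]_q) : v = \sum_r v r 0 *: delta_mx r 0.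
  apply/matrixP => i l; rewrite summxE (bigD1 i) //= big1 ?addr0 => [|s h]; rewrite !mxE ord1.
    by rewrite !eqxx mulr1.
  by rewrite eq_sym (negPf h) mulr0.
have colmx0 : colmx (0 : 'cV[T]_(p * d)) = 0 by apply: (addIr (colmx 0)); rewrite -colmxD !add0r.
have eV : V j w = \sum_r tt (j, w) r 0 *: wr r.
  etransitivity; first exact: (htt (j, w)).
  rewrite [X in W *m X]expand mulmx_sumr (big_morph _ colmxD colmx0).
  by apply: eq_bigr => r _; rewrite -scalemxAr colmxZ.
have -> : \sum_(r < q) al r j w * wr r a j = V j w a j.
  by rewrite eV summxE; apply: eq_bigr => r _; rewrite [RHS]mxE.
have := colV j w j; rewrite llii subn0 mul1mx => /matrixP/(_ a 0); rewrite !mxE => ->.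
by rewrite mulrC rhZ rh1 mulr1.
Qed.

End ThroughT.

(** * Klein forms *)

Lemma closed_root (k : closedFieldType) (c : k) m : (0 < m)%N -> exists r, r ^+ m = c.
Proof.
move=> m0; have [r hr] := solve_monicpoly (fun i => if i == 0%N then c else 0) m0.
exists r; rewrite hr; case: m m0 hr => // m _ _.
by rewrite big_ord_recl /= mulr1 big1 ?addr0 // => i _; rewrite mul0r.
Qed.

Section Klein.
Variable k : closedFieldType.
Hypothesis char0 : [pchar k] =i pred0.
Notation T := (series k 2).
Notation u := (svar k ord0 : T).
Notation v := (svar k ord_max : T).

Lemma inI_scale (a b : k) (P Q t : T) : a != 0 -> b != 0 -> inI (sC b * Q) (sC a * P) t <-> inI Q P t.
Proof.
move=> a0 b0; split=> -[s1 [s2 ->]].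
  by exists (sC b * s1), (sC a * s2); ring.
exists (sC b^-1 * s1), (sC a^-1 * s2).
have ea : sC a * sC a^-1 = 1 :> T by rewrite -rmorphM mulfV // rmorph1.
have eb : sC b * sC b^-1 = 1 :> T by rewrite -rmorphM mulfV // rmorph1.
by rewrite [X in _ = X + _]mulrACA eb mul1r [X in _ = _ + X]mulrACA ea mul1r.
Qed.

(** Scaling [P] by an [m]-th root of [-a/c] and [Q] by a square root of [-b/c] turns the relation
    into [Y^m + X^2 = R^d]. *)
Lemma klein_fin m e (P Q R : T) (a b c : k) E : (0 < m)%N ->
  a != 0 -> b != 0 -> c != 0 ->
  ordge 1 P -> ordge 1 Q -> Q != 0 ->
  sC a * P ^+ m + sC b * Q ^+ 2 + sC c * R ^+ e.+1 = 0 ->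
  inI Q P (u ^+ E) -> inI Q P (v ^+ E) -> ~ inI Q P (R ^+ e) ->
  fint e.+1 (sext (@xl k 0 ^+ m)).
Proof.
move=> m0 a0 b0 c0 P1 Q1 Q0 rel uI vI RI.
have [a' ha] := closed_root (- a / c) m0.
have [b' hb] := @closed_root k (- b / c) 2 isT.
have a'0 : a' != 0.
  apply/eqP => h; move: ha; rewrite h expr0n eqn0Ngt m0 /= => /esym/eqP.
  by rewrite mulf_eq0 oppr_eq0 invr_eq0 (negPf a0) (negPf c0).
have b'0 : b' != 0.
  apply/eqP => h; move: hb; rewrite h expr0n /= => /esym/eqP.
  by rewrite mulf_eq0 oppr_eq0 invr_eq0 (negPf b0) (negPf c0).
have X1 : ordge 1 (sC b' * Q) by apply: ordgeMl.
have Y1 : ordge 1 (sC a' * P) by apply: ordgeMl.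
have sC0 (q : k) : q != 0 -> sC q != 0 :> T.
  by apply: contra_neq => h; rewrite -(@s0C _ 2 q) h rmorph0.
apply: (@through_T k e char0 (sC b' * Q) (sC a' * P) R E) => //.
- by apply: mulf_neq0 => //; apply: sC0.
- exact/inI_scale.
- exact/inI_scale.
- by apply/sext_neq0/expf_neq0/x_neq0.
- rewrite /sext rmorphXn /= siota_y (chomD (Th_chom X1 Y1)) !(chomX (Th_chom X1 Y1)).
  rewrite Thx // Thy // !exprMn -!rmorphXn /= ha hb !rmorphM !rmorphN /=.
  apply: (mulfI (sC0 _ c0)).
  have ec : sC c * sC c^-1 = 1 :> T by rewrite -rmorphM mulfV // rmorph1.
  have e1 : sC c * (- sC a * sC c^-1 * P ^+ m + - sC b * sC c^-1 * Q ^+ 2) =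
    - (sC c * sC c^-1) * (sC a * P ^+ m + sC b * Q ^+ 2).
    by move: (sC c^-1) (P ^+ m) => w w'; ring.
  by rewrite e1 ec mulN1r; apply/eqP; rewrite eq_sym -addr_eq0 addrC rel.
- by move/inI_scale => h; apply: RI; apply: h.
Qed.

Definition mon2 i j : mon 2 := [ffun a => if a == ord0 then i else j].
Definition cf (t : T) i j : k := t (mon2 i j).

Definition hf (l : seq (k * nat * nat)) : T :=
  foldr (fun q acc => sC q.1.1 * (u ^+ q.1.2 * v ^+ q.2) + acc) 0 l.
(** [Nat.leb], [Nat.sub] and [Nat.eqb] are used here so that [cbv] evaluates the certificates on
    explicit exponents. *)
Definition mulcf (l : seq (k * nat * nat)) (t : nat -> nat -> k) i j : k :=
  foldr (fun q acc => (if Nat.leb q.1.2 i && Nat.leb q.2 j then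
     q.1.1 * t (Nat.sub i q.1.2) (Nat.sub j q.2) else 0) + acc) 0 l.
Definition coef (l : seq (k * nat * nat)) i j : k :=
  foldr (fun q acc => (if Nat.eqb q.1.2 i && Nat.eqb q.2 j then q.1.1 else 0) + acc) 0 l.
Definition lam (l : seq (k * nat * nat)) (t : nat -> nat -> k) : k :=
  foldr (fun q acc => q.1.1 * t q.1.2 q.2 + acc) 0 l.

Lemma uvE a b : u ^+ a * v ^+ b = smon k (mon2 a b).
Proof.
rewrite !svarX -smonD; congr (smon k _); apply/ffunP => i; rewrite !ffunE.
by case: (unliftP ord0 i) => [i' ->|->]; rewrite ?ord1 /= ?muln1 ?muln0 ?addn0.
Qed.

Lemma cf_hf_mul l t i j : cf (hf l * t) i j = mulcf l (cf t) i j.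
Proof.
elim: l => [|[[c a] b] l ih] /=; first by rewrite mul0r.
rewrite mulrDl -ih; congr (_ + _).
rewrite -mulrA /cf sCM uvE smonM.
have -> : mle (mon2 a b) (mon2 i j) = Nat.leb a i && Nat.leb b j.
  have lebE p q : Nat.leb p q = (p <= q)%N by elim: p q => [|p ih'] [|q] //=; rewrite ih'.
  rewrite !lebE; apply/mleP/andP => [h|[h1 h2] s].
    by have := h ord0; have := h ord_max; rewrite !ffunE /= => -> ->.
  by rewrite !ffunE; case: eqP.
case: ifP => h; last by rewrite mulr0.
by congr (_ * t _); apply/ffunP => s; rewrite !ffunE; case: eqP.
Qed.

Lemma cf_hf l i j : cf (hf l) i j = coef l i j.
Proof.
elim: l => [|[[c a] b] l ih] //=; rewrite -ih; congr (_ + _).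
rewrite /cf sCM uvE /smon.
have eqbE p q : Nat.eqb p q = (p == q)%N by elim: p q => [|p ih'] [|q] //=; rewrite ih' eqSS.
have -> : (mon2 i j == mon2 a b) = Nat.eqb a i && Nat.eqb b j.
  rewrite !eqbE; apply/eqP/andP => [h|[/eqP-> /eqP->]] //.
  by split; apply/eqP; [have /ffunP/(_ ord0) := h|have /ffunP/(_ ord_max) := h]; rewrite !ffunE.
by case: ifP => _; rewrite ?mulr1 ?mulr0.
Qed.

Lemma ordge_hf l : all (fun q => 0 < q.1.2 + q.2)%N l -> ordge 1 (hf l).
Proof.
elim: l => [|[[c a] b] l ih] //= /andP[h1 /ih h2]; apply: ordgeD => //.
apply: ordgeMl; apply: (ordgeW h1); apply: ordgeM; apply: ordgeX1; exact: ordge_svar.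
Qed.

Lemma lamD L s t : lam L (fun i j => s i j + t i j) = lam L s + lam L t.
Proof. by elim: L => [|q L ih] /=; rewrite ?addr0 // ih mulrDr addrACA. Qed.
Lemma lam_ext L s t : (forall i j, s i j = t i j) -> lam L s = lam L t.
Proof. by move=> h; elim: L => //= q L ->; rewrite h. Qed.

(** The certificates are cleared of denominators by powers of 2, 3 and 5, which are invertible in
    characteristic 0. *)
Lemma smooth_neq0 a b c : (2%:R ^+ a * 3%:R ^+ b * 5%:R ^+ c : k) != 0.
Proof. by rewrite !mulf_eq0 !expf_eq0 !((pcharf0P k).1 char0) /= !andbF. Qed.

(* [L] is a linear functional on forms which vanishes on the ideal of the
   forms [lP], [lQ] but not on [R ^+ e]. *)
Lemma klein_cert m e (lP lQ lR L : seq (k * nat * nat)) (R : T) (a b c : k) E A B A' B' p q r p' q' r' p2 q2 r2 i0 : (0 < m)%N ->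
  a != 0 -> b != 0 -> c != 0 ->
  all (fun q => 0 < q.1.2 + q.2)%N lP -> all (fun q => 0 < q.1.2 + q.2)%N lQ ->
  coef lQ i0 0 = 1 ->
  sC a * hf lP ^+ m + sC b * hf lQ ^+ 2 + sC c * R ^+ e.+1 = 0 ->
  sC (2%:R ^+ p * 3%:R ^+ q * 5%:R ^+ r) * u ^+ E = hf lQ * A + hf lP * B ->
  sC (2%:R ^+ p' * 3%:R ^+ q' * 5%:R ^+ r') * v ^+ E = hf lQ * A' + hf lP * B' ->
  R ^+ e = hf lR ->
  (forall s t, lam L (mulcf lQ s) + lam L (mulcf lP t) = 0) ->
  lam L (coef lR) = 2%:R ^+ p2 * 3%:R ^+ q2 * 5%:R ^+ r2 ->
  fint e.+1 (sext (@xl k 0 ^+ m)).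
Proof.
move=> m0 a0 b0 c0 lP1 lQ1 lQ0 rel eu ev eR lam0 lam1.
have Q0 : hf lQ != 0.
  by apply/eqP => h; move/eqP: lQ0; rewrite -cf_hf h eq_sym oner_eq0.
have inIu t A1 B1 x y z : sC (2%:R ^+ x * 3%:R ^+ y * 5%:R ^+ z) * t = hf lQ * A1 + hf lP * B1 ->
    inI (hf lQ) (hf lP) t.
  move=> h; set w := _ * _ * _ in h; exists (sC w^-1 * A1), (sC w^-1 * B1).
  rewrite mulrCA [X in _ = _ + X]mulrCA -mulrDr -h mulrA -rmorphM /= mulVf ?smooth_neq0 //.
  by rewrite rmorph1 mul1r.
apply: (klein_fin m0 a0 b0 c0 (ordge_hf lP1) (ordge_hf lQ1) Q0 rel).
- exact: inIu eu.
- exact: inIu ev.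
case=> s [t h]; have := smooth_neq0 p2 q2 r2; rewrite -lam1 => /eqP; apply.
rewrite -(lam0 (cf s) (cf t)) -lamD; apply: lam_ext => i j.
by rewrite -!cf_hf_mul -cf_hf -eR h.
Qed.

End Klein.

Section Certificates.
Variable k : closedFieldType.
Hypothesis char0 : [pchar k] =i pred0.
Notation T := (series k 2).
Notation u := (svar k ord0 : T).
Notation v := (svar k ord_max : T).

Ltac klein_certificate char0 k :=
  try solve [ by rewrite ?oppr_eq0 ?oner_eq0 // ((pcharf0P k).1 char0)
  | by cbv [coef foldr fst snd Nat.eqb andb]; ring
  | by cbv [hf foldr fst snd]; ring
  | by move=> s t; cbv [lam mulcf foldr fst snd Nat.leb Nat.sub andb]; ring
  | by cbv [lam coef foldr fst snd Nat.eqb andb]; ring].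

(** Dihedral case: [(u^d + v^d)^2 - (u^d - v^d)^2 = 4 (u v)^d]. The ideal is [(u^d, v^d)], and the
    monomial [(u v)^(d-1)] is not in it. *)
Lemma fint_2 e : fint e.+1 (sext (@xl k 0 ^+ 2)).
Proof.
have two0 : 2%:R != 0 :> k by rewrite ((pcharf0P k).1 char0).
have ed q : q = sC 2%:R^-1 * (2%:R * q) :> T.
  by rewrite -(rmorph_nat (@sC k 2) 2) mulrA -rmorphM /= mulVf // rmorph1 mul1r.
pose lP : seq (k * nat * nat) := [:: (1, e.+1, 0%N); (1, 0%N, e.+1)].
pose lQ : seq (k * nat * nat) := [:: (1, e.+1, 0%N); (- 1, 0%N, e.+1)].
have hE : u ^+ e.+1 + v ^+ e.+1 = hf lP.
  by rewrite /hf /= !rmorph1 !expr0 !mul1r !mulr1 addr0.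
have hE' : u ^+ e.+1 - v ^+ e.+1 = hf lQ.
  by rewrite /hf /= !rmorphN !rmorph1 !expr0 !mul1r !mulr1 addr0 mulN1r.
have lebE p q : Nat.leb p q = (p <= q)%N by elim: p q => [|p ih'] [|q] //=; rewrite ih'.
have eqbE p q : Nat.eqb p q = (p == q)%N by elim: p q => [|p ih'] [|q] //=; rewrite ih' eqSS.
apply: (@klein_fin k char0 2 e (u ^+ e.+1 + v ^+ e.+1) (u ^+ e.+1 - v ^+ e.+1) (u * v) 1 (- 1) (- 4%:R) e.+1) => //.
1-3: by rewrite ?oppr_eq0 ?oner_eq0 // ((pcharf0P k).1 char0).
- by rewrite hE; apply: ordge_hf.
- by rewrite hE'; apply: ordge_hf.
- rewrite hE'; apply/eqP => h; have := cf_hf lQ e.+1 0.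
  by rewrite h /= eqbE eqxx /= addr0 addr0 => /eqP; rewrite eq_sym oner_eq0.
- rewrite !rmorphN rmorph1 (rmorph_nat (@sC k 2)) exprMn !exprS; ring.
- exists (sC 2%:R^-1), (sC 2%:R^-1); rewrite {1}[u ^+ _]ed; ring.
- exists (- sC 2%:R^-1), (sC 2%:R^-1); rewrite {1}[v ^+ _]ed; ring.
case=> s [t]; rewrite hE hE'.
have -> : (u * v) ^+ e = hf [:: (1, e, e)] by rewrite /hf /= rmorph1 mul1r exprMn addr0.
move=> h; have : cf (hf [:: (1, e, e)]) e e = cf (hf lQ * s) e e + cf (hf lP * t) e e by rewrite h.
rewrite !cf_hf_mul cf_hf /mulcf /coef /lP /lQ; cbn [foldr fst snd].
rewrite !lebE !eqbE eqxx leq0n ltnn /= !addr0 => /eqP; by rewrite oner_eq0.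
Qed.

(** Tetrahedral case: quartics [P], [R] and a sextic [Q], in coordinates that make them rational.
    Here and below [deg P + deg Q - 2] is the degree of [R^(d-1)], the socle degree of [T / (P, Q)].
    So a functional on forms of this one degree detects [R^(d-1)], while powers of [u] and [v] of
    higher degree lie in the ideal. *)
Lemma fint_3_3 : fint 3 (sext (@xl k 0 ^+ 3)).
Proof.
apply: (@klein_cert k char0 3 2
  ([:: (1, 4%N, 0%N); (- 4, 3%N, 1%N); (6, 2%N, 2%N); (- 12, 1%N, 3%N); (9, 0%N, 4%N)])
  ([:: (1, 6%N, 0%N); (- 6, 5%N, 1%N); (15, 4%N, 2%N); (- 45, 2%N, 4%N); (54, 1%N, 5%N); (- 27, 0%N, 6%N)])
  ([:: (16, 6%N, 2%N); (- 96, 5%N, 3%N); (240, 4%N, 4%N); (- 288, 3%N, 5%N); (144, 2%N, 6%N)])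
  ([:: (567, 8%N, 0%N); (189, 7%N, 1%N); (63, 6%N, 2%N); (27, 5%N, 3%N); (15, 4%N, 4%N); (9, 3%N, 5%N); (7, 2%N, 6%N); (7, 1%N, 7%N); (7, 0%N, 8%N)])
  ( - 4*u^+3*v + 12*u^+2*v^+2 - 12*u*v^+3)
  (1) (- 1) (- 1) 9
  (61*u^+3 - 63*u^+2*v + 189*u*v^+2 - 189*v^+3)
  ( - 45*u^+5 + 249*u^+4*v - 216*u^+3*v^+2 - 630*u^+2*v^+3 + 945*u*v^+4 - 567*v^+5)
  (7*u^+3 - 21*u^+2*v + 21*u*v^+2 - 61*v^+3)
  ( - 7*u^+5 + 35*u^+4*v - 70*u^+3*v^+2 - 72*u^+2*v^+3 + 249*u*v^+4 - 135*v^+5)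
  4 0 0 4 3 0 4 3 0 6) => //; klein_certificate char0 k.
Qed.

(** Octahedral relation [P^3 - Q^2 = 108 R^4] in degrees 8, 12 and 6, with [R = u v (u^4 - v^4)]. *)
Lemma fint_3_4 : fint 4 (sext (@xl k 0 ^+ 3)).
Proof.
apply: (@klein_cert k char0 3 3
  ([:: (1, 8%N, 0%N); (14, 4%N, 4%N); (1, 0%N, 8%N)])
  ([:: (1, 12%N, 0%N); (- 33, 8%N, 4%N); (- 33, 4%N, 8%N); (1, 0%N, 12%N)])
  ([:: (1, 15%N, 3%N); (- 3, 11%N, 7%N); (3, 7%N, 11%N); (- 1, 3%N, 15%N)])
  ([:: (13, 15%N, 3%N); (- 1, 11%N, 7%N); (1, 7%N, 11%N); (- 13, 3%N, 15%N)])
  (u^+5*v - u*v^+5)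
  (1) (- 1) (- 108) 20
  (576*u^+8 + (5*10^+3 + 543)*u^+4*v^+4 + 395*v^+8)
  ((13*10^+3 + 465)*u^+8*v^+4 + (13*10^+3 + 22)*u^+4*v^+8 - 395*v^+12)
  (13*u^+4*v^+4 + 181*v^+8)
  ( - 13*u^+8*v^+4 + 430*u^+4*v^+8 + 395*v^+12)
  6 2 0 6 2 0 5 0 0 12) => //; klein_certificate char0 k.
Qed.

(** The octahedral relation with the forms of degrees 6 and 8 exchanged. *)
Lemma fint_4_3 : fint 3 (sext (@xl k 0 ^+ 4)).
Proof.
apply: (@klein_cert k char0 4 2
  ([:: (1, 5%N, 1%N); (- 1, 1%N, 5%N)])
  ([:: (1, 12%N, 0%N); (- 33, 8%N, 4%N); (- 33, 4%N, 8%N); (1, 0%N, 12%N)])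
  ([:: (1, 16%N, 0%N); (28, 12%N, 4%N); (198, 8%N, 8%N); (28, 4%N, 12%N); (1, 0%N, 16%N)])
  ([:: (65, 16%N, 0%N); (1, 12%N, 4%N); (1, 8%N, 8%N); (1, 4%N, 12%N); (65, 0%N, 16%N)])
  (u^+8 + 14*u^+4*v^+4 + v^+8)
  (- 108) (- 1) (1) 20
  (64*u^+8 - 65*u^+4*v^+4)
  ((2*10^+3 + 177)*u^+11*v^+3 + (2*10^+3 + 144)*u^+7*v^+7 - 65*u^+3*v^+11)
  ( - 65*u^+4*v^+4 + 64*v^+8)
  (65*u^+11*v^+3 - (2*10^+3 + 144)*u^+7*v^+7 - (2*10^+3 + 177)*u^+3*v^+11)
  6 0 0 6 0 0 7 1 0 12) => //; klein_certificate char0 k.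
Qed.

(** Icosahedral relation [P^3 + Q^2 = 1728 R^5] in degrees 20, 30 and 12; [R] vanishes at the
    vertices of the icosahedron. *)
Lemma fint_3_5 : fint 5 (sext (@xl k 0 ^+ 3)).
Proof.
apply: (@klein_cert k char0 3 4
  ([:: (- 1, 20%N, 0%N); (228, 15%N, 5%N); (- 494, 10%N, 10%N); (- 228, 5%N, 15%N); (- 1, 0%N, 20%N)])
  ([:: (1, 30%N, 0%N); (522, 25%N, 5%N); (- (10*10^+3 + 5), 20%N, 10%N); (- (10*10^+3 + 5), 10%N, 20%N); (- 522, 5%N, 25%N); (1, 0%N, 30%N)])
  ([:: (1, 44%N, 4%N); (44, 39%N, 9%N); (722, 34%N, 14%N); (5*10^+3 + 192, 29%N, 19%N); (13*10^+3 + 195, 24%N, 24%N); (- (5*10^+3 + 192), 19%N, 29%N); (722, 14%N, 34%N); (- 44, 9%N, 39%N); (1, 4%N, 44%N)])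
  ([:: (2*10^+6 + 22*10^+3 + 161, 44%N, 4%N); (10*10^+3 + 323, 39%N, 9%N); (589, 34%N, 14%N); (177, 29%N, 19%N); (161, 24%N, 24%N); (- 177, 19%N, 29%N); (589, 14%N, 34%N); (- (10*10^+3 + 323), 9%N, 39%N); (2*10^+6 + 22*10^+3 + 161, 4%N, 44%N)])
  (u^+11*v + 11*u^+6*v^+6 - u*v^+11)
  (1) (1) (- 1728) 50
  ((1*10^+9 + 406*10^+6 + 250*10^+3)*u^+20 - (217*10^+9 + 699*10^+6 + 643*10^+3 + 411)*u^+15*v^+5 + (469*10^+9 + 52*10^+6 + 10*10^+3 + 531)*u^+10*v^+10 + (216*10^+9 + 696*10^+6 + 319*10^+3 + 483)*u^+5*v^+15 + (950*10^+6 + 431*10^+3 + 323)*v^+20)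
  ((516*10^+9 + 362*10^+6 + 856*10^+3 + 589)*u^+25*v^+5 - (9*10^+12 + 508*10^+9 + 961*10^+6 + 797*10^+3 + 719)*u^+20*v^+10 + (20*10^+9 + 237*10^+6 + 108*10^+3 + 822)*u^+15*v^+15 - (9*10^+12 + 508*10^+9 + 9*10^+6 + 828*10^+3 + 896)*u^+10*v^+20 - (496*10^+9 + 127*10^+6 + 172*10^+3 + 767)*u^+5*v^+25 + (950*10^+6 + 431*10^+3 + 323)*v^+30)
  ((2*10^+6 + 22*10^+3 + 161)*u^+15*v^+5 - (461*10^+6 + 63*10^+3 + 31)*u^+10*v^+10 + (1*10^+9 + 1*10^+6 + 301*10^+3 + 767)*u^+5*v^+15 + (455*10^+6 + 818*10^+3 + 677)*v^+20)
  ((2*10^+6 + 22*10^+3 + 161)*u^+25*v^+5 + (1*10^+9 + 55*10^+6 + 557*10^+3 + 719)*u^+20*v^+10 - (20*10^+9 + 237*10^+6 + 108*10^+3 + 822)*u^+15*v^+15 + (103*10^+6 + 588*10^+3 + 896)*u^+10*v^+20 - (20*10^+9 + 237*10^+6 + 705*10^+3 + 983)*u^+5*v^+25 - (950*10^+6 + 431*10^+3 + 323)*v^+30)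
  4 2 10 4 2 10 0 0 10 30) => //; klein_certificate char0 k.
Qed.

(** The icosahedral relation with the forms of degrees 12 and 20 exchanged. *)
Lemma fint_5_3 : fint 3 (sext (@xl k 0 ^+ 5)).
Proof.
apply: (@klein_cert k char0 5 2
  ([:: (1, 11%N, 1%N); (11, 6%N, 6%N); (- 1, 1%N, 11%N)])
  ([:: (1, 30%N, 0%N); (522, 25%N, 5%N); (- (10*10^+3 + 5), 20%N, 10%N); (- (10*10^+3 + 5), 10%N, 20%N); (- 522, 5%N, 25%N); (1, 0%N, 30%N)])
  ([:: (1, 40%N, 0%N); (- 456, 35%N, 5%N); (52*10^+3 + 972, 30%N, 10%N); (- (224*10^+3 + 808), 25%N, 15%N); (140*10^+3 + 70, 20%N, 20%N); (224*10^+3 + 808, 15%N, 25%N); (52*10^+3 + 972, 10%N, 30%N); (456, 5%N, 35%N); (1, 0%N, 40%N)])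
  ([:: (1*10^+6 + 968*10^+3 + 252, 40%N, 0%N); (- (1*10^+3 + 364), 35%N, 5%N); (123, 30%N, 10%N); (- 11, 25%N, 15%N); (2, 20%N, 20%N); (11, 15%N, 25%N); (123, 10%N, 30%N); (1*10^+3 + 364, 5%N, 35%N); (1*10^+6 + 968*10^+3 + 252, 0%N, 40%N)])
  ( - u^+20 + 228*u^+15*v^+5 - 494*u^+10*v^+10 - 228*u^+5*v^+15 - v^+20)
  (- 1728) (1) (1) 45
  ((1*10^+6 + 953*10^+3 + 125)*u^+15 + (21*10^+6 + 652*10^+3 + 136)*u^+10*v^+5 - (1*10^+6 + 968*10^+3 + 252)*u^+5*v^+10)
  ( - (1*10^+9 + 41*10^+6 + 183*10^+3 + 386)*u^+29*v^+4 + (19*10^+9 + 693*10^+6 + 586*10^+3 + 131)*u^+24*v^+9 - (13*10^+6 + 582*10^+3 + 603)*u^+19*v^+14 + (19*10^+9 + 691*10^+6 + 649*10^+3 + 129)*u^+14*v^+19 + (1*10^+9 + 27*10^+6 + 428*10^+3 + 908)*u^+9*v^+24 - (1*10^+6 + 968*10^+3 + 252)*u^+4*v^+29)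
  ( - (1*10^+6 + 968*10^+3 + 252)*u^+10*v^+5 - (21*10^+6 + 652*10^+3 + 136)*u^+5*v^+10 + (1*10^+6 + 953*10^+3 + 125)*v^+15)
  ((1*10^+6 + 968*10^+3 + 252)*u^+29*v^+4 + (1*10^+9 + 27*10^+6 + 428*10^+3 + 908)*u^+24*v^+9 - (19*10^+9 + 691*10^+6 + 649*10^+3 + 129)*u^+19*v^+14 - (13*10^+6 + 582*10^+3 + 603)*u^+14*v^+19 - (19*10^+9 + 693*10^+6 + 586*10^+3 + 131)*u^+9*v^+24 - (1*10^+9 + 41*10^+6 + 183*10^+3 + 386)*u^+4*v^+29)
  0 0 9 0 0 9 2 1 9 30) => //; klein_certificate char0 k.
Qed.

End Certificates.

(** * Stabilization and normal forms *)

Section Stable.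
Variable k : fieldType.

Definition lift_last n m (phi : 'I_n -> series k m) (p : series k m.+1) (i : 'I_n.+1) : series k m.+1 :=
  if unlift ord_max i is Some j then siota (phi j) else p.

Lemma lift_last_max n m (phi : 'I_n -> series k m) p : lift_last phi p ord_max = p.
Proof. by rewrite /lift_last unlift_none. Qed.
Lemma lift_lastE n m (phi : 'I_n -> series k m) p i : lift_last phi p (lift ord_max i) = siota (phi i).
Proof. by rewrite /lift_last liftK. Qed.

Lemma lift_last_ord n m (phi : 'I_n -> series k m) p : (forall i, ordge 1 (phi i)) -> ordge 1 p ->
  forall i, ordge 1 (lift_last phi p i).
Proof. by move=> h hp i; rewrite /lift_last; case: unlift => // j; apply/ordge_iota. Qed.

Lemma gsubst_iota n m (phi : 'I_n -> series k m) p f : (forall i, ordge 1 (phi i)) -> ordge 1 p ->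
  gsubst (lift_last phi p) (siota f) = siota (gsubst phi f).
Proof.
move=> h hp; have c1 := gsubst_chom (lift_last_ord h hp).
apply: (chom_ext (chom_comp c1 (@chom_siota k n)) (chom_comp (@chom_siota k m) (gsubst_chom h))) => i /=.
by rewrite siota_var !gsubst_var // ?lift_lastE //; apply: lift_last_ord.
Qed.

Lemma gsubst_last n m (phi : 'I_n -> series k m) p : (forall i, ordge 1 (phi i)) -> ordge 1 p ->
  gsubst (lift_last phi p) (@xl k n) = p.
Proof. by move=> h hp; rewrite gsubst_var ?lift_last_max //; apply: lift_last_ord. Qed.

Lemma ordge_xl n : ordge 1 (@xl k n). Proof. exact: ordge_svar. Qed.
Hint Resolve ordge_xl ordge_svar : core.

Lemma cchange_lift n (phi : 'I_n -> series k n) : cchange phi -> cchange (lift_last phi (@xl k n)).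
Proof.
move=> hc; have [psi [h1 h2 h3]] := cchange_inv_ex hc; case: hc => p1 _.
apply: (@cchange_of_inv _ _ _ (lift_last psi (@xl k n))); try exact: lift_last_ord.
all: move=> i; case: (unliftP ord_max i) => [j ->|->]; rewrite ?lift_lastE ?lift_last_max.
- by rewrite gsubst_iota // h2 siota_var.
- by rewrite gsubst_last.
- by rewrite gsubst_iota // h3 siota_var.
- by rewrite gsubst_last.
Qed.

Lemma req_sext n (f g : series k n) : req f g -> req (sext f) (sext g).
Proof.
move=> [phi [hc ->]]; exists (lift_last phi (@xl k n)); split; first exact: cchange_lift.
have p1 := proj1 hc.
have c := gsubst_chom (lift_last_ord p1 (@ordge_xl n)).
by rewrite /sext (chomD c) (chomX c) gsubst_iota // gsubst_last.
Qed.

Lemma req_neq0 n (f g : series k n) : req f g -> g != 0 -> f != 0.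
Proof.
move=> [phi [[p1 p2] ->]]; apply: contra_neq => h; apply: (bij_inj p2).
by rewrite h (chom0 (gsubst_chom p1)).
Qed.

(** [f] is [g] plus squares of [n - c] new variables, a change of variables being allowed after each
    square. *)
Inductive stab c (g : series k c) : forall n, series k n -> Prop :=
| stab0 : stab g g
| stabS n (f : series k n.+1) (f' : series k n) : req f (sext f') -> stab g f' -> stab g f.

Lemma stab_neq0 c (g : series k c) n (f : series k n) : stab g f -> g != 0 -> f != 0.
Proof.
move=> h g0; elim: h => // m f1 f2 r _ ih; apply: (req_neq0 r).
exact: sext_neq0.
Qed.

Hypothesis char0 : [pchar k] =i pred0.

Lemma stab_down e c (g : series k c) n (f : series k n) : stab g f -> g != 0 ->
  fint e.+1 f -> fint e.+1 g.
Proof.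
move=> h g0; elim: h => // m f1 f2 r s ih /(fint_req _ r).1 h; apply: ih.
exact: (step_down (stab_neq0 s g0) char0 h).
Qed.

Lemma stab_up e c (g : series k c) n (f : series k n) : stab g f -> g != 0 ->
  fint e.+1 g -> fint e.+1 f.
Proof.
move=> h g0; elim: h => // m f1 f2 r s ih /ih h; apply/(fint_req _ r).2.
exact: (step_up char0 (stab_neq0 s g0) h).
Qed.

Lemma stab_leq c (g : series k c) n (f : series k n) : stab g f -> (c <= n)%N.
Proof. by elim=> // m f1 f2 _ _; apply: leqW. Qed.

(** The Knörrer steps need a nonzero series; for [g = 0] the chain is restarted after its first
    square, where at least [c] variables do not occur. *)
Lemma stab_zero c n (f : series k n) : stab (0 : series k c) f ->
  f = 0 \/ exists m (h : series k m.+1), [/\ (c <= m)%N, req h (sext 0) & stab h f].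
Proof.
elim=> [|m f1 f2 r s [f0|[m' [h [hm rh s']]]]]; first by left.
  by right; exists m, f1; rewrite -f0; split=> //; [exact: stab_leq s|exact: stab0].
by right; exists m', h; split=> //; apply: stabS s'.
Qed.

Lemma AnfE j n : Anf k j n = svar k ord0 ^+ j.+1 + \sum_(i < n) svar k (lift ord0 i) ^+ 2.
Proof.
rewrite /Anf spowE; congr (_ + _); by apply: eq_bigr => i _; rewrite spowE.
Qed.

Lemma Anf0 j : Anf k j 0 = @xl k 0 ^+ j.+1.
Proof. by rewrite AnfE big_ord0 addr0 /xl; congr (svar k _ ^+ _); apply: val_inj. Qed.

Lemma AnfS j n : Anf k j n.+1 = sext (Anf k j n).
Proof.
rewrite /sext !AnfE rmorphD rmorph_sum rmorphXn /= siota_var big_ord_recr /= addrA; congr (_ + _ + _).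
- apply: eq_bigr => i _; rewrite rmorphXn /= siota_var /=; congr (svar k _ ^+ _); apply: val_inj => /=.
  by rewrite /bump /=; have := ltn_ord i; lia.
Qed.

Lemma stab_Anf j n : stab (@xl k 0 ^+ j.+1) (Anf k j n).
Proof.
elim: n => [|n ih]; first by rewrite Anf0; apply: stab0.
by apply: stabS ih; rewrite AnfS; apply: req_refl.
Qed.

Lemma stab_AnfP j g n (f : series k n) : stab g f -> req g (@xl k 0 ^+ j.+1) ->
  match n return series k n -> Prop with 0 => fun=> True | n.+1 => fun f => req f (Anf k j n) end f.
Proof.
move=> h r; elim: h => [|[|m] f1 f2 r1 s ih]; first by rewrite Anf0.
  by have := stab_leq s.
by apply: (req_trans r1); rewrite AnfS; apply: req_sext.
Qed.

Lemma stab_squares n (f : series k n) : stab (0 : series k 0) f ->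
  match n return series k n -> Prop with 0 => fun f => f = 0 | n.+1 => fun f => req f (Anf k 1 n) end f.
Proof.
elim=> // -[|m] f1 f2 r1 s ih; apply: (req_trans r1); last by rewrite AnfS; apply: req_sext.
by rewrite ih /sext rmorph0 add0r Anf0; apply: req_refl.
Qed.

End Stable.

(** * The splitting lemma *)

Section Split.
Variable k : closedFieldType.
Hypothesis char0 : [pchar k] =i pred0.
Hint Resolve ordge_xl ordge_svar : core.

Lemma ordge_dec n N (f : series k n) : ordge N.+1 f ->
  exists g : 'I_n -> series k n, f = \sum_i svar k i * g i /\ forall i, ordge N (g i).
Proof.
elim: n f => [|n ih] f hf.
  exists (fun=> 0); split=> [|i]; last by case: i.
  by rewrite big_ord0; apply: s0_inj0; rewrite rmorph0; apply/ordge1P/(ordgeW _ hf).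
have [g [eg hg]] := ih (slice 0 f) (ordge_slice0 hf).
exists (lift_last g (sshift f)); split=> [|i].
  rewrite {1}(sshiftE f) eg rmorph_sum /= (bigD1_ord ord_max) //= lift_last_max addrC; congr (_ + _).
  by apply: eq_bigr => i _; rewrite rmorphM /= siota_var lift_lastE.
by rewrite /lift_last; case: unlift => [j|]; [apply/ordge_iota|apply: ordge_sshift].
Qed.

Lemma series_const n (f : series k n) : ordge 1 (f - sC (s0 f)).
Proof. by apply/ordge1P; rewrite rmorphB /= s0C subrr. Qed.

Lemma ordge_quad n (f : series k n) : ordge 2 f ->
  exists C : 'M[k]_n, ordge 3 (f - \sum_i \sum_j sC (C i j) * (svar k i * svar k j)).
Proof.
move=> /ordge_dec[g [-> hg]].
have [h hh] := choice (fun i => ordge_dec (hg i)).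
exists (\matrix_(i, j) s0 (h i j)); rewrite -sumrB; apply: ordge_sum => i _.
have [{1}-> _] := hh i; rewrite mulr_sumr -sumrB; apply: ordge_sum => j _.
rewrite mxE (_ : _ - _ = svar k i * svar k j * (h i j - sC (s0 (h i j)))); last by ring.
by apply: (ordgeM (M := 2)); [apply: (ordgeM (M := 1) (N := 1))|apply: series_const].
Qed.

Definition qf n (C : 'M[k]_n) (w : 'I_n -> k) := \sum_i \sum_j C i j * (w i * w j).

Lemma two0 : 2%:R != 0 :> k. Proof. by rewrite ((pcharf0P k).1 char0). Qed.

(** A quadratic form vanishing on all vectors with last coordinate 1 is zero: the vectors [en],
    [en + u] and [en - u] give [q(u) = B(en, u) = 0], and polarization does the rest. *)
Lemma qf_neq0 n (C : 'M[k]_n.+1) :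
  (forall u : 'I_n.+1 -> k, u ord_max = 0 -> qf C (fun i => (i == ord_max)%:R + u i) = 0) ->
  forall i j, C i j + C j i = 0.
Proof.
move=> h; pose B u v := \sum_i \sum_j C i j * (u i * v j + v i * u j).
have qB u v : qf C (fun i => u i + v i) = qf C u + qf C v + B u v.
  rewrite /qf /B -!big_split; apply: eq_bigr => i _; rewrite -!big_split; apply: eq_bigr => j _ /=.
  by ring.
pose en i : k := (i == ord_max :> 'I_n.+1)%:R.
have qn : qf C en = 0.
  rewrite -[RHS](h (fun=> 0)) //; congr (qf C _); apply: funext => i; by rewrite addr0.
have qu u : u ord_max = 0 -> qf C u = 0 /\ B en u = 0.
  move=> hu; have := h u hu; rewrite qB qn add0r => h1.
  have := h (fun i => - u i); rewrite hu oppr0 qB qn add0r => /(_ erefl) h2.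
  have e1 : qf C (fun i => - u i) = qf C u.
    by apply: eq_bigr => i _; apply: eq_bigr => j _; rewrite mulrNN.
  have e2 : B en (fun i => - u i) = - B en u.
    rewrite -sumrN; apply: eq_bigr => i _; rewrite -sumrN; apply: eq_bigr => j _; ring.
  rewrite e1 e2 in h2; have h3 : 2%:R * qf C u = 0.
    transitivity (qf C u + B en u + (qf C u - B en u)); first by ring.
    by rewrite h1 h2 addr0.
  have q0 : qf C u = 0 by apply: (mulfI two0); rewrite mulr0.
  by split=> //; move: h1; rewrite q0 add0r.
have Bu u v : u ord_max = 0 -> v ord_max = 0 -> B u v = 0.
  move=> hu hv; have := qB u v; rewrite (proj1 (qu u hu)) (proj1 (qu v hv)) !add0r => <-.
  by apply: (proj1 (qu _ _)); rewrite hu hv addr0.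
pose de i j : k := (j == i :> 'I_n.+1)%:R.
have Bde i j : B (de i) (de j) = C i j + C j i.
  rewrite /B; under eq_bigr do (under eq_bigr do rewrite mulrDr; rewrite big_split /=).
  rewrite big_split /=; congr (_ + _).
    rewrite (bigD1 i) //= (bigD1 j) //= /de !eqxx !mulr1 !big1 ?addr0 // => l /negPf->.
      by rewrite big1 // => m _; rewrite mul0r mulr0.
    by rewrite mulr0 mulr0.
  rewrite (bigD1 j) //= (bigD1 i) //= /de !eqxx !mulr1 !big1 ?addr0 // => l /negPf->.
    by rewrite big1 // => m _; rewrite mul0r mulr0.
  by rewrite mulr0 mulr0.
have BC u v : B u v = B v u.
  by apply: eq_bigr => i _; apply: eq_bigr => j _; rewrite addrC.
have dm i : i != ord_max -> de i ord_max = 0 by rewrite /de eq_sym => /negPf->.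
have en_de : en = de ord_max by [].
move=> i j; rewrite -Bde; have [->|/dm hi] := eqVneq i ord_max; have [->|/dm hj] := eqVneq j ord_max.
- have := qB en en; rewrite qn !add0r -en_de => <-.
  transitivity (2%:R * 2%:R * qf C en); last by rewrite qn mulr0.
  rewrite mulr_sumr; apply: eq_bigr => i' _; rewrite mulr_sumr; apply: eq_bigr => j' _; ring.
- by rewrite -en_de (proj2 (qu _ hj)).
- by rewrite BC -en_de (proj2 (qu _ hi)).
- exact: Bu.
Qed.

Definition shear n (u : 'I_n.+1 -> k) i : series k n.+1 := svar k i + sC (u i) * @xl k n.

Lemma shear_ord n (u : 'I_n.+1 -> k) i : ordge 1 (shear u i).
Proof. by apply: ordgeD; [exact: ordge_svar|apply: ordgeMl; exact: ordge_xl]. Qed.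

Lemma shear_cc n (u : 'I_n.+1 -> k) : u ord_max = 0 -> cchange (shear u).
Proof.
have H (w w' : 'I_n.+1 -> k) : w ord_max = 0 -> (forall i, w' i = - w i) ->
    forall i, gsubst (shear w) (shear w' i) = svar k i.
  move=> w0 e i; have c := gsubst_chom (shear_ord w).
  rewrite {2}/shear (chomD c) (chomM c) (chomC c) !gsubst_var; try exact: shear_ord.
  rewrite /shear w0 e rmorph0 rmorphN /= -/(@xl k n); ring.
move=> u0; apply: (@cchange_of_inv _ _ _ (shear (fun i => - u i))); try exact: shear_ord.
- exact: H.
- by apply: H => [|i]; rewrite ?u0 ?oppr0 ?opprK.
Qed.

Lemma slice1_svar n (i : 'I_n.+1) : slice 1 (svar k i : series k n.+1) = (i == ord_max)%:R.
Proof.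
case: (unliftP ord_max i) => [j ->|->]; last by rewrite eqxx -/(@xl k n) slice_xl.
by rewrite -siota_var slice_iota /= [_ == ord_max]eq_sym (negPf (neq_lift _ _)).
Qed.

Lemma slice1_shear n (u : 'I_n.+1 -> k) i : slice 1 (shear u i) = sC ((i == ord_max)%:R + u i).
Proof.
rewrite /shear raddfD /= slice1_svar -siota_C slice_iotaM slice_xl mulr1 rmorphD /=.
by case: eqP => _; rewrite ?rmorph1 ?rmorph0.
Qed.

Definition x2coef n (f : series k n.+1) : k := s0 (slice 2 f).
Lemma x2coefD n (f g : series k n.+1) : x2coef (f + g) = x2coef f + x2coef g.
Proof. by rewrite /x2coef !raddfD. Qed.

Lemma x2coef_ord n (f : series k n.+1) : ordge 3 f -> x2coef f = 0.
Proof. by move=> /ordge_slice/(_ 2%N) h; apply/ordge1P. Qed.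

Lemma x2coefM n (f g : series k n.+1) c : ordge 1 f -> ordge 1 g ->
  x2coef (sC c * (f * g)) = c * (s0 (slice 1 f) * s0 (slice 1 g)).
Proof.
move=> hf hg; rewrite /x2coef -siota_C slice_iotaM rmorphM /= s0C; congr (_ * _).
have f0 : s0 (slice 0 f) = 0 by rewrite s0_slice0; apply/ordge1P.
have g0 : s0 (slice 0 g) = 0 by rewrite s0_slice0; apply/ordge1P.
rewrite sliceM rmorph_sum /= !big_ord_recr big_ord0 /= !rmorphM /= f0 g0.
by rewrite mul0r mulr0 add0r addr0 add0r.
Qed.

(** After the shear by [u] the coefficient of the squared last variable is the quadratic part of [f]
    at the vector with last coordinate 1 and other coordinates [u], so [qf_neq0] provides [u]. *)
Lemma generic_shear n (f : series k n.+1) : ordge 2 f -> ~ ordge 3 f ->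
  exists u, u ord_max = 0 /\ x2coef (gsubst (shear u) f) != 0.
Proof.
move=> f2 f3; have [C hC] := ordge_quad f2; apply: contrapT => H; apply: f3.
have hq (u : 'I_n.+1 -> k) : x2coef (gsubst (shear u) f) = qf C (fun i => (i == ord_max)%:R + u i).
  have c := gsubst_chom (shear_ord u); set Q := \sum_i _ in hC.
  rewrite -[f](subrK Q) (chomD c) x2coefD x2coef_ord ?add0r; last exact: (chom_ord c).
  have xs (F : 'I_n.+1 -> series k n.+1) : x2coef (\sum_i F i) = \sum_i x2coef (F i).
    by apply: (big_morph _ (@x2coefD n)); rewrite /x2coef !raddf0.
  rewrite /Q (chom_sum c) xs; apply: eq_bigr => i _; rewrite (chom_sum c) xs; apply: eq_bigr => j _.
  rewrite !(chomM c) (chomC c) !gsubst_var; try exact: shear_ord.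
  by rewrite x2coefM ?slice1_shear ?s0C //; apply: shear_ord.
have /qf_neq0 hz : forall u : 'I_n.+1 -> k, u ord_max = 0 -> qf C (fun i => (i == ord_max)%:R + u i) = 0.
  move=> u u0; rewrite -hq; apply: contrapT => /eqP h; apply: H; by exists u.
suff e : \sum_i \sum_j sC (C i j) * (svar k i * svar k j) = 0 :> series k n.+1 by rewrite e subr0 in hC.
set Q := \sum_i _ in hC *.
have e2 : Q + Q = 0.
  rewrite {2}/Q exchange_big /= -big_split big1 // => i _; rewrite -big_split big1 // => j _ /=.
  by rewrite [svar k j * _]mulrC -mulrDl -rmorphD /= hz rmorph0 mul0r.
have t0 : sC 2%:R != 0 :> series k n.+1.
  by apply: contra_neq two0 => h; rewrite -(@s0C _ n.+1 2%:R) h rmorph0.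
by apply: (mulfI t0); rewrite mulr0 -e2 (rmorph_nat (@sC k n.+1)); ring.
Qed.

Lemma sqr_neq0 (a b : k) : b ^+ 2 = a -> a != 0 -> b != 0.
Proof. by move=> <-; apply: contra_neq => ->; rewrite expr0n. Qed.

Lemma sC_inv n (a : k) : a != 0 -> sC a * sC a^-1 = 1 :> series k n.
Proof. by move=> a0; rewrite -rmorphM mulfV // rmorph1. Qed.

Notation sv n := (@svar k n).
Let sv1 n i : ordge 1 (sv n i). Proof. exact: ordge_svar. Qed.

(** With [x] the last variable, the fixed point [p] solves [2 x p = (r - p^2) - (r - p^2)|_{x=0}],
    hence [x^2 + r = (x + p)^2 + (r - p^2)|_{x=0}]; having order 2, [p] makes [x |-> x + p] a change
    of variables. *)
Lemma morse_perturb n (g : series k n) (r : series k n.+1) : ordge 2 g -> ordge 3 r ->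
  exists2 g', ordge 2 g' & req (siota g + @xl k n ^+ 2 + r) (sext g').
Proof.
move=> g2 r3; pose x := @xl k n; pose hf : series k n.+1 := sC 2%:R^-1.
have hf2 : hf * 2%:R = 1 by rewrite -(rmorph_nat (@sC k n.+1)) mulrC sC_inv // two0.
have sN N (p : series k n.+1) : ordge N.+1 p -> ordge N (hf * sshift p).
  by move=> h; apply/ordgeMl/ordge_sshift.
have [p hp|N p q p2 q2 pq|p p2 e] := @series_fix k n.+1 2 (fun p => hf * sshift (r - p ^+ 2)).
- apply: sN; apply: ordgeB => //; apply: ordgeW (ordgeX (e := 2) hp) => //.
- rewrite -mulrBr -raddfB; apply: sN.
  rewrite (_ : _ - _ = (q - p) * (q + p)); last by ring.
  by rewrite -addn2; apply: ordgeM; [exact: ordgeBC|exact: ordgeD].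
have xp : ordge 1 (x + p) by apply: ordgeD; [exact: ordge_xl|exact: ordgeW p2].
exists (g + slice 0 (r - p ^+ 2)).
  apply: ordgeD => //; apply: ordge_slice0; apply: ordgeB; first exact: ordgeW r3.
  by apply: ordgeW (ordgeX (e := 2) p2).
exists (lift_last (sv n) (x + p)); split.
  apply: cchange_id => i; case: (unliftP ord_max i) => [j ->|->].
    by rewrite lift_lastE siota_var subrr.
  by rewrite lift_last_max addrC -/(@xl k n) addKr.
have c := gsubst_chom (lift_last_ord (@sv1 n) xp).
rewrite /sext (chomD c) (chomX c) gsubst_last // gsubst_iota // gsubst_id raddfD /=.
have e2 : x * sshift (r - p ^+ 2) = 2%:R * (x * p).
  by rewrite -{2}e; transitivity (hf * 2%:R * (x * sshift (r - p ^+ 2))); [rewrite hf2 mul1r|ring].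
have e3 : siota (slice 0 (r - p ^+ 2)) = (r - p ^+ 2) - 2%:R * (x * p).
  by rewrite -e2 [X in _ = X - _]sshiftE addrK.
by rewrite e3 -/x; ring.
Qed.

(** Complete the square in the last variable after a generic shear. The remaining part [r] has order
    3 and is absorbed by [morse_perturb]. *)
Lemma split_square n (f : series k n.+1) : ordge 2 f -> ~ ordge 3 f ->
  exists2 g, ordge 2 g & req f (sext g).
Proof.
move=> f2 f3; have [u [u0 hu]] := generic_shear f2 f3.
set f' := gsubst (shear u) f in hu.
have rf : req f f'.
  by apply: req_sym; exists (shear u); split=> //; apply: shear_cc.
have f'2 : ordge 2 f' by apply: (chom_ord (gsubst_chom (shear_ord u))).
have [b hb] := @closed_root k (x2coef f') 2 isT.
have b0 := sqr_neq0 hb hu; pose x := @xl k n.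
pose f0 := slice 0 f'; pose l := sC (2%:R * b)^-1 * slice 1 f' : series k n.
have l1 : ordge 1 l by apply: ordgeMl; have /ordge_slice/(_ 1%N) := f'2.
pose r := x ^+ 2 * (sshift (sshift f') - sC (x2coef f')).
have r3 : ordge 3 r.
  apply: (ordgeM (M := 2)); first by apply: ordgeX1; apply: ordge_xl.
  suff -> : x2coef f' = s0 (sshift (sshift f')) by apply: series_const.
  by rewrite /x2coef -s0_slice0 !slice_sshift.
have ef : f' = (sC b * x + siota l) ^+ 2 + siota (f0 - l ^+ 2) + r.
  have e2 : siota (slice 1 f') = 2%:R * sC b * siota l.
    rewrite /l rmorphM /= siota_C mulrA -(rmorph_nat (@sC k n.+1)) -rmorphM /=.
    by rewrite sC_inv ?mul1r // mulf_neq0 // two0.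
  have e3 : sC (x2coef f') = sC b ^+ 2 :> series k n.+1 by rewrite -hb rmorphXn.
  have e4 : f' = siota f0 + x * (siota (slice 1 f') + x * sshift (sshift f')).
    by rewrite {1}(sshiftE f') {1}(sshiftE (sshift f')) slice_sshift.
  rewrite /r e3 rmorphB rmorphXn /= {1}e4 e2; ring.
have y1 : ordge 1 (sC b^-1 * (x - siota l)).
  by apply: ordgeMl; apply: ordgeB; [exact: ordge_xl|exact/ordge_iota].
have z1 : ordge 1 (sC b * x + siota l).
  by apply: ordgeD; [apply: ordgeMl; exact: ordge_xl|exact/ordge_iota].
have [cy cz] := (gsubst_chom (lift_last_ord (@sv1 n) y1), gsubst_chom (lift_last_ord (@sv1 n) z1)).
pose r' := gsubst (lift_last (sv n) (sC b^-1 * (x - siota l))) r.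
have [|g g2 hg] := @morse_perturb n (f0 - l ^+ 2) r' _ (chom_ord cy r3).
  apply: ordgeB; first exact: ordge_slice0.
  by apply: ordgeW (ordgeX (e := 2) l1).
exists g => //; apply: (req_trans rf); apply: req_trans hg; apply: req_sym.
have bb := sC_inv n.+1 b0.
have ez : gsubst (lift_last (sv n) (sC b^-1 * (x - siota l))) (sC b * x + siota l) = x.
  rewrite (chomD cy) (chomM cy) (chomC cy) gsubst_last // gsubst_iota // gsubst_id mulrA bb mul1r.
  by rewrite subrK.
exists (lift_last (sv n) (sC b^-1 * (x - siota l))); split; last first.
  move: ef ez; set z := _ + siota l => ef ez.
  rewrite [in RHS]ef !(chomD cy) (chomX cy) ez gsubst_iota // gsubst_id -/r'; congr (_ + _); exact: addrC.
apply: (@cchange_of_inv _ _ _ (lift_last (sv n) (sC b * x + siota l))); try exact: lift_last_ord.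
all: move=> i; case: (unliftP ord_max i) => [j ->|->]; rewrite ?lift_lastE ?lift_last_max.
- by rewrite gsubst_iota // gsubst_id siota_var.
- exact: ez.
- by rewrite gsubst_iota // gsubst_id siota_var.
- rewrite (chomM cz) (chomC cz) (chomB cz) gsubst_last // gsubst_iota // gsubst_id addrK.
  by rewrite mulrA [sC _ * sC _]mulrC bb mul1r.
Qed.

Lemma splitting n (f : series k n) : ordge 2 f ->
  exists c (g : series k c), ordge 3 g /\ stab g f.
Proof.
elim: n f => [|n ih] f f2.
  exists 0%N, f; split; last exact: stab0.
  rewrite (_ : f = 0) //; apply: s0_inj0; rewrite rmorph0; apply/ordge1P/(ordgeW _ f2) => //.
have [f3|f3] := pselect (ordge 3 f); first by exists n.+1, f; split=> //; apply: stab0.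
have [f' f'2 r] := split_square f2 f3; have [c [g [g3 s]]] := ih f' f'2.
by exists c, g; split=> //; apply: stabS r s.
Qed.

End Split.

Section OneVariable.
Variable k : closedFieldType.
Hypothesis char0 : [pchar k] =i pred0.
Notation x := (@xl k 0).

Lemma x_adic (g : series k 1) : g != 0 -> exists m h, g = x ^+ m * h /\ s0 h != 0.
Proof.
move=> /slice_neq0[j [+ _]]; elim: j g => [|j ih] g hj.
  exists 0%N, g; rewrite expr0 mul1r; split=> //; apply: contra_neq hj => h.
  by apply: s0_inj0; rewrite s0_slice0 h rmorph0.
have [g0|g0] := eqVneq (slice 0 g) 0.
  have [|m [h [e h0]]] := ih (sshift g); first by rewrite slice_sshift.
  by exists m.+1, h; rewrite exprS -mulrA -e -slice0_xl.
exists 0%N, g; rewrite expr0 mul1r; split=> //; apply: contra_neq g0 => h.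
by apply: s0_inj0; rewrite s0_slice0 h rmorph0.
Qed.

(** Newton iteration for [(1 + q)^m = h] with the derivative frozen at its value [m] at 1; it
    contracts because the constant terms cancel. *)
Lemma root_of_unit n m (h : series k n) : (0 < m)%N -> s0 h = 1 -> exists2 q, ordge 1 q & (1 + q) ^+ m = h.
Proof.
move=> m0 h0; have mk : m%:R != 0 :> k by rewrite ((pcharf0P k).1 char0) -lt0n.
have im : sC m%:R^-1 * m%:R = 1 :> series k n by rewrite -(rmorph_nat (@sC k n)) mulrC sC_inv.
have [q q1|N p q p1 q1 pq|q q1 e] := @series_fix k n 1 (fun q => q + sC m%:R^-1 * (h - (1 + q) ^+ m)).
- apply: ordgeD => //; apply: ordgeMl; apply/ordge1P.
  by rewrite rmorphB rmorphXn rmorphD rmorph1 /= h0 ((ordge1P _).1 q1) addr0 expr1n subrr.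
- rewrite (_ : _ - _ = (p - q) - sC m%:R^-1 * ((1 + p) ^+ m - (1 + q) ^+ m)); last by ring.
  rewrite subrXX opprD addrACA subrr add0r.
  rewrite (_ : _ - _ = (p - q) * (1 - sC m%:R^-1 * \sum_(i < m) (1 + p) ^+ (m.-1 - i) * (1 + q) ^+ i)); last by ring.
  rewrite -addn1; apply: ordgeM => //; apply/ordge1P.
  rewrite rmorphB rmorphM rmorph_sum rmorph1 /= s0C (eq_bigr (fun=> 1)) => [|i _].
    by rewrite sumr_const card_ord mulVf ?subrr.
  by rewrite rmorphM !rmorphXn !rmorphD rmorph1 /= ((ordge1P _).1 p1) ((ordge1P _).1 q1) addr0 !expr1n mulr1.
exists q => //; apply/esym/eqP; rewrite -subr_eq0; move/eqP: e; rewrite -subr_eq0 addrC addKr.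
rewrite mulf_eq0 => /orP[/eqP h1|//]; move: im; rewrite h1 mul0r => /eqP.
by rewrite eq_sym oner_eq0.
Qed.

(** The unit [h] in [g = x^m h] has an [m]-th root: its constant part rescales [x], and the rest is
    absorbed by [x |-> x (1 + q)]. *)
Lemma one_var_normal (g : series k 1) : g != 0 -> ordge 3 g ->
  exists2 m, (2 < m)%N & req g (x ^+ m).
Proof.
move=> g0 g3; have [m [h [eg h0]]] := x_adic g0.
have m3 : (2 < m)%N.
  rewrite leqNgt ltnS; apply/negP => hm; case/eqP: h0.
  have /ordge_slice/(_ m) := g3; rewrite eg slice_xlXM ltnn subnn -s0_slice0.
  by move=> H; apply/ordge1P; apply: ordgeW H; rewrite subn_gt0 ltnS.
exists m => //; have m0 : (0 < m)%N by apply: leq_trans m3.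
have [r hr] := closed_root (s0 h) m0.
have r0 : r != 0 by apply: contra_neq h0 => r0; rewrite -hr r0 expr0n eqn0Ngt m0.
have [|q q1 hq] := @root_of_unit 1 m (sC (s0 h)^-1 * h) m0.
  by rewrite rmorphM /= s0C mulVf.
have x1 : ordge 1 x by exact: ordge_xl.
have sx i : svar k i = x by rewrite /xl; congr svar; apply: val_inj; rewrite (ord1 i).
have H (p : series k 1) (i : 'I_1) : ordge 1 p -> gsubst (fun=> p) x = p by move=> hp; rewrite gsubst_var.
have o (a : k) : ordge 1 (sC a * x) by apply: ordgeMl.
have xq1 : ordge 1 (x * (1 + q)) by apply: ordgeMr.
apply: (@req_trans _ _ ((sC r * x) ^+ m)).
  exists (fun=> x * (1 + q)); split.
    apply: cchange_id => i; rewrite sx mulrDr mulr1 addrC addKr.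
    exact: (ordgeM (M := 1) (N := 1)).
  have c := gsubst_chom (fun=> xq1) : chom (gsubst (fun _ : 'I_1 => x * (1 + q))).
  rewrite (chomX c) (chomM c) (chomC c) (H _ ord0) // !exprMn hq -rmorphXn /= hr eg.
  rewrite -[LHS]mul1r -(@sC_inv k 1 (s0 h) h0); ring.
exists (fun=> sC r * x); split.
  apply: (@cchange_of_inv _ _ _ (fun=> sC r^-1 * x)) => // i.
    have c := gsubst_chom (fun=> o r) : chom (gsubst (fun _ : 'I_1 => sC r * x)).
    by rewrite (chomM c) (chomC c) (H _ ord0) // mulrA [sC _ * sC _]mulrC sC_inv // mul1r sx.
  have c := gsubst_chom (fun=> o r^-1) : chom (gsubst (fun _ : 'I_1 => sC r^-1 * x)).
  by rewrite (chomM c) (chomC c) (H _ ord0) // mulrA sC_inv // mul1r sx.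
have c := gsubst_chom (fun=> o r) : chom (gsubst (fun _ : 'I_1 => sC r * x)).
by rewrite (chomX c) (H _ ord0).
Qed.

End OneVariable.

(** * Infinite families in one variable *)

Section Pad.
Variables (R : comNzRingType) (e : nat) (f : R) (p : nat).
Notation d := e.+1.
Implicit Type l : seq 'M[R]_p.

Lemma pad_prod l m : (size l <= m)%N -> \prod_(i < m) nth 1%:M l i = \prod_(M <- l) M :> 'M_p.
Proof.
elim: l m => [|M l ih] m; first by move=> _; rewrite big_nil big1 // => i _; rewrite nth_nil.
by case: m => // m /ih h; rewrite big_ord_recl big_cons /= -h.
Qed.

Lemma padP l : (size l <= d)%N -> \prod_(M <- l) M = f%:M :> 'M_p -> \prod_(i < d) nth 1%:M l i = f%:M :> 'M_p.
Proof. by move=> /pad_prod->. Qed.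

(** Identity factors let a family built with few factors serve every larger [d]. *)
Definition pad l (sl : (size l <= d)%N) (pl : \prod_(M <- l) M = f%:M) : dmf d f := Dmf (padP sl pl).

Lemma pad_iso l l' sl sl' pl pl' : diso (@pad l sl pl) (@pad l' sl' pl') ->
  exists al be : nat -> 'M[R]_p,
  [/\ forall i, (i < e)%N -> al i *m nth 1%:M l i = nth 1%:M l' i *m al i.+1,
      forall i, (i < e)%N -> be i *m nth 1%:M l' i = nth 1%:M l i *m be i.+1,
      forall i, be i *m al i = 1%:M & forall i, al i *m be i = 1%:M].
Proof.
move=> [al [be [h1 h2 h3 h4]]]; exists (fun i => al (inord i)), (fun i => be (inord i)).
have E i : (i < e)%N -> ordS (inord i : 'I_d) = inord i.+1.
  move=> hi; apply: val_inj; rewrite /= !inordK ?modn_small ?ltnS //; exact: ltnW.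
by split=> // i hi; [have := h1 (inord i)|have := h2 (inord i)];
  rewrite E //= inordK // ltnS ltnW.
Qed.

End Pad.

Section Small.
Variable R : comNzRingType.

Definition mxl n (s : seq (seq R)) : 'M[R]_n := \matrix_(i, j) nth 0 (nth [::] s i) j.
Definition mx2 a b c d := mxl 2 [:: [:: a; b]; [:: c; d]].
Definition mx3 a b c d e f g h i := mxl 3 [:: [:: a; b; c]; [:: d; e; f]; [:: g; h; i]].

Lemma mx2_ex (M : 'M[R]_2) : exists a b c d, M = mx2 a b c d.
Proof.
exists (M 0 0), (M 0 1), (M 1 0), (M 1 1); apply/matrixP => i j; rewrite mxE.
by case: i => [[|[|//]] hi]; case: j => [[|[|//]] hj] /=; congr (M _ _); apply: val_inj.
Qed.
Lemma mx3_ex (M : 'M[R]_3) : exists a b c d e f g h i, M = mx3 a b c d e f g h i.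
Proof.
pose o n : 'I_3 := inord n.
exists (M (o 0) (o 0)), (M (o 0) (o 1)), (M (o 0) (o 2)).
exists (M (o 1) (o 0)), (M (o 1) (o 1)), (M (o 1) (o 2)).
exists (M (o 2) (o 0)), (M (o 2) (o 1)), (M (o 2) (o 2)).
apply/matrixP => i j; rewrite mxE.
by case: i => [[|[|[|//]]] hi]; case: j => [[|[|[|//]]] hj] /=; congr (M _ _); apply: val_inj;
  rewrite /= inordK.
Qed.
Lemma mx2_inj a b c d a' b' c' d' : mx2 a b c d = mx2 a' b' c' d' ->
  [/\ a = a', b = b', c = c' & d = d'].
Proof.
move/matrixP => h.
by split; [have := h 0 0|have := h 0 1|have := h 1 0|have := h 1 1]; rewrite !mxE.
Qed.
Lemma mx3_inj a b c d e f g h i a' b' c' d' e' f' g' h' i' :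
  mx3 a b c d e f g h i = mx3 a' b' c' d' e' f' g' h' i' ->
  [/\ [/\ a = a', b = b' & c = c'], [/\ d = d', e = e' & f = f'] & [/\ g = g', h = h' & i = i']].
Proof.
move/matrixP => H; pose o n : 'I_3 := inord n.
have E u v : (u < 3)%N -> (v < 3)%N -> nth 0 (nth [::] [:: [:: a; b; c]; [:: d; e; f]; [:: g; h; i]] u) v =
  nth 0 (nth [::] [:: [:: a'; b'; c']; [:: d'; e'; f']; [:: g'; h'; i']] u) v.
  by move=> hu hv; have := H (o u) (o v); rewrite !mxE !inordK.
by split; split; [exact: (E 0%N 0%N)|exact: (E 0%N 1%N)|exact: (E 0%N 2%N)
  |exact: (E 1%N 0%N)|exact: (E 1%N 1%N)|exact: (E 1%N 2%N)
  |exact: (E 2%N 0%N)|exact: (E 2%N 1%N)|exact: (E 2%N 2%N)].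
Qed.
Lemma mx2M a b c d a' b' c' d' : mx2 a b c d *m mx2 a' b' c' d' =
  mx2 (a * a' + b * c') (a * b' + b * d') (c * a' + d * c') (c * b' + d * d').
Proof.
apply/matrixP => i j; rewrite !mxE !big_ord_recl big_ord0 !mxE addr0.
by case: i => [[|[|//]] hi]; case: j => [[|[|//]] hj].
Qed.
Lemma mx3M a b c d e f g h i a' b' c' d' e' f' g' h' i' :
  mx3 a b c d e f g h i *m mx3 a' b' c' d' e' f' g' h' i' =
  mx3 (a * a' + b * d' + c * g') (a * b' + b * e' + c * h') (a * c' + b * f' + c * i')
      (d * a' + e * d' + f * g') (d * b' + e * e' + f * h') (d * c' + e * f' + f * i')
      (g * a' + h * d' + i * g') (g * b' + h * e' + i * h') (g * c' + h * f' + i * i').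
Proof.
apply/matrixP => r s; rewrite !mxE !big_ord_recl big_ord0 !mxE addr0 !addrA.
by case: r => [[|[|[|//]]] hr]; case: s => [[|[|[|//]]] hs].
Qed.
Lemma mx2Z k a b c d : k *: mx2 a b c d = mx2 (k * a) (k * b) (k * c) (k * d).
Proof.
by apply/matrixP => -[[|[|//]] hi] -[[|[|//]] hj]; rewrite !mxE.
Qed.
Lemma mx3Z k a b c d e f g h i : k *: mx3 a b c d e f g h i =
  mx3 (k * a) (k * b) (k * c) (k * d) (k * e) (k * f) (k * g) (k * h) (k * i).
Proof.
by apply/matrixP => -[[|[|[|//]]] hi] -[[|[|[|//]]] hj]; rewrite !mxE.
Qed.
Lemma mx2_scal a : mx2 a 0 0 a = a%:M.
Proof.
by apply/matrixP => -[[|[|//]] hi] -[[|[|//]] hj]; rewrite !mxE.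
Qed.
Lemma mx3_scal a : mx3 a 0 0 0 a 0 0 0 a = a%:M.
Proof.
by apply/matrixP => -[[|[|[|//]]] hi] -[[|[|[|//]]] hj]; rewrite !mxE.
Qed.
End Small.

Section Families.
Variable k : fieldType.
Hypothesis char0 : [pchar k] =i pred0.

Lemma xl_pow_eq n t t' (c : series k n.+1) : (t < t')%N -> @xl k n ^+ t <> @xl k n ^+ t' * c.
Proof.
move=> /subnK <-; rewrite addnS -addSn exprD mulrAC => /eqP.
rewrite eq_sym -[X in _ == X]mul1r => /eqP /mulIf; rewrite expf_neq0 ?x_neq0 // => /(_ isT).
move/(congr1 (@s0 k n.+1)); rewrite rmorph1 !rmorphM rmorphXn /= ((ordge1P _).1 (@ordge_xl k n)).
by rewrite exprS !mul0r => /eqP; rewrite eq_sym oner_eq0.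
Qed.

(** An isomorphism gives [M t = be * M t' * al]; at [x = 0] the upper right entry makes [y^t] a
    multiple of [y^t'] with [t < t']. *)
Lemma x2_infinite n e : ~ fint e.+2 (sext (0 : series k n.+1)).
Proof.
pose x := @xl k n.+1; pose y : series k n.+2 := siota (@xl k n).
pose M t := mx2 x (y ^+ t) 0 (- x).
have MM t : \prod_(N <- [:: M t; M t]) N = (sext 0)%:M :> 'M_2.
  rewrite !big_cons big_nil mulr1 -[_ * _]/(M t *m M t) mx2M -mx2_scal /sext rmorph0 -/x.
  by congr mx2; ring.
pose X t : dmf e.+2 (sext 0) := @pad _ e.+1 _ 2 [:: M t; M t] isT (MM t).
move=> /(fint_pigeon char0 (ltn0Sn _) (p := 2) (X := X))[//|t [t' [ltt /pad_iso[al [be [h1 _ h3 _]]]]]].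
have {}h1 : M t = be 0%N *m (M t' *m al 1%N) by rewrite -(h1 0%N) //= mulmxA h3 mul1mx.
move: h1; have [a [b [c [d ->]]]] := mx2_ex (be 0%N); have [a' [b' [c' [d' ->]]]] := mx2_ex (al 1%N).
rewrite !mx2M => /mx2_inj[_ /(congr1 (slice 0)) E _ _].
apply: (@xl_pow_eq n t t' (slice 0 a * slice 0 d')) => //.
move: E; rewrite !rmorphD !rmorphM /= !rmorphD !rmorphM !rmorphN !rmorphXn /= /x /y slice0_iota slice_xl rmorph0 /= => ->.
ring.
Qed.

Notation S := (series k 1).
Notation y := (@xl k 0 : S).

Lemma s0_xl n : s0 (@xl k n) = 0. Proof. exact/ordge1P/ordge_xl. Qed.

Lemma xmul_eq n (a b : series k n.+1) c : @xl k n * a = @xl k n * b + @xl k n ^+ 2 * c -> s0 a = s0 b.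
Proof.
rewrite expr2 -mulrA -mulrDr => /xlM_inj ->.
by rewrite rmorphD rmorphM /= s0_xl mul0r addr0.
Qed.

(** The four factors are [y L_i^-1 L_(i+1)], up to [h], for the lattices in [k((y))^2] of vectors
    whose residue lies in the line of slope infinity, 0, 1 and [mu]. An isomorphism fixes the first
    three lines, so its residue is scalar, and it carries the slope [t] to [t']. *)
Lemma y4_infinite e (h : S) : y ^+ 4 * h != 0 -> ~ fint e.+4 (y ^+ 4 * h).
Proof.
move=> f0.
pose l (mu : S) := [:: mx2 0 (y ^+ 2) 1 0; mx2 y 0 1 y; mx2 y 0 (mu - 1) y;
   h *: mx2 0 (y ^+ 2) 1 (- mu * y)].
have ml mu : \prod_(M <- l mu) M = (y ^+ 4 * h)%:M :> 'M_2.
  rewrite !big_cons big_nil mulr1 mx2Z -![_ * _]/(_ *m _) !mx2M -mx2_scal.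
  by congr mx2; ring.
pose X t : dmf e.+4 (y ^+ 4 * h) := @pad _ e.+3 _ 2 (l t%:R) isT (ml _).
move=> /(fint_pigeon char0 (ltn0Sn _) (p := 2) (X := X))[//|t [t' [ltt /pad_iso[al [be [h1 _ h3 h4]]]]]].
have := h1 0%N isT; have := h1 1%N isT; have := h1 2%N isT.
have := h4 0%N; rewrite /=.
have [a0 [b0 [c0 [d0 ->]]]] := mx2_ex (al 0%N); have [a1 [b1 [c1 [d1 ->]]]] := mx2_ex (al 1%N).
have [a2 [b2 [c2 [d2 ->]]]] := mx2_ex (al 2%N); have [a3 [b3 [c3 [d3 ->]]]] := mx2_ex (al 3%N).
have [p [q [r [s ->]]]] := mx2_ex (be 0%N).
rewrite !mx2M -mx2_scal => /mx2_inj[I1 _ _ _] /mx2_inj[E1 _ E3 _] /mx2_inj[F1 F2 F3 F4] /mx2_inj[G1 G2 G3 G4].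
have y2 : y ^+ 2 != 0 by rewrite expf_neq0 ?x_neq0.
have a0E : a0 = d1 by apply: (mulfI y2); move: G2; rewrite mul0r mulr0 addr0 add0r mulrC.
have b1E : b1 = y ^+ 2 * c0 by rewrite mulrC; move: G4; rewrite mulr0 addr0 mul1r mul0r addr0.
have b2E : b2 = y ^+ 2 * c0.
  by rewrite -b1E; apply: (mulfI (@x_neq0 k 0)); rewrite -[LHS]addr0 -(mul0r d2) -F2; ring.
have e1 : s0 a2 = s0 a1.
  by apply: (@xmul_eq _ _ _ c0); rewrite -b1E -[LHS]addr0 -(mul0r c2) -F1; ring.
have e2 : s0 d1 = s0 d2.
  by apply: (@xmul_eq _ _ _ c0); rewrite -b2E -[LHS]add0r -(mulr0 c1) [y * _]mulrC F4; ring.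
have e3 : s0 a2 = s0 a3.
  apply: (@xmul_eq _ _ _ (- c0 * (t%:R - 1))); rewrite -[y * a3]addr0 -(mul0r c3) -E1 b2E; ring.
have e4 : s0 d1 = s0 a2.
  move/(congr1 (@s0 k 1)): F3; rewrite !rmorphD !rmorphM rmorph1 /= s0_xl.
  by rewrite !(mulr0, mul0r, mul1r, mulr1, add0r, addr0).
have e5 : s0 d2 * (t%:R - 1) = s0 a3 * (t'%:R - 1).
  move/(congr1 (@s0 k 1)): E3; rewrite !rmorphD !rmorphM !rmorphB !rmorph_nat rmorph1 /= s0_xl.
  by rewrite !(mulr0, mul0r, add0r, addr0) [X in _ = X]mulrC.
have A0 : s0 d1 != 0.
  apply/eqP => z; move/(congr1 (@s0 k 1)): I1; rewrite rmorph1 rmorphD !rmorphM /= a0E z mul0r add0r.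
  have -> : b0 = y ^+ 2 * c1 by rewrite -[LHS]add0r -(mulr0 a0) -[b0]mulr1 G1 mul0r add0r.
  rewrite rmorphM rmorphXn /= s0_xl expr0n !mul0r => /eqP.
  by rewrite eq_sym oner_eq0.
move: e5; rewrite -e2 -e3 -e4 => /(mulfI A0) /addIr h0.
have /(natr_inj_series char0) e6 : t%:R = t'%:R :> S by rewrite -!(rmorph_nat (@sC k 1)) h0.
by rewrite e6 ltnn in ltt.
Qed.

End Families.

(* With [C i] the lattices whose chain of inclusions is the factorization,
   an isomorphism is multiplication by one fixed matrix [G / z]. *)
Lemma lattice_iso (R : idomainType) p e (C C' phi phi' al : nat -> 'M[R]_p) D0 z (w : nat -> R) :
  D0 *m C 0%N = z%:M -> (forall i, w i != 0) ->
  (forall i, (i < e)%N -> C i *m phi i = w i *: C i.+1) ->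
  (forall i, (i < e)%N -> C' i *m phi' i = w i *: C' i.+1) ->
  (forall i, (i < e)%N -> al i *m phi i = phi' i *m al i.+1) ->
  forall i, (i <= e)%N -> C' 0%N *m al 0%N *m D0 *m C i = z *: (C' i *m al i).
Proof.
move=> D0C w0 h h' ha; elim=> [|i ih] hi.
  by rewrite -[_ *m D0 *m _]mulmxA D0C mul_mx_scalar.
have := congr1 (mulmxr (phi i)) (ih (ltnW hi)); rewrite /= -[LHS]mulmxA h // -scalemxAr.
rewrite -scalemxAl -[C' i *m _ *m _]mulmxA ha // mulmxA h' // -scalemxAl scalerA mulrC -scalerA => /matrixP E.
by apply/matrixP => r s; have := E r s; rewrite mxE [RHS]mxE => /(mulfI (w0 i)).
Qed.

Lemma mulmx_inv_scal (R : comNzRingType) p (A B D : 'M[R]_p) z : A *m B = z%:M -> A *m (B *m D) = z *: D.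
Proof. by move=> h; rewrite mulmxA h mul_scalar_mx. Qed.

Lemma six_prod (R : comNzRingType) p (J Qa Pa Pb Qb Pc Qc : 'M[R]_p) z h :
  (Pb *m J) *m Qb = z%:M -> (Pc *m J) *m Qc = z%:M -> (J *m Qa) *m Pa = z%:M ->
  \prod_(M <- [:: J; Qa *m Pb; J; Qb *m Pc; J; h *: (Qc *m Pa)]) M = (h * z ^+ 3)%:M :> 'M_p.
Proof.
move=> hb hc ha.
transitivity (J *m ((Qa *m Pb) *m (J *m ((Qb *m Pc) *m (J *m (h *: (Qc *m Pa))))))).
  by rewrite !big_cons big_nil mulr1.
rewrite -!scalemxAr -[Qb *m Pc *m _]mulmxA [Pc *m (J *m _)]mulmxA (mulmx_inv_scal _ hc) -!scalemxAr.
rewrite -[Qa *m Pb *m _]mulmxA [Pb *m (J *m _)]mulmxA (mulmx_inv_scal _ hb) -!scalemxAr.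
by rewrite [J *m _]mulmxA ha !scale_scalar_mx !exprS expr0 mulr1.
Qed.

(** Closes an equation whose two sides have the same difference as those of [E], up to ring
    identities. *)
Ltac lincomb E := let h := fresh in have h := E; match type of h with ?L = ?R =>
  apply: subr0_eq; refine (eq_trans (_ : _ = L - R) _); [ring|by rewrite -h subrr] end.

Section Flags.
Variable k : fieldType.
Hypothesis char0 : [pchar k] =i pred0.
Notation S := (series k 1).
Notation y := (@xl k 0 : S).

Lemma ymod j (a b c : S) : y ^+ j * a = y ^+ j * b + y ^+ j.+1 * c -> s0 a = s0 b.
Proof.
rewrite exprSr -mulrA -mulrDr => /mulfI; rewrite expf_neq0 ?x_neq0 // => /(_ isT) ->.
by rewrite rmorphD rmorphM /= s0_xl mul0r addr0.
Qed.

Lemma y0_unit_row (a b c p q r : S) : a * p + b * q + c * r = 1 -> s0 b = 0 -> s0 c = 0 -> s0 a != 0.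
Proof.
move=> /(congr1 (@s0 k 1)) E hb hc; apply/eqP => ha; move/eqP: E.
by rewrite !rmorphD !rmorphM rmorph1 /= ha hb hc !mul0r !addr0 eq_sym oner_eq0.
Qed.

(** [Fa], [Fb], [Fc] span the lattices [l + yP + y^2 k[[y]]^3] of three flags of a line [l] in a
    plane [P]: [e1] in [<e1, e2 + e3>], [e2] in [<e2, e1 + e3>], [e3] in [<e3, e1 + la e2>]. Each
    [G] is [y^2] times the inverse of the corresponding [F]. *)
Definition Fa := mx3 1 0 0 0 y 0 0 y (y ^+ 2).
Definition Ga := mx3 (y ^+ 2) 0 0 0 y 0 0 (- 1) 1.
Definition Fb := mx3 0 y (y ^+ 2) 1 0 0 0 y 0.
Definition Gb := mx3 0 (y ^+ 2) 0 0 0 y 1 0 (- 1).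
Definition Fc (la : S) := mx3 0 y 0 0 (la * y) (y ^+ 2) 1 0 0.
Definition Gc (la : S) := mx3 0 0 (y ^+ 2) y 0 0 (- la) 1 0.

(** Preserving the three lines makes the comparison matrix diagonal modulo [y]. The first two planes
    equate its diagonal entries, and the third then carries [la = t] to [t']: the modulus is the
    triple ratio of the flags. *)
Lemma y6_infinite e (h : S) : y ^+ 6 * h != 0 -> ~ fint e.+3 (y ^+ 6 * h).
Proof.
move=> f0.
pose l la := [:: Gc la *m Fb; Gb *m Fa; h *: (Ga *m Fc la)].
have FG : [/\ Fa *m Ga = (y ^+ 2)%:M, Fb *m Gb = (y ^+ 2)%:M, (forall la, Fc la *m Gc la = (y ^+ 2)%:M)
    & forall la, Gc la *m Fc la = (y ^+ 2)%:M].
  by split=> [||la|la]; rewrite mx3M -mx3_scal; congr mx3; ring.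
case: FG => FGa FGb FGc GFc.
have ml la : \prod_(M <- l la) M = (y ^+ 6 * h)%:M :> 'M_3.
  transitivity ((Gc la *m Fb) *m ((Gb *m Fa) *m (h *: (Ga *m Fc la)))).
    by rewrite !big_cons big_nil mulr1.
  by rewrite !mx3M mx3Z !mx3M -mx3_scal; congr mx3; ring.
pose X t : dmf e.+3 (y ^+ 6 * h) := @pad _ e.+2 _ 3 (l t%:R) isT (ml _).
move=> /(fint_pigeon char0 (ltn0Sn _) (p := 3) (X := X))[//|t [t' [ltt /pad_iso[al [be [h1 _ _ h4]]]]]].
pose C la i : 'M_3 := nth 0 [:: Fc la; Fb; Fa] i.
have hC la i : (i < 2)%N -> C la i *m nth 1%:M (l la) i = y ^+ 2 *: C la i.+1.
  by case: i => [|[|//]] _; rewrite /= mulmxA ?FGc ?FGb mul_scalar_mx.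
have y20 : y ^+ 2 != 0 by rewrite expf_neq0 ?x_neq0.
have H := @lattice_iso _ 3 2 (C t%:R) (C t'%:R) _ _ al (Gc t%:R) (y ^+ 2) (fun=> y ^+ 2)
   (GFc _) (fun=> y20) (hC _) (hC _) (fun i hi => h1 i (leq_trans hi (isT : (1 < e.+2)%N))).
move: {H}(C t'%:R 0%N *m al 0%N *m Gc t%:R) H => G H.
have := h4 2%N; have := H 2%N isT; have := H 1%N isT; have := H 0%N isT; rewrite /C /= /Fa /Fb /Fc.
have [c11 [c12 [c13 [c21 [c22 [c23 [c31 [c32 [c33 ->]]]]]]]]] := mx3_ex (al 0%N).
have [b11 [b12 [b13 [b21 [b22 [b23 [b31 [b32 [b33 ->]]]]]]]]] := mx3_ex (al 1%N).
have [a11 [a12 [a13 [a21 [a22 [a23 [a31 [a32 [a33 ->]]]]]]]]] := mx3_ex (al 2%N).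
have [p11 [p12 [p13 [p21 [p22 [p23 [p31 [p32 [p33 ->]]]]]]]]] := mx3_ex (be 2%N).
have [G11 [G12 [G13 [G21 [G22 [G23 [G31 [G32 [G33 ->]]]]]]]]] := mx3_ex G.
rewrite !mx3M !mx3Z -mx3_scal.
case/mx3_inj=> -[K11 K12 _] [K21 K22 _] [K31 _ _].
case/mx3_inj=> -[M11 M12 _] [M21 _ _] [M31 M32 _].
case/mx3_inj=> -[N11 N12 N13] [N21 N22 _] [N31 N32 _].
case/mx3_inj=> -[I1 _ _] _ _.
(* The lines: each lattice has a basis vector [e_i] among its columns, so the columns of [G / y^2]
   can be read off; off the diagonal they vanish modulo [y]. *)
have e11 : G11 = y ^+ 2 * a11 by lincomb N11.
have e21 : G21 = y ^+ 2 * (y * a21) by lincomb N21.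
have e31 : G31 = y ^+ 2 * (y * a21 + y ^+ 2 * a31) by lincomb N31.
have e12 : G12 = y ^+ 2 * (y * b21 + y ^+ 2 * b31) by lincomb M11.
have e22 : G22 = y ^+ 2 * b11 by lincomb M21.
have e32 : G32 = y ^+ 2 * (y * b21) by lincomb M31.
have e13 : G13 = y ^+ 2 * (y * c21) by lincomb K11.
have e23 : G23 = y ^+ 2 * (t'%:R * y * c21 + y ^+ 2 * c31) by lincomb K21.
have e33 : G33 = y ^+ 2 * c11 by lincomb K31.
subst G11 G21 G31 G12 G22 G32 G13 G23 G33.
(* The planes: the coefficients of [y^3] compare the diagonal entries. *)
have s1 : s0 b11 = s0 a22 by apply: (@ymod 3 _ _ (- (t'%:R * c21 + y * c31))); lincomb N22.
have s2 : s0 c11 = s0 a22 by apply: (@ymod 3 _ _ (a32 - b21)); lincomb N32.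
have s3 : s0 a11 = s0 b22 by apply: (@ymod 3 _ _ (b32 - c21)); lincomb M12.
have s4 : s0 c11 = s0 b22 by apply: (@ymod 3 _ _ (- a21 - y * a31)); lincomb M32.
have s5 : s0 (t%:R * b11) = s0 (t'%:R * c22).
  by apply: (@ymod 3 _ _ (c32 - a21)); lincomb K22.
have s6 : s0 a11 = s0 c22.
  by apply: (@ymod 3 _ _ (- t%:R * (b21 + y * b31))); lincomb K12.
have a0 : s0 a11 != 0.
  apply: (y0_unit_row I1).
    by rewrite -[RHS](@rmorph0 _ _ (@s0 k 1)); apply: (@ymod 2 _ _ (y * (b21 + y * b31 + c21))); lincomb (esym N12).
  by rewrite -[RHS](@rmorph0 _ _ (@s0 k 1)); apply: (@ymod 2 _ _ (y ^+ 2 * c21)); lincomb (esym N13).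
move: s5; rewrite !rmorphM !rmorph_nat /= s1 -s2 s4 -s3 -s6 => /(mulIf a0) h0.
have /(natr_inj_series char0) e6 : t%:R = t'%:R :> S by rewrite -!(rmorph_nat (@sC k 1)) h0.
by rewrite e6 ltnn in ltt.
Qed.

(** The same three flags: [Pa], [Pb], [Pc] span the lattices of the planes, and multiplying by [J]
    shrinks each to the lattice of its line. A flag now uses two factors but only one power of
    [y]. *)
Definition J := mx3 1 0 0 0 y 0 0 0 1.
Definition Pa := mx3 1 0 0 0 1 0 0 1 y.
Definition Qa := mx3 y 0 0 0 1 0 0 (- 1) 1.
Definition Pb := mx3 0 1 y 1 0 0 0 1 0.
Definition Qb := mx3 0 y 0 0 0 1 1 0 (- 1).
Definition Pc (la : S) := mx3 0 1 0 0 la y 1 0 0.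
Definition Qc (la : S) := mx3 0 0 y 1 0 0 (- la) 1 0.

(** As in [y6_infinite], along the chain plane, line, plane, line, plane, line; the weights [w]
    alternate between 1 for an inclusion and [y] for a passage to the next flag. *)
Lemma y3_infinite e (h : S) : y ^+ 3 * h != 0 -> ~ fint e.+4.+2 (y ^+ 3 * h).
Proof.
move=> f0.
pose l la := [:: J; Qa *m Pb; J; Qb *m Pc la; J; h *: (Qc la *m Pa)].
have PQ : [/\ (Pa *m J) *m Qa = y%:M, (Pb *m J) *m Qb = y%:M,
    (forall la, (Pc la *m J) *m Qc la = y%:M) & (J *m Qa) *m Pa = y%:M].
  by split=> [||la|]; rewrite !mx3M -mx3_scal; congr mx3; ring.
case: PQ => PQa PQb PQc QPa.
have ml la : \prod_(M <- l la) M = (y ^+ 3 * h)%:M :> 'M_3.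
  rewrite (six_prod _ PQb (PQc la) QPa) //; congr _%:M; ring.
pose X t : dmf e.+4.+2 (y ^+ 3 * h) := @pad _ e.+4.+1 _ 3 (l t%:R) isT (ml _).
move=> /(fint_pigeon char0 (ltn0Sn _) (p := 3) (X := X))[//|t [t' [ltt /pad_iso[al [be [h1 _ _ h4]]]]]].
pose C la i : 'M_3 := nth 0 [:: Pa; Pa *m J; Pb; Pb *m J; Pc la; Pc la *m J] i.
pose w i : S := if odd i then y else 1.
have hC la i : (i < 5)%N -> C la i *m nth 1%:M (l la) i = w i *: C la i.+1.
  case: i => [|[|[|[|[|//]]]]] _;
    [exact/esym/scale1r|exact: mulmx_inv_scal PQa|exact/esym/scale1r|exact: mulmx_inv_scal PQb|exact/esym/scale1r].
have w0 i : w i != 0 by rewrite /w; case: ifP; rewrite ?x_neq0 ?oner_neq0.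
have H := @lattice_iso _ 3 5 (C t%:R) (C t'%:R) _ _ al (J *m Qa) y w
   QPa w0 (hC _) (hC _) (fun i hi => h1 i (leq_trans hi (isT : (4 < e.+4.+1)%N))).
move: {H}(C t'%:R 0%N *m al 0%N *m (J *m Qa)) H => G H.
have := h4 1%N; have := H 0%N isT; have := H 1%N isT; have := H 2%N isT.
have := H 3%N isT; have := H 4%N isT; have := H 5%N isT; rewrite /C /= /Pa /Pb /Pc /J.
have [a11 [a12 [a13 [a21 [a22 [a23 [a31 [a32 [a33 ->]]]]]]]]] := mx3_ex (al 0%N).
have [u11 [u12 [u13 [u21 [u22 [u23 [u31 [u32 [u33 ->]]]]]]]]] := mx3_ex (al 1%N).
have [b11 [b12 [b13 [b21 [b22 [b23 [b31 [b32 [b33 ->]]]]]]]]] := mx3_ex (al 2%N).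
have [v11 [v12 [v13 [v21 [v22 [v23 [v31 [v32 [v33 ->]]]]]]]]] := mx3_ex (al 3%N).
have [c11 [c12 [c13 [c21 [c22 [c23 [c31 [c32 [c33 ->]]]]]]]]] := mx3_ex (al 4%N).
have [w11 [w12 [w13 [w21 [w22 [w23 [w31 [w32 [w33 ->]]]]]]]]] := mx3_ex (al 5%N).
have [p11 [p12 [p13 [p21 [p22 [p23 [p31 [p32 [p33 ->]]]]]]]]] := mx3_ex (be 1%N).
have [G11 [G12 [G13 [G21 [G22 [G23 [G31 [G32 [G33 ->]]]]]]]]] := mx3_ex G.
rewrite !mx3M !mx3Z -mx3_scal.
case/mx3_inj=> -[W11 _ _] [W21 _ _] [W31 _ _].
case/mx3_inj=> -[_ K12 _] [_ K22 _] _.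
case/mx3_inj=> -[V11 _ _] [V21 _ _] [V31 _ _].
case/mx3_inj=> -[_ M12 _] _ [_ M32 _].
case/mx3_inj=> -[U11 U12 U13] [U21 _ _] [U31 _ _].
case/mx3_inj=> _ [_ N22 _] [_ N32 _].
case/mx3_inj=> -[I1 _ _] _ _.
have e11 : G11 = y * u11 by lincomb U11.
have e21 : G21 = y ^+ 2 * u21 by lincomb U21.
have e31 : G31 = y ^+ 2 * (u21 + u31) by lincomb U31.
have e12 : G12 = y ^+ 2 * (v21 + v31) by lincomb V11.
have e22 : G22 = y * v11 by lincomb V21.
have e32 : G32 = y ^+ 2 * v21 by lincomb V31.
have e13 : G13 = y ^+ 2 * w21 by lincomb W11.
have e23 : G23 = y ^+ 2 * (t'%:R * w21 + w31) by lincomb W21.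
have e33 : G33 = y * w11 by lincomb W31.
subst G11 G21 G31 G12 G22 G32 G13 G23 G33.
have s1 : s0 v11 = s0 a22 by apply: (@ymod 1 _ _ (- (t'%:R * w21 + w31))); lincomb N22.
have s2 : s0 w11 = s0 a22 by apply: (@ymod 1 _ _ (a32 - v21)); lincomb N32.
have s3 : s0 u11 = s0 b22 by apply: (@ymod 1 _ _ (b32 - w21)); lincomb M12.
have s4 : s0 w11 = s0 b22 by apply: (@ymod 1 _ _ (- (u21 + u31))); lincomb M32.
have s5 : s0 (t%:R * v11) = s0 (t'%:R * c22) by apply: (@ymod 1 _ _ (c32 - u21)); lincomb K22.
have s6 : s0 u11 = s0 c22 by apply: (@ymod 1 _ _ (- t%:R * (v21 + v31))); lincomb K12.
have a0 : s0 u11 != 0.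
  apply: (y0_unit_row I1).
    by rewrite -[RHS](@rmorph0 _ _ (@s0 k 1)); apply: (@ymod 1 _ _ (y * (v21 + v31 + w21))); lincomb (esym U12).
  by rewrite -[RHS](@rmorph0 _ _ (@s0 k 1)); apply: (@ymod 1 _ _ (y * w21)); lincomb (esym U13).
move: s5; rewrite !rmorphM !rmorph_nat /= s1 -s2 s4 -s3 -s6 => /(mulIf a0) h0.
have /(natr_inj_series char0) e6 : t%:R = t'%:R :> S by rewrite -!(rmorph_nat (@sC k 1)) h0.
by rewrite e6 ltnn in ltt.
Qed.

End Flags.

(** * Series of order 3 in several variables *)

Lemma prod3 (R : comNzRingType) p (A B C : 'M[R]_p) : \prod_(M <- [:: A; B; C]) M = A *m B *m C.
Proof. by rewrite !big_cons big_nil mulr1 -mulmxA. Qed.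

Lemma mor_comp2 (R : comNzRingType) p (a0 a1 a2 X0 X1 Y0 Y1 : 'M[R]_p) :
  a0 *m X0 = Y0 *m a1 -> a1 *m X1 = Y1 *m a2 -> a0 *m (X0 *m X1) = Y0 *m Y1 *m a2.
Proof. by move=> h h'; rewrite mulmxA h -mulmxA h' mulmxA. Qed.

Lemma addr_shift (V : zmodType) (a b c d e : V) : a + b = c + (d + e) -> a - e = c + d - b.
Proof. by move=> h; rewrite -[a](addrK b) h addrA [LHS]addrAC addrK. Qed.

Section Block3.
Variables (R : comNzRingType) (q : nat).
Implicit Types a b c d e f g h i : 'M[R]_q.

Definition bl3 a b c d e f g h i : 'M[R]_(q + (q + q)) :=
  block_mx a (row_mx b c) (col_mx d g) (block_mx e f h i).

Lemma bl3M a b c d e f g h i a' b' c' d' e' f' g' h' i' :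
  bl3 a b c d e f g h i *m bl3 a' b' c' d' e' f' g' h' i' =
  bl3 (a *m a' + (b *m d' + c *m g')) (a *m b' + (b *m e' + c *m h')) (a *m c' + (b *m f' + c *m i'))
      (d *m a' + (e *m d' + f *m g')) (d *m b' + (e *m e' + f *m h')) (d *m c' + (e *m f' + f *m i'))
      (g *m a' + (h *m d' + i *m g')) (g *m b' + (h *m e' + i *m h')) (g *m c' + (h *m f' + i *m i')).
Proof.
rewrite /bl3 mulmx_block mul_row_col mul_mx_row mul_row_block add_row_mx mul_col_mx mul_block_col.
by rewrite add_col_mx mul_col_row mulmx_block add_block_mx.
Qed.

Lemma bl3_scal (s : R) : bl3 s%:M 0 0 0 s%:M 0 0 0 s%:M = s%:M.
Proof. by rewrite /bl3 col_mx0 row_mx0 -!scalar_mx_block. Qed.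

Lemma bl3_inj a b c d e f g h i a' b' c' d' e' f' g' h' i' :
  bl3 a b c d e f g h i = bl3 a' b' c' d' e' f' g' h' i' ->
  [/\ [/\ a = a', b = b' & c = c'], [/\ d = d', e = e' & f = f'] & [/\ g = g', h = h' & i = i']].
Proof. by move=> /eq_block_mx[-> /eq_row_mx[-> ->] /eq_col_mx[-> ->] /eq_block_mx[-> -> -> ->]]. Qed.

Lemma bl3_ex (M : 'M[R]_(q + (q + q))) : exists a b c d e f g h i, M = bl3 a b c d e f g h i.
Proof.
pose U := ursubmx M; pose D := dlsubmx M; pose N := drsubmx M : 'M_(q + q).
exists (ulsubmx M), (lsubmx U), (rsubmx U), (usubmx D), (ulsubmx N), (ursubmx N), (dsubmx D), (dlsubmx N), (drsubmx N).
by rewrite /bl3 hsubmxK vsubmxK !submxK.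
Qed.

End Block3.

Section Tensor.
Variables (R : comNzRingType) (q : nat) (o : R).
Hypothesis ho : o ^+ 2 = - 1 - o.

Definition T3 (A C B : 'M[R]_q) (a b c : R) :=
  bl3 A a%:M 0 0 (o *: C) b%:M c%:M 0 (o ^+ 2 *: B).

Lemma T3M2 A B C a b c : T3 A C B a b c *m T3 B A C a b c =
  bl3 (A *m B) (- o ^+ 2 * a *: A) (a * b)%:M (b * c)%:M (o ^+ 2 *: (C *m A)) (- b *: C)
      (- o * c *: B) (c * a)%:M (o *: (B *m C)).
Proof.
have o3 : o ^+ 2 * o ^+ 2 = o by rewrite ho; transitivity (o ^+ 2 + o *+ 2 + 1); [ring|rewrite ho; ring].
rewrite /T3 bl3M !mulmx0 !mul0mx !addr0 !add0r !mul_mx_scalar !mul_scalar_mx.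
rewrite -!scalemxAl -!scalemxAr !scalerA -?scalerDl !scale_scalar_mx o3 -expr2.
by congr bl3; first [congr _%:M; ring|congr (_ *: _); rewrite ?ho; ring].
Qed.

Lemma T3M A B C a b c f : A *m B *m C = f%:M -> B *m C *m A = f%:M -> C *m A *m B = f%:M ->
  T3 A C B a b c *m T3 B A C a b c *m T3 C B A a b c = (f + a * b * c)%:M.
Proof.
have o3 : o ^+ 2 * o = 1 by rewrite ho; transitivity (- o ^+ 2 - o); [ring|rewrite ho; ring].
move=> h1 h2 h3; rewrite T3M2 /T3 bl3M -bl3_scal.
rewrite !mulmx0 !mul_mx_scalar !mul_scalar_mx -!scalemxAl -!scalemxAr !scalerA h1 h2 h3 !scale_scalar_mx.
have -> : - o ^+ 2 * a * o = - a by rewrite mulrAC mulNr o3 mulN1r.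
rewrite [o * o ^+ 2]mulrC o3 !addr0 !add0r.
congr bl3; rewrite -?scalerDl -?raddfD /=.
all: first [congr _%:M; ring | rewrite (_ : _ + _ = 0) ?scale0r //; ring].
Qed.

End Tensor.

Section Wild.
Variable k : closedFieldType.
Hypothesis char0 : [pchar k] =i pred0.

Lemma cube_root : exists o : k, o ^+ 2 = - 1 - o.
Proof.
have [w hw] := solve_monicpoly (fun=> - 1 : k) (ltn0Sn 1).
by exists w; rewrite hw !big_ord_recr big_ord0 /=; ring.
Qed.

Section Vars.
Variables (n : nat) (o : k).
Hypothesis ho : o ^+ 2 = - 1 - o.
Notation S := (series k n).
Notation om := (sC o : S).

Lemma hom : om ^+ 2 = - 1 - om.
Proof. by rewrite -rmorphXn ho rmorphB rmorphN rmorph1. Qed.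

Lemma mxord_row p q r N (A : 'M[S]_(p, q)) (B : 'M[S]_(p, r)) : mxord N A -> mxord N B -> mxord N (row_mx A B).
Proof. by move=> ha hb i j; rewrite mxE; case: split => s; [exact: ha|exact: hb]. Qed.
Lemma mxord_col p q r N (A : 'M[S]_(q, p)) (B : 'M[S]_(r, p)) : mxord N A -> mxord N B -> mxord N (col_mx A B).
Proof. by move=> ha hb i j; rewrite mxE; case: split => s; [exact: ha|exact: hb]. Qed.

Lemma mxord_bl3 q N (a b c d e f g h i : 'M[S]_q) :
  mxord N a -> mxord N b -> mxord N c -> mxord N d -> mxord N e -> mxord N f ->
  mxord N g -> mxord N h -> mxord N i -> mxord N (bl3 a b c d e f g h i).
Proof.
move=> ha hb hc hd he hf hg hh hi.
have H p r p' r' (U : 'M[S]_(p, r)) (V : 'M[S]_(p, r')) (W : 'M[S]_(p', r)) (Z : 'M[S]_(p', r')) :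
  mxord N U -> mxord N V -> mxord N W -> mxord N Z -> mxord N (block_mx U V W Z).
  by move=> *; apply: mxord_col; apply: mxord_row.
by apply: (H) => //; [apply: mxord_row|apply: mxord_col|apply: H].
Qed.

Lemma mxord_scal q N (s : S) : ordge N s -> mxord N (s%:M : 'M_q).
Proof. by move=> h i j; rewrite mxE; case: eqP => _ //; exact: ordge0. Qed.
Lemma mxordZ q N (s : S) (M : 'M_q) : mxord N M -> mxord N (s *: M).
Proof. by move=> h i j; rewrite mxE; apply: ordgeMl; apply: h. Qed.
Lemma mxord0 q N : mxord N (0 : 'M[S]_q).
Proof. by move=> i j; rewrite mxE; exact: ordge0. Qed.

(** Iterated tensor products factor a sum of products of three elements of the maximal ideal, with
    all entries in the maximal ideal. *)
Lemma tensor_ex (s : seq (S * S * S)) :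
  (forall t, t \in s -> [/\ ordge 1 t.1.1, ordge 1 t.1.2 & ordge 1 t.2]) ->
  exists q (A B C : 'M[S]_q), let f := \sum_(t <- s) t.1.1 * t.1.2 * t.2 in
  [/\ (0 < q)%N /\ [/\ mxord 1 A, mxord 1 B & mxord 1 C], A *m B *m C = f%:M, B *m C *m A = f%:M & C *m A *m B = f%:M].
Proof.
elim: s => [|[[a b] c] s ih] hs.
  exists 1%N, 0, 0, 0; rewrite /= big_nil !mulmx0 raddf0; split=> //; split=> //; by split; apply: mxord0.
have [t ts|q [A [B [C [[q0 [hA hB hC]] h1 h2 h3]]]]] := ih; first by apply: hs; rewrite inE ts orbT.
have [/= a1 b1 c1] := hs (a, b, c) (mem_head _ _).
have H (A' B' C' : 'M[S]_q) : mxord 1 A' -> mxord 1 B' -> mxord 1 C' -> mxord 1 (T3 om A' C' B' a b c).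
  move=> hA' hB' hC'; apply: mxord_bl3; try exact: mxord0; try exact: mxord_scal; try exact: mxordZ; by [].
exists (q + (q + q))%N, (T3 om A C B a b c), (T3 om B A C a b c), (T3 om C B A a b c) => /=.
rewrite big_cons /= [_ * _ * _ + _]addrC; split; first by split; [rewrite addn_gt0 q0|split; apply: H].
all: by apply: T3M => //; apply: hom.
Qed.

End Vars.

Lemma lin_indep n (i j : 'I_n) (p q : series k n) : i != j ->
  ordge 2 (svar k i * p + svar k j * q) -> s0 p = 0.
Proof.
move=> ij /(_ (mone i)); rewrite mdeg_mone => /(_ isT); rewrite !svarE.
rewrite sED !smonM mlexx.
have -> : mle (mone j) (mone i) = false.
  by apply/negP => /mleP/(_ j); rewrite !ffunE eqxx eq_sym (negPf ij).
rewrite addr0 => h; rewrite -[RHS]h /s0; congr (p _); apply/ffunP => l; rewrite !ffunE subnn //.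
Qed.


(** Tensoring a factorization of [g] with [(1, l, 0)] still factors [g], as the added product is 0.
    The linear form [l] is the upper right block of the product of two consecutive maps, so an
    isomorphism gives [l_t a = l_t' c] modulo order 2 with [a] not in the maximal ideal; hence
    [x - t y] and [x - t' y] are proportional. *)
Lemma wild_infinite n e (g : series k n.+2) : ordge 3 g -> ~ fint e.+3 g.
Proof.
move=> g3; have [o ho] := cube_root; pose S := series k n.+2; have hom := hom n.+2 ho.
have [g1 [eg hg1]] := ordge_dec g3.
have [g2 hg2] := choice (fun i => ordge_dec (hg1 i)).
pose sq := [seq ((svar k p.1 : S, svar k p.2 : S), g2 p.1 p.2) | p : 'I_n.+2 * 'I_n.+2].
have esq : g = \sum_(t <- sq) t.1.1 * t.1.2 * t.2.
  rewrite big_map big_enum /= eg -(pair_bigA _ (fun i j => svar k i * svar k j * g2 i j)) /=.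
  apply: eq_bigr => i _; rewrite {1}(proj1 (hg2 i)) mulr_sumr; apply: eq_bigr => j _; exact: mulrA.
have [t|q [A [B [C]]]] := tensor_ex ho (s := sq).
  case/mapP => p _ -> /=; split; try exact: ordge_svar; exact: (proj2 (hg2 p.1) p.2).
rewrite /= -esq => -[[q0 [hA hB hC]] h1 h2 h3] {sq esq g1 eg hg1 g2 hg2}.
pose x : S := svar k ord0; pose y : S := svar k ord_max.
pose l (t : nat) : S := x - t%:R * y.
pose Ms t := [:: T3 (sC o) A C B 1 (l t) 0; T3 (sC o) B A C 1 (l t) 0; T3 (sC o) C B A 1 (l t) 0].
have ml t : \prod_(M <- Ms t) M = g%:M :> 'M_(q + (q + q)).
  etransitivity; first exact: prod3.
  etransitivity; first exact: (T3M hom 1 (l t) 0 h1 h2 h3).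
  by rewrite mulr0 addr0.
pose X t : dmf e.+3 g := @pad _ e.+2 _ _ (Ms t) isT (ml t).
move=> /(fint_pigeon char0 (ltn0Sn _) (p := q + (q + q)) (X := X))[//|t [t' [ltt /pad_iso[al [be [hal _ hb _]]]]]].
have l1 s : ordge 1 (l s) by apply: ordgeB; [|apply: ordgeMl]; exact: ordge_svar.
have E0 := hal 0%N isT; have E1 := hal 1%N isT; rewrite /= in E0 E1.
have E01 := etrans (congr1 (mulmx (al 0%N)) (esym (T3M2 hom A B C 1 (l t) 0)))
  (etrans (mor_comp2 E0 E1) (congr1 (mulmx^~ (al 2%N)) (T3M2 hom A B C 1 (l t') 0))).
have I0 := hb 0%N; move: E0 E1 E01 I0; rewrite /T3.
have [a11 [a12 [a13 [a21 [a22 [a23 [a31 [a32 [a33 ->]]]]]]]]] := bl3_ex (al 0%N).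
have [b11 [b12 [b13 [b21 [b22 [b23 [b31 [b32 [b33 ->]]]]]]]]] := bl3_ex (al 1%N).
have [c11 [c12 [c13 [c21 [c22 [c23 [c31 [c32 [c33 ->]]]]]]]]] := bl3_ex (al 2%N).
have [p11 [p12 [p13 [p21 [p22 [p23 [p31 [p32 [p33 ->]]]]]]]]] := bl3_ex (be 0%N).
rewrite !bl3M -(bl3_scal q 1).
case/bl3_inj=> _ [_ D22 _] [_ D32 _].
case/bl3_inj=> -[_ _ F13] _ _.
case/bl3_inj=> -[_ _ H13] _ _.
case/bl3_inj=> -[I11 _ _] _ _.
have lM u (M : 'M[S]_q) v : mxord v M -> mxord v.+1 (l u *: M).
  by move=> hM r' s'; rewrite mxE; apply: (ordgeM (M := 1)).
have o21 : mxord 1 a21.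
  have -> : a21 = (sC o *: C *m b22 + (l t')%:M *m b32) - a22 *m (sC o *: C).
    by apply/esym/(canLR (addrK _)); move: D22; rewrite mulmx1 mulmx0 addr0 mul0mx add0r.
  apply: mxordD; last by apply/mxordN/mxordMl/mxordZ.
  by apply: mxordD; apply: mxordMr; [apply: mxordZ|apply: mxord_scal].
have o31 : mxord 1 a31.
  have -> : a31 = (sC o ^+ 2 *: B *m b32) - a32 *m (sC o *: C).
    apply/esym/(canLR (addrK _)); move: D32; rewrite mulmx1 mulmx0 addr0 mul0mx add0r.
    by rewrite raddf0 mul0mx add0r.
  apply: mxordD; last by apply/mxordN/mxordMl/mxordZ.
  by apply/mxordMr/mxordZ.
have o23 : mxord 1 c23.
  have -> : c23 = (b12 *m (l t)%:M + b13 *m (sC o ^+ 2 *: C)) - B *m c13.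
    by apply/esym/(canLR (addrK _)); move: F13; rewrite mul1mx mulmx0 mul0mx add0r addr0 [X in _ = X -> _]addrC.
  apply: mxordD; last exact/mxordN/mxordMr.
  by apply: mxordD; apply: mxordMl; [apply: mxord_scal|apply: mxordZ].
(* The blocks below [a11] lie in the maximal ideal, so invertibility of the whole matrix gives [a11]
   an entry with nonzero constant term. *)
have [r [s a0]] : exists r s, s0 (a11 r s) != 0.
  apply: contrapT => H; have o11 : mxord 1 a11.
    by move=> r s; apply/ordge1P/eqP; apply: contrapT => /negP h; apply: H; exists r, s.
  have : mxord 1 (1%:M : 'M[S]_q).
    by rewrite -I11; apply: mxordD; [|apply: mxordD]; apply: mxordMl.
  move/(_ (Ordinal q0) (Ordinal q0))/ordge1P; rewrite mxE eqxx rmorph1 => /eqP.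
  by rewrite oner_eq0.
have oU : mxord 2 (l t *: a11 - l t' *: c33).
  have -> : l t *: a11 - l t' *: c33 = A *m B *m c13 + (- sC o ^+ 2 * 1) *: A *m c23
      - (a12 *m (- l t *: C) + a13 *m (sC o *: (B *m C))).
    by move: H13; rewrite !mul1r mul_mx_scalar mul_scalar_mx; apply: addr_shift.
  apply: mxordD; last apply: mxordN; apply: mxordD.
  - by apply/mxordMr/(mxordM (N := 1)).
  - by apply: (mxordM (N := 1)) => //; apply: mxordZ.
  - by apply: mxordMl; rewrite scaleNr; apply/mxordN/lM.
  - by apply/mxordMl/mxordZ/(mxordM (N := 1)).
have := oU r s; rewrite !mxE; set a := a11 r s in a0 *; set c := c33 r s => oac.
have n01 : ord0 != ord_max :> 'I_n.+2 by [].
have e1 : s0 a = s0 c.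
  apply/eqP; rewrite -subr_eq0 -rmorphB /=; apply/eqP.
  by apply: (lin_indep n01 (q := t'%:R * c - t%:R * a)); move: oac; rewrite /l /x /y; congr ordge; ring.
have e2 : s0 (t'%:R * c - t%:R * a) = 0.
  apply: (@lin_indep _ ord_max ord0 _ (a - c)) => //.
  by move: oac; rewrite /l /x /y; congr ordge; ring.
move/eqP: e2; rewrite rmorphB !rmorphM !rmorph_nat /= -e1 subr_eq0 => /eqP /(mulIf a0) h0.
have /(natr_inj_series char0) e6 : t'%:R = t%:R :> S by rewrite -!(rmorph_nat (@sC k n.+2)) h0.
by rewrite e6 ltnn in ltt.
Qed.

End Wild.

(** * Classification *)

Section Classification.
Variable k : closedFieldType.
Hypothesis char0 : [pchar k] =i pred0.
Notation y := (@xl k 0).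

Lemma xX_neq0 m : y ^+ m != 0. Proof. by rewrite expf_neq0 ?x_neq0. Qed.

(** The Klein relations live in two variables, while the chain of squares starts in one: remove a
    square, then add [n] of them. *)
Lemma fint_Anf j n e : fint e.+1 (sext (y ^+ j.+1)) -> fint e.+1 (Anf k j n).
Proof.
move=> /(step_down (xX_neq0 _) char0) h.
exact: (stab_up char0 (stab_Anf k j n) (xX_neq0 _) h).
Qed.

(** Splitting off [y^6], [y^4] or [y^3] rules out [m >= 6] for all these [d], [m >= 4] for [d >= 4],
    and [m = 3] for [d >= 6]. *)
Lemma fint_pow_bound m e : (2 < m)%N -> fint e.+3 (y ^+ m) ->
  [\/ m = 3%N /\ (e.+3 \in [:: 3; 4; 5]), m = 4%N /\ e = 0%N | m = 5%N /\ e = 0%N].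
Proof.
have E i l : y ^+ (i + l) = y ^+ i * y ^+ l by rewrite exprD.
move=> m2 h; have [m6|m6] := leqP 6 m.
  case: (@y6_infinite _ char0 e (y ^+ (m - 6))); rewrite -E subnKC //; exact: xX_neq0.
have [m4|m4] := leqP 4 m.
  case: e h => [|e] h; last first.
    case: (@y4_infinite _ char0 e (y ^+ (m - 4))); rewrite -E subnKC //; exact: xX_neq0.
  by case: m m4 m6 {m2 h} => [|[|[|[|[|[|[|//]]]]]]] // _ _; [constructor 2|constructor 3].
have m3 : m = 3%N by lia.
rewrite {}m3 in h *; constructor 1; split=> //.
case: e h => [|[|[|e]]] // h.
by case: (@y3_infinite _ char0 e 1); rewrite mulr1 //; exact: xX_neq0.
Qed.

(** A vanishing remainder in at least one variable leaves one square with a free variable, where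
    [x2_infinite] applies. *)
Lemma stab_zero_infinite c n (f : series k n) e : (0 < c)%N -> stab (0 : series k c) f -> f != 0 ->
  ~ fint e.+2 f.
Proof.
move=> c0 /stab_zero[->|[m [h [cm r s]]]]; first by rewrite eqxx.
have q0 : sext (0 : series k m) != 0 by rewrite /sext rmorph0 add0r expf_neq0 ?x_neq0.
move=> _ /(stab_down char0 s (req_neq0 r q0)) /(fint_req _ r).1.
case: m h r s cm q0 => [|m] h r s cm _; first by move: (leq_trans c0 cm).
exact: (@x2_infinite k char0 m e).
Qed.

End Classification.

Theorem theorem3p2 (k : closedFieldType) (hk : [pchar k] =i pred0)
  (n : nat) (f : series k n.+1) (hf0 : f <> @szero k n.+1) (hf2 : in_msq f)
  (d : nat) (hd : (2 < d)%N) :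
  finite_MF_type d f <->
  [\/ right_equiv f (Anf k 1 n),
      (d \in [:: 3; 4; 5]%N) /\ right_equiv f (Anf k 2 n),
      d = 3%N /\ right_equiv f (Anf k 3 n)
    | d = 3%N /\ right_equiv f (Anf k 4 n)].
Proof.
case: d hd => [|[|[|e]]] // _; rewrite finite_MF_typeE; split; last first.
  case=> [/right_equivE r|[he /right_equivE r]|[he /right_equivE r]|[he /right_equivE r]];
    apply/(fint_req _ r)/fint_Anf => //.
  - exact: fint_2.
  - move: he; rewrite !inE => /or3P[] /eqP->; [exact: fint_3_3|exact: fint_3_4|exact: fint_3_5].
  - by rewrite he; exact: fint_4_3.
  - by rewrite he; exact: fint_5_3.
move=> hf; have f0 : f != 0 by apply/eqP.
have [c [g [g3 s]]] := splitting hk hf2.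
(* Without remaining variables [g] is a constant of positive order, hence 0, and [f] is a sum of
   squares. *)
case: c g g3 s => [|c] g g3 s.
  have g0 : g = 0 by apply: s0_inj0; rewrite rmorph0; apply/ordge1P/(ordgeW _ g3).
  by constructor 1; apply/right_equivE; rewrite g0 in s; exact: (stab_squares s).
have [g0|g0] := eqVneq g 0.
  by rewrite g0 in s; case: (stab_zero_infinite hk _ s f0 hf).
have hg := stab_down hk s g0 hf; case: c g g3 s g0 hg => [|c] g g3 s g0 hg; last first.
  by case: (wild_infinite hk g3 hg).
have [m m2 r] := one_var_normal hk g0 g3.
have P j : m = j.+1 -> req f (Anf k j n) by move=> em; rewrite em in r; apply: (stab_AnfP s r).
case: (fint_pow_bound hk m2 ((fint_req _ r).1 hg)) => -[em he].
- by constructor 2; split=> //; apply/right_equivE/P.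
- by constructor 3; rewrite he; split=> //; apply/right_equivE/P.
- by constructor 4; rewrite he; split=> //; apply/right_equivE/P.
Qed.
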